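(* In the setting described in the context, suppose that $N=2$, $s>1$, and $$\operatorname*{ess\,sup}_{x\in E}f(x)\le\beta(0),\qquad \operatorname*{ess\,sup}_{x\in D\setminus\bar E}f(x)<\beta(0).$$ Let $\{\bar g_\varepsilon\}$ be a sequence (indexed by $\varepsilon\searrow0$) of local minimizers $\bar g_\varepsilon\in\mathcal F$ of $(P_\varepsilon)$ that converges in $\mathcal W$, and let $\bar y_\varepsilon:=S_\varepsilon(\bar g_\varepsilon)$. Then, for all $\varepsilon>0$ small enough, the set $\{x\in D\setminus\bar E:\ \tfrac1\varepsilon H_\varepsilon'(\bar g_\varepsilon(x))\bar y_\varepsilon(x)-\varepsilon=0\}$ has measure zero and $$\int_{D\setminus\bar E}\frac{1}{\left|\frac1\varepsilon H_\varepsilon'(\bar g_\varepsilon)\bar y_\varepsilon-\varepsilon\right|^2}\,dx<\infty .$$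
   Context: Setting. $D\subset\mathbb R^N$ is a bounded domain of class $C^{1,1}$; $f\in L^2(D)$; $\alpha\ge 0$; $E\subset D$ is a subdomain whose boundary has measure zero and with $d(\bar E,\partial D)>0$ ($d$ denotes the distance between sets); $y_d\in L^2(E)$. $\mathcal W:=L^2(D)\cap H^s(D\setminus\bar E)$ is the Hilbert space of functions in $L^2(D)$ whose restriction to $D\setminus\bar E$ lies in the Sobolev space $H^s(D\setminus\bar E)$, with $\|\cdot\|_{\mathcal W}^2=\|\cdot\|_{L^2(D)}^2+\|\cdot\|_{H^s(D\setminus\bar E)}^2$; for $N=2$ and $s>1$ it is a standard recalled fact that $\mathcal W$ embeds continuously into $L^2(D)\cap L^\infty(D\setminus\bar E)$. $\mathcal F:=\{g\in\mathcal W: g\le 0\text{ a.e. in }E\}$, and $\bar g_{\mathfrak{sh}}\in\mathcal F$ is fixed. The function $\beta:\mathbb R\to\mathbb R$ is non-decreasing, Lipschitz continuous on every interval $[-M,M]$, $M>0$, and directionally differentiable at every point. It is also assumed throughout that, with $\mathcal N$ the set of non-differentiable points of $\beta$: for each $z\in\mathcal N$ there is $\delta_z>0$ such that $\beta$ is convex or concave on $[z-\delta_z,z+\delta_z]$ and differentiable on $[z-\delta_z,z)\cup(z,z+\delta_z]$; $\mathcal N$ is well-ordered; the intervals $[z-\delta_z,z+\delta_z]$, $z\in\mathcal N$, are disjoint; and $\beta$ is continuously differentiable outside $\bigcup_{z\in\mathcal N}[z-\delta_z/4,z+\delta_z/4]$. For $\varepsilon>0$, $H_\varepsilon:\mathbb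 R\to[0,1]$ is $H_\varepsilon(v)=0$ for $v\le0$, $H_\varepsilon(v)=v^2(3\varepsilon-2v)/\varepsilon^3$ for $v\in(0,\varepsilon)$, $H_\varepsilon(v)=1$ for $v\ge\varepsilon$; it is $C^1$ with $H_\varepsilon'(v)=6v(\varepsilon-v)/\varepsilon^3$ on $(0,\varepsilon)$ and $0$ otherwise. State equation: for each $\varepsilon>0$ and $g\in L^2(D)$ there is a unique $y=S_\varepsilon(g)\in H^1_0(D)\cap H^2(D)$ with $-\Delta y+\beta(y)+\frac1\varepsilon H_\varepsilon(g)y=f+\varepsilon g$ in $D$, $y=0$ on $\partial D$. The control problem $(P_\varepsilon)$ is to minimize over $g\in\mathcal F$ the reduced cost $$j_\varepsilon(g)=\int_E(S_\varepsilon(g)-y_d)^2\,dx+\alpha\int_D(1-H_\varepsilon(g))\,dx+\tfrac12\|g-\bar g_{\mathfrak{sh}}\|_{\mathcal W}^2 .$$ $\bar g\in\mathcal F$ is a local minimizer of $(P_\varepsilon)$ (in the $L^2(D)$ sense) if there is $r>0$ with $j_\varepsilon(\bar g)\le j_\varepsilon(g)$ for all $g\in\mathcal F$ with $\|g-\bar g\|_{L^2(D)}\le r$. *)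

(* Defs.v *)
From HB Require Import structures.
From mathcomp Require Export all_boot all_order all_algebra.
From mathcomp Require Export all_classical all_reals all_analysis ess_sup_inf.

Set Implicit Arguments.
Unset Strict Implicit.
Unset Printing Implicit Defensive.

Import Order.TTheory GRing.Theory Num.Theory.
Import numFieldNormedType.Exports.

Local Open Scope classical_set_scope.
Local Open Scope ring_scope.

Notation plane R := (measurableTypeR R * measurableTypeR R)%type.

(* Measurability below is Borel measurability; every Lebesgue class of functions
   has a Borel representative. *)
Definition leb2 (R : realType) : {measure set (plane R) -> \bar R} :=
  (@lebesgue_measure R \x @lebesgue_measure R)%E.

Section PlaneGeometry.
Context {R : realType}.
Implicit Types (x y : plane R) (A D : set (plane R)).

Definition dotp x y : R := x.1 * y.1 + x.2 * y.2.

Definition dist2 x y : R := Num.sqrt ((x.1 - y.1) ^+ 2 + (x.2 - y.2) ^+ 2).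

Definition basis (i : 'I_2) : plane R := if i == ord0 then (1, 0) else (0, 1).

Definition boundary A : set (plane R) := closure A `\` interior A.

Definition set_dist A B : \bar R :=
  ereal_inf [set (dist2 x.1 x.2)%:E | x in A `*` B].

Definition domain D := [/\ D !=set0, open D & connected D].

(* Near each boundary point, after a rotation with orthonormal frame
   (a, b), (-b, a), the set is the strict epigraph of a differentiable function
   with Lipschitz derivative. *)
Definition class_C11 D := forall x0, boundary D x0 ->
  exists (r a b : R) (h : R -> R),
    [/\ 0 < r, a ^+ 2 + b ^+ 2 = 1,
        forall t, derivable h t 1,
        exists k : R, forall t u, `|derive1 h t - derive1 h u| <= k * `|t - u| &
        forall x, dist2 x x0 < r ->
          (D x <-> h (dotp (x - x0) (a, b)) < dotp (x - x0) (- b, a))].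

End PlaneGeometry.

Section SobolevSpaces.
Context {R : realType}.
Local Notation mu := (leb2 R).
Implicit Types (A D : set (plane R)) (u v w phi : plane R -> R).

Definition L2normsq D u : \bar R := (\int[mu]_(x in D) (u x ^+ 2)%:E)%E.

Definition L2 D u := measurable_fun D u /\ (L2normsq D u < +oo)%E.

Fixpoint class_C (k : nat) phi : Prop :=
  continuous phi /\
  if k is k'.+1 then
    forall i, (forall x, derivable phi x (basis i)) /\
              class_C k' (derive phi ^~ (basis i))
  else True.

Definition test_fun D phi :=
  [/\ forall k, class_C k phi,
      compact (closure [set x | phi x != 0]) &
      closure [set x | phi x != 0] `<=` D].

Definition weak_deriv D i u w := forall phi, test_fun D phi ->
  \int[mu]_(x in D) (u x * derive phi x (basis i)) =
  - \int[mu]_(x in D) (w x * phi x).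

Definition H1_with_grad D u (p : 'I_2 -> plane R -> R) :=
  L2 D u /\ forall i, L2 D (p i) /\ weak_deriv D i u (p i).

Definition H2_with_hess D u (h : 'I_2 -> 'I_2 -> plane R -> R) :=
  exists2 p, H1_with_grad D u p & forall i, H1_with_grad D (p i) (h i).

Definition H1_0 D u :=
  exists2 p, H1_with_grad D u p &
  exists2 phi : nat -> plane R -> R, forall n, test_fun D (phi n) &
    (L2normsq D (phi n \- u)%R +
     \sum_(i < 2) L2normsq D ((derive (phi n) ^~ (basis i)) \- p i)%R)%E
      @[n --> \oo] --> 0%E.

(* Real and imaginary parts of
   (2 pi)^-1 * \int_{|x| <= n} u(x) exp(- i x.xi) dx. *)
Definition fourier_trunc_re u (n : nat) (xi : plane R) : R :=
  (2 * pi)^-1 * \int[mu]_(x in [set x | dist2 x (0, 0) <= n%:R])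
                   (u x * cos (dotp x xi)).
Definition fourier_trunc_im u (n : nat) (xi : plane R) : R :=
  - ((2 * pi)^-1 * \int[mu]_(x in [set x | dist2 x (0, 0) <= n%:R])
                      (u x * sin (dotp x xi))).

(* a + i b is the (unitary) Fourier-Plancherel transform of u in L^2(R^2),
   defined as a limit in mean. *)
Definition is_fourier u a b :=
  [/\ L2 setT u, L2 setT a, L2 setT b &
      (L2normsq setT (fourier_trunc_re u n \- a)%R +
       L2normsq setT (fourier_trunc_im u n \- b)%R)%E @[n --> \oo] --> 0%E].

(* For v in H^s(R^2) with transform a + i b, this is the square of its H^s norm. *)
Definition Hs_weight (s : R) a b : \bar R :=
  (\int[mu]_xi ((1 + dotp xi xi) `^ s * (a xi ^+ 2 + b xi ^+ 2))%:E)%E.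

(* H^s(A) is the space of restrictions to A of elements of H^s(R^2), with the
   quotient norm; the infimum is +oo when there is no extension. *)
Definition Hsnormsq (s : R) A u : \bar R :=
  ereal_inf [set r | exists v a b,
    [/\ is_fourier v a b, {ae mu, forall x, A x -> v x = u x} &
        r = Hs_weight s a b]].

Definition Hs (s : R) A u := measurable_fun A u /\ (Hsnormsq s A u < +oo)%E.

Definition Wnormsq (s : R) D E u : \bar R :=
  (L2normsq D u + Hsnormsq s (D `\` closure E) u)%E.

Definition W (s : R) D E u := L2 D u /\ Hs s (D `\` closure E) u.

Definition F_ad (s : R) D E u :=
  W s D E u /\ {ae mu, forall x, E x -> u x <= 0}.

Definition ess_sup_on A u : \bar R :=
  ess_sup mu (fun x => if x \in A then (u x)%:E else -oo%E).

End SobolevSpaces.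

Section Nonlinearity.
Context {R : realType}.
Implicit Types (b : R -> R) (eps : R).

Definition nondiff b : set R := [set z | ~ derivable b z 1].

Definition concave_function_on (A : set R) b := convex_function A (\- b).

Definition beta_assumptions b :=
  [/\ {homo b : x y / x <= y},
      forall M : R, 0 < M -> exists k : R,
        {in `[- M, M] &, forall x y, `|b x - b y| <= k * `|x - y|},
      forall z h, cvg ((fun t => t^-1 * (b (z + t * h) - b z)) @ 0^'+) &
      (forall A, A `<=` nondiff b -> A !=set0 ->
        exists2 z, A z & forall w, A w -> z <= w) /\
      exists delta : R -> R,
      [/\ forall z, nondiff b z ->
            [/\ 0 < delta z,
                convex_function `[z - delta z, z + delta z]%classic b \/
                concave_function_on `[z - delta z, z + delta z]%classic b &
                forall x : R, x \in `[z - delta z, z + delta z] -> x != z ->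
                  derivable b x 1],
          trivIset (nondiff b) (fun z => `[z - delta z, z + delta z]%classic) &
          {within ~` \bigcup_(z in nondiff b)
                       `[z - delta z / 4, z + delta z / 4]%classic,
            continuous (derive1 b)}]].

Definition Heps eps (v : R) : R :=
  if v <= 0 then 0
  else if v < eps then v ^+ 2 * (3 * eps - 2 * v) / eps ^+ 3
  else 1.

End Nonlinearity.

Section ControlProblem.
Context {R : realType}.
Local Notation mu := (leb2 R).
Implicit Types (D E : set (plane R)) (f g y : plane R -> R) (eps : R).

Definition is_state D (beta : R -> R) f eps g y :=
  H1_0 D y /\
  exists2 h, H2_with_hess D y h &
  {ae mu, forall x, D x ->
    - (\sum_(i < 2) h i i x) + beta (y x) + eps^-1 * Heps eps (g x) * y x
    = f x + eps * g x}.

(* Uniqueness of the state up to null sets follows from the monotonicity of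
   beta and need not be part of the specification of S. *)
Definition solution_operator D beta f
    (S : R -> (plane R -> R) -> (plane R -> R)) :=
  forall eps g, 0 < eps -> L2 D g -> is_state D beta f eps g (S eps g).

Definition reduced_cost (alpha s : R) D E yd gsh S eps g : \bar R :=
  (L2normsq E (S eps g \- yd)%R
   + alpha%:E * \int[mu]_(x in D) (1 - Heps eps (g x))%:E
   + 2^-1%:E * Wnormsq s D E (g \- gsh)%R)%E.

Definition local_minimizer alpha s D E yd gsh S eps gbar :=
  F_ad s D E gbar /\
  exists2 r : R, 0 < r &
  forall g, F_ad s D E g -> (L2normsq D (g \- gbar)%R <= (r ^+ 2)%:E)%E ->
    (reduced_cost alpha s D E yd gsh S eps gbar
       <= reduced_cost alpha s D E yd gsh S eps g)%E.

End ControlProblem.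

(* Main.v *)
(* The states are nonpositive: [f + eps * gbar <= beta 0] a.e. in [D] (in [E]
   because [gbar <= 0]; outside [E] because the embedding of H^s into bounded
   functions makes the [gbar] uniformly bounded, so that [eps * gbar] fits in the
   strict gap between [f] and [beta 0]), whence [- Laplacian y <= 0] where [y > 0]
   and the weak maximum principle applies. As [Heps] is nondecreasing, the quantity
   in the denominator is then at most [- eps], so the integrand is at most
   [eps^-2] on a bounded set.

   The maximum principle is obtained without a chain rule for Sobolev functions:
   the weak equation is tested with smooth functions of the smooth approximations
   of [y]. The embedding is obtained from the L^1 bound of the Fourier transform;
   that a function coincides with its inverse Fourier integral is checked on
   rectangles, whose indicators are limits of Poisson integrals. *)
From HB Require Import structures.
Require Import Defs.
From mathcomp Require Import measurable_realfun.
From mathcomp Require Import ring lra.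
Set Implicit Arguments.
Unset Strict Implicit.
Unset Printing Implicit Defensive.
Import Order.TTheory GRing.Theory Num.Theory.
Import numFieldNormedType.Exports.
Local Open Scope classical_set_scope.
Local Open Scope ring_scope.

(** Testing the weak equation with [Gam1 d phi] alone would control only a gradient. The extra
    factor [A - x.1 ^+ 2], whose Laplacian is -2, yields a zero-order term in the positive part and
    so does the work of Poincare's inequality. Two errors then compete: smoothing at scale [d] costs
    a multiple of [d], and the distance from the approximations to [y] is multiplied by [1 / d];
    hence [d] is fixed before the approximation is chosen. The Fourier transform is given only as a
    limit in mean of truncated integrals, so it is tied to its function through L^2 pairings.
    Rectangles suit these: the transform of an indicator decays like [1 / (1 + |s|)] in each
    variable, so it lies in L^2 and its pairings pass to the limit, while Fubini pairs it with the
    inverse integral of integrable functions. That transform is not in L^1, however, and exchanging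
    integrals against it needs a convergence factor: [exp (- t |s|)] in each variable, with the
    Poisson kernel as transform. Rectangles are stable under intersection and generate the Borel
    sets, so equal integrals over them mean equality almost everywhere. *)

Section plane_measure.
Context {R : realType}.
Local Notation mu := (leb2 R).

Lemma leb2_rect (A B : set (measurableTypeR R)) : measurable A -> measurable B ->
  mu (A `*` B) = (lebesgue_measure A * lebesgue_measure B)%E.
Proof. exact: product_measure1E. Qed.

Definition box (n : nat) : set (plane R) :=
  `](- n%:R : R), n%:R]%classic `*` `](- n%:R : R), n%:R]%classic.

Lemma measurable_box n : measurable (box n).
Proof. exact: measurableX. Qed.

Lemma leb2_box_fin (n : nat) : (mu (box n) < +oo)%E.
Proof.
rewrite /box leb2_rect//.
have h : (lebesgue_measure [set` `](- n%:R)%R, (n%:R : R)]] < +oo)%E.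
  by rewrite lebesgue_measure_itv/= lte_fin; case: ifP => _; rewrite ltry.
by rewrite lte_mul_pinfty// ge0_fin_numE.
Qed.

Lemma bigcup_box : \bigcup_n box n = setT.
Proof.
apply/seteqP; split=> // -[x y] _.
exists (Num.bound (`|x| + `|y|)) => //.
set n := Num.bound _.
have hn : `|x| + `|y| < n%:R by apply: archi_boundP; exact: addr_ge0.
have := ler_norm x; have := ler_norm y; have := ler_norm (- x); have := ler_norm (- y).
rewrite !normrN => *; have := normr_ge0 x; have := normr_ge0 y => ? ?.
by split; rewrite /= in_itv/=; apply/andP; split; lra.
Qed.

Lemma leb2_sigma_finite : sigma_finite setT mu.
Proof.
exists box; first by rewrite bigcup_box.
by move=> n; split; [exact: measurable_box|exact: leb2_box_fin].
Qed.

(** A copy of [leb2] that carries the sigma-finite structure, so that Fubini's theorem applies to a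
    product of two planes. *)
Definition leb2s : set (plane R) -> \bar R := leb2 R.

HB.instance Definition _ := Measure.copy leb2s (leb2 R).

HB.instance Definition _ :=
  Measure_isSigmaFinite.Build _ _ _ leb2s leb2_sigma_finite.

(** Measurability refers to the product sigma-algebra, so an open set is written as the countable
    union of the products of balls with rational centres and radii [1 / (n + 1)] that it contains. A
    radius below [e / 2] keeps a product that meets [x] inside the [e]-ball around [x]. *)
Lemma open_measurable2 (U : set (plane R)) : open U -> measurable U.
Proof.
move=> oU.
pose B (i : rat * rat * nat) : set (plane R) :=
  ball (ratr i.1.1 : R) i.2.+1%:R^-1 `*` ball (ratr i.1.2 : R) i.2.+1%:R^-1.
have -> : U = \bigcup_i (if `[< B i `<=` U >] then B i else set0).
  apply/seteqP; split=> [x Ux | x [i _]]; last by case: ifPn => // /asboolP; apply.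
  have /nbhs_ballP [e /= e0 eU] : nbhs x U by exact: open_nbhs_nbhs.
  have [n hn] : exists n : nat, n.+1%:R^-1 < e / 2.
    by exists (Num.truncn (e / 2)^-1); rewrite invf_plt ?posrE ?divr_gt0// truncnS_gt.
  have n0 : 0 < n.+1%:R^-1 :> R by rewrite invr_gt0.
  set d := n.+1%:R^-1 in hn n0.
  have xin (z : R) : exists q : rat, ball (ratr q : R) d z.
    have /rat_in_itvoo[q] : z - d < z + d by lra.
    rewrite in_itv/= => /andP[h1 h2]; exists q.
    by rewrite /ball/= ltr_norml; apply/andP; split; lra.
  have [p hp] := xin x.1; have [q hq] := xin x.2.
  exists (p, q, n) => //; case: ifPn => [_|/asboolPn]; first by split.
  move=> h; exfalso; apply: h => y [/= h1 h2]; apply: eU.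
  move: h1 h2 hp hq; rewrite -/d /ball /= /prod_ball /ball /= !ltr_norml.
  move=> /andP[? ?] /andP[? ?] /andP[? ?] /andP[? ?].
  by split; apply/andP; split; lra.
apply: countable_bigcupT_measurable => [|i]; first exact: countableP.
by case: ifPn => // _; apply: measurableX; apply: open_measurable; exact: ball_open.
Qed.

Lemma closed_measurable2 (U : set (plane R)) : closed U -> measurable U.
Proof.
move=> cU; rewrite -(setCK U); apply: measurableC; apply: open_measurable2.
exact: closed_openC.
Qed.

Lemma continuous_measurable2 (phi : plane R -> R) (D : set (plane R)) :
  continuous phi -> measurable_fun D phi.
Proof.
move=> /continuousP cf; apply: measurable_funTS.
apply: (measurability _ (RGenOpens.measurableE R)).
move=> _ [_ [a [b ->] <-]]; rewrite setTI; apply: open_measurable2.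
exact/cf/interval_open.
Qed.

Lemma bounded_sub_box (D : set (plane R)) : bounded_set D ->
  exists n, D `<=` box n.
Proof.
move=> [M [_ hM]]; exists (Num.bound (`|M| + 1)).
set n := Num.bound _.
have hn : `|M| + 1 < n%:R by apply: archi_boundP; exact: addr_ge0.
move=> x /(hM (`|M| + 1)).
have M1 : M < `|M| + 1 by have := ler_norm M; lra.
move=> /(_ M1) /= hx.
have [h1 h2] : `|x.1| <= `|x| /\ `|x.2| <= `|x|.
  by rewrite prod_normE /= !le_max !lexx orbT.
move: h1 h2; rewrite !ler_norml => /andP[? ?] /andP[? ?].
by split; rewrite /= in_itv/=; apply/andP; split; lra.
Qed.

Lemma bounded_leb2_fin (D : set (plane R)) : measurable D -> bounded_set D ->
  (mu D < +oo)%E.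
Proof.
move=> mD /bounded_sub_box[n Dn].
apply: le_lt_trans (leb2_box_fin n); apply: le_measure => //; rewrite inE//.
exact: measurable_box.
Qed.

End plane_measure.

(** * Square-integrable functions on a measurable set *)

Section L2.
Context {R : realType}.
Local Notation mu := (leb2 R).
Variable D : set (plane R).
Hypothesis mD : measurable D.
Implicit Types u v : plane R -> R.

Lemma L2_integrable u : L2 D u <->
  measurable_fun D u /\ mu.-integrable D (fun x => (u x ^+ 2)%:E).
Proof.
split=> -[mu' h]; split => //.
- apply/integrableP; split.
    by apply/measurable_EFinP; exact: measurable_funX.
  under eq_integral do rewrite gee0_abs ?lee_fin ?sqr_ge0//.
  exact: h.
- have /integrableP[_] := h.
  by under eq_integral do rewrite gee0_abs ?lee_fin ?sqr_ge0//.
Qed.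

Lemma L2_meas u : L2 D u -> measurable_fun D u. Proof. by case. Qed.

Lemma L2_sq u : L2 D u -> mu.-integrable D (EFin \o (fun x => u x ^+ 2)).
Proof. by case/L2_integrable. Qed.

Lemma L2_mul u v : L2 D u -> L2 D v -> mu.-integrable D (EFin \o (fun x => u x * v x)).
Proof.
move=> /L2_integrable[mu' iu] /L2_integrable[mv iv].
have iuv := integrableD mD iu iv.
apply: le_integrable iuv => //.
  by apply/measurable_EFinP; exact: measurable_funM.
move=> x _ /=; rewrite lee_fin [leRHS]ger0_norm ?addr_ge0 ?sqr_ge0//.
rewrite ler_norml; apply/andP; split; nra.
Qed.

Lemma L2_dom u v : measurable_fun D u -> L2 D v ->
  (forall x, D x -> `|u x| <= `|v x|) -> L2 D u.
Proof.
move=> mu' /L2_integrable[mv iv] uv; apply/L2_integrable; split => //.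
apply: le_integrable iv => //.
  by apply/measurable_EFinP; exact: measurable_funX.
move=> x Dx /=; rewrite lee_fin !normrX; rewrite ler_sqr ?nnegrE//; exact: uv.
Qed.

Lemma L2D u v : L2 D u -> L2 D v -> L2 D (fun x => u x + v x).
Proof.
move=> Lu Lv; have [mu' iu] := (L2_integrable u).1 Lu.
have [mv iv] := (L2_integrable v).1 Lv.
apply/L2_integrable; split; first exact: measurable_funD.
have iuv := integrableD mD iu iv.
have i2 := integrableZl mD 2 iuv.
apply: le_integrable i2 => //.
  by apply/measurable_EFinP; apply: measurable_funX; exact: measurable_funD.
move=> x _ /=; rewrite lee_fin ger0_norm ?sqr_ge0//.
rewrite ger0_norm ?mulr_ge0 ?addr_ge0 ?sqr_ge0//.
by have := sqr_ge0 (u x - v x); nra.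
Qed.

Lemma L2_bdmul u v (C : R) : L2 D u -> measurable_fun D v ->
  (forall x, D x -> `|v x| <= C) -> L2 D (fun x => v x * u x).
Proof.
move=> Lu mv vC; have [mu' iu] := (L2_integrable u).1 Lu.
apply/L2_integrable; split; first exact: measurable_funM.
have i2 := integrableZl mD (C ^+ 2) iu.
apply: le_integrable i2 => //.
  by apply/measurable_EFinP; apply: measurable_funX; exact: measurable_funM.
move=> x Dx /=; rewrite lee_fin ger0_norm ?sqr_ge0//.
have C0 : 0 <= C by apply: le_trans (vC _ Dx).
rewrite (ger0_norm (mulr_ge0 (sqr_ge0 _) (sqr_ge0 _))).
have -> : (v x * u x) ^+ 2 = v x ^+ 2 * u x ^+ 2 by ring.
apply: ler_wpM2r; first exact: sqr_ge0.
by rewrite -(real_normK (num_real (v x))) ler_sqr ?nnegrE//; exact: vC.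
Qed.

Lemma L2Z u (C : R) : L2 D u -> L2 D (fun x => C * u x).
Proof.
move=> Lu; apply: (@L2_bdmul _ (fun=> C) `|C|) => //.
Qed.

Lemma L2B u v : L2 D u -> L2 D v -> L2 D (fun x => u x - v x).
Proof.
move=> Lu Lv; have := L2D Lu (L2Z (-1) Lv).
by congr (L2 D _); apply/funext => x; rewrite mulN1r.
Qed.

Lemma L2_bounded v (C : R) : (mu D < +oo)%E -> measurable_fun D v ->
  (forall x, D x -> `|v x| <= C) -> L2 D v.
Proof.
move=> fD mv vC.
have L1 : L2 D (fun=> 1).
  apply/L2_integrable; split; first exact: measurable_cst.
  apply/integrableP; split; first exact: measurable_cst.
  by rewrite integral_cst//= lte_mul_pinfty// ge0_fin_numE.
have := L2_bdmul L1 mv vC.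
by congr (L2 D _); apply/funext => x; rewrite mulr1.
Qed.

Lemma le_Rintegral_ae u v :
  mu.-integrable D (EFin \o u) -> mu.-integrable D (EFin \o v) ->
  {ae mu, forall x, D x -> u x <= v x} ->
  \int[mu]_(x in D) u x <= \int[mu]_(x in D) v x.
Proof.
move=> iu iv uv.
have iB := integrableB mD iv iu.
rewrite -subr_ge0 -RintegralB//.
have mB : measurable_fun D (fun x => v x - u x).
  by have /measurable_int/measurable_EFinP := iB.
(* The difference agrees almost everywhere with its positive part, which is nonnegative at every
   point. *)
have -> : \int[mu]_(x in D) (v x - u x) = \int[mu]_(x in D) Num.max (v x - u x) 0.
  rewrite /Rintegral; congr fine; apply: ae_eq_integral => //.
  - by apply/measurable_EFinP.
  - by apply/measurable_EFinP; exact: measurable_maxr.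
  - apply: filterS uv => x h Dx /=; rewrite max_l//.
    by rewrite subr_ge0; exact: h.
by apply: Rintegral_ge0 => x _; rewrite le_max lexx orbT.
Qed.

End L2.

(** * Weak maximum principle *)

Section smoothed_pos.
Context {R : realType}.
Variable d : R.
Hypothesis d0 : 0 < d.
Implicit Types t s : R.

(* [Gam] regularises [t |-> max t 0 ^+ 2 / 2] at scale [d]; [Gam1] and [Gam2] are
   its first two derivatives. *)
Definition isq t : R := (Num.sqrt (t ^+ 2 + d ^+ 2))^-1.
Definition Gam t : R := (t ^+ 2 + t * (t ^+ 2 + d ^+ 2) * isq t - d * t) / 4.
Definition Gam1 t : R := (2 * t + (2 * t ^+ 2 + d ^+ 2) * isq t - d) / 4.
Definition Gam2 t : R := (2 + t * (2 * t ^+ 2 + 3 * d ^+ 2) * isq t ^+ 3) / 4.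

(** The square root becomes a variable [r] with [r ^+ 2 = t ^+ 2 + d ^+ 2]. Once [d ^+ 2] is
    eliminated, the derivative identities are rational in [r], [t] and [d]. *)
Lemma isqP t : exists r, [/\ d <= r, `|t| <= r, r ^+ 2 = t ^+ 2 + d ^+ 2 & isq t = r^-1].
Proof.
exists (Num.sqrt (t ^+ 2 + d ^+ 2)); split => //.
- by rewrite -[leLHS]gtr0_norm// -sqrtr_sqr ler_wsqrtr// lerDr sqr_ge0.
- by rewrite -sqrtr_sqr ler_wsqrtr// lerDl sqr_ge0.
- by rewrite sqr_sqrtr// addr_ge0 ?sqr_ge0.
Qed.

Lemma is_derive_isq t : is_derive t 1 isq (- t * isq t ^+ 3).
Proof.
have h0 : 0 < t ^+ 2 + d ^+ 2 by rewrite ltr_wpDl ?sqr_ge0// exprn_gt0.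
have d1 : is_derive t 1 (fun t : R => t ^+ 2 + d ^+ 2) (2 * t).
  by apply: is_derive_eq; rewrite /GRing.scale/=; ring.
have d2 := @is_derive1_comp _ _ (fun t : R => t ^+ 2 + d ^+ 2) t _ _ (is_derive1_sqrt h0) d1.
have n0 : Num.sqrt (t ^+ 2 + d ^+ 2) != 0 by rewrite gt_eqF// sqrtr_gt0.
set g := Num.sqrt \o _ in d2.
have dg : derivable g t 1 by exact: (@ex_derive _ _ _ _ _ _ _ d2).
have -> : isq = (fun t => (g t)^-1) by [].
apply: DeriveDef; first exact: derivableV.
rewrite deriveV// derive_val /GRing.scale/= /g/=.
by field; exact: n0.
Qed.

Lemma is_derive_Gam t : is_derive t 1 Gam (Gam1 t).
Proof.
have dJ := is_derive_isq t.
have [r [dr tr r2 E]] := isqP t.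
have r0 : r != 0 by rewrite gt_eqF// (lt_le_trans d0).
rewrite /Gam; apply: is_derive_eq.
rewrite /GRing.scale/= E /Gam1 E.
have -> : d ^+ 2 = r ^+ 2 - t ^+ 2 by rewrite r2; ring.
by field.
Qed.

Lemma is_derive_Gam1 t : is_derive t 1 Gam1 (Gam2 t).
Proof.
have dJ := is_derive_isq t.
have [r [dr tr r2 E]] := isqP t.
have r0 : r != 0 by rewrite gt_eqF// (lt_le_trans d0).
rewrite /Gam1; apply: is_derive_eq.
rewrite /GRing.scale/= /Gam2 E.
have -> : d ^+ 2 = r ^+ 2 - t ^+ 2 by rewrite r2; ring.
by field.
Qed.

(** In the scale-free variable [u = t / r], the second derivative [Gam2] depends on [u] alone, and
    [Gam1] is a quadratic in [u] up to the factor [r] and the shift by [d]. *)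
Lemma isqE t : exists r u, [/\ 0 < d <= r, -1 <= u <= 1, t = u * r,
  d ^+ 2 = r ^+ 2 * (1 - u ^+ 2) & isq t = r^-1].
Proof.
have [r [dr tr r2 E]] := isqP t.
have r0 : 0 < r by rewrite (lt_le_trans d0).
exists r, (t / r); split => //.
- by rewrite d0.
- by rewrite -ler_norml normrM normfV (gtr0_norm r0) ler_pdivrMr// mul1r.
- by rewrite divfK// gt_eqF.
- have -> : d ^+ 2 = r ^+ 2 - t ^+ 2 by rewrite r2; ring.
  by field; rewrite gt_eqF.
Qed.

Lemma Gam2_ge0 t : 0 <= Gam2 t <= 1.
Proof.
have [r [u [/andP[_ dr] /andP[u1 u2] tE d2 E]]] := isqE t.
have r0 : r != 0 by rewrite gt_eqF// (lt_le_trans d0).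
have -> : Gam2 t = (2 + 3 * u - u ^+ 3) / 4.
  by rewrite /Gam2 E d2 tE; field.
(* These two products are [4 * Gam2 d t] and [4 * (1 - Gam2 d t)]. *)
have h1 : 0 <= (1 + u) ^+ 2 * (2 - u) by apply: mulr_ge0; [exact: sqr_ge0|lra].
have h2 : 0 <= (1 - u) ^+ 2 * (2 + u) by apply: mulr_ge0; [exact: sqr_ge0|lra].
by apply/andP; split; lra.
Qed.

(** For [t >= 0] it suffices that [r >= d]. For [t < 0] one has [t ^+ 2 + t * r = ((t + r) ^+ 2 - d
    ^+ 2) / 2] and [- d * t >= 0], whence the loss [d ^+ 2 / 8]. *)
Lemma Gam_lb t : Num.max t 0 ^+ 2 / 4 - d ^+ 2 / 8 <= Gam t.
Proof.
have [r [dr tr r2 E]] := isqP t.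
have r0 : 0 < r by rewrite (lt_le_trans d0).
have -> : Gam t = (t ^+ 2 + t * r - d * t) / 4.
  rewrite /Gam E -r2; field; exact: lt0r_neq0.
have [t0|t0] := leP 0 t.
  by have : 0 <= t * (r - d) by [apply: mulr_ge0; lra]; have := sqr_ge0 d; lra.
have h1 : 0 <= d * - t by rewrite mulr_ge0 ?oppr_ge0 ?ltW.
have := sqr_ge0 (t + r); have -> : 0 ^+ 2 = 0 :> R by rewrite expr0n.
lra.
Qed.

Lemma Gam10 : Gam1 0 = 0.
Proof.
rewrite /Gam1 /isq expr0n/= add0r sqrtr_sqr gtr0_norm//.
by field; exact: lt0r_neq0.
Qed.

Lemma Gam0 : Gam 0 = 0.
Proof. by rewrite /Gam; ring. Qed.

Lemma Gam1_mvt s t : exists c, Gam1 t - Gam1 s = Gam2 c * (t - s).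
Proof.
wlog st : s t / s <= t.
  move=> H; have [/H//|/ltW /H[c Hc]] := leP s t; exists c.
  by rewrite -opprB Hc -mulrN opprB.
have [c _ Hc] := MVT_segment st (fun x _ => is_derive_Gam1 x)
  (derivable_within_continuous (fun x _ => @ex_derive _ _ _ _ _ _ _ (is_derive_Gam1 x))).
by exists c.
Qed.

Lemma Gam1_lip s t : `|Gam1 t - Gam1 s| <= `|t - s|.
Proof.
have [c ->] := Gam1_mvt s t; have /andP[c0 c1] := Gam2_ge0 c.
by rewrite normrM ger0_norm// ler_piMl.
Qed.

Lemma Gam1_bound t : `|Gam1 t| <= `|t|.
Proof. by have := Gam1_lip 0 t; rewrite Gam10 !subr0. Qed.

Lemma Gam1_ge0 t : 0 <= t -> 0 <= Gam1 t.
Proof.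
move=> t0; have [c] := Gam1_mvt 0 t; have /andP[c0 c1] := Gam2_ge0 c.
by rewrite Gam10 !subr0 => ->; exact: mulr_ge0.
Qed.

(** Unlike [max t 0], the smoothed version does not vanish on the negative axis. Its defect [d / 4]
    is the price of testing with a smooth function. *)
Lemma Gam1_le0 t : t <= 0 -> - (d / 4) <= Gam1 t <= 0.
Proof.
move=> t0; apply/andP; split.
  have [r [u [/andP[_ dr] /andP[u1 u2] tE d2 E]]] := isqE t.
  have r0 : 0 < r by rewrite (lt_le_trans d0).
  have -> : Gam1 t = (r * (1 + u) ^+ 2 - d) / 4.
    by rewrite /Gam1 E d2 tE; field; exact: lt0r_neq0.
  have := sqr_ge0 (1 + u); nra.
have [c] := Gam1_mvt 0 t; have /andP[c0 c1] := Gam2_ge0 c.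
by rewrite Gam10 !subr0 => ->; exact: mulr_ge0_le0.
Qed.

End smoothed_pos.

(** Carries the control of the positive part from a smooth approximation [phi] to [y]. *)
Lemma max0_sqr_le (R : realType) (y phi : R) :
  Num.max y 0 ^+ 2 / 2 <= Num.max phi 0 ^+ 2 + (phi - y) ^+ 2.
Proof.
have [y0|y0] := leP y 0.
  by rewrite expr0n/= mul0r addr_ge0 ?sqr_ge0.
have [p0|p0] := leP phi 0.
  have : 0 <= y * - phi by apply: mulr_ge0; [exact: ltW|rewrite oppr_ge0].
  by rewrite expr0n/=; have := sqr_ge0 phi; have := sqr_ge0 y; lra.
by have := sqr_ge0 (2 * phi - y); lra.
Qed.

(* With [rho = A - X ^+ 2], [q] the gradient of [phi] and [X] the first coordinate,
   the first line on the right is [p . grad psi - F psi] for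
   [psi = rho * Gam1 d phi], and the second one is the [X]-derivative of
   [X * Gam d phi], whose integral vanishes; it turns the drift
   [- 2 * X * Gam1 d phi * q1] coming from [rho] into [2 * Gam d phi], which
   controls [max y 0 ^+ 2]. *)
Lemma energy_pointwise (R : realType) (d A rho X F y phi p1 p2 q1 q2 : R) :
  0 < d -> d <= 1 -> X ^+ 2 <= A -> 1 <= rho -> rho <= A ->
  (0 < y -> F <= 0) ->
  Num.max y 0 ^+ 2 / 2 <=
    2 * (p1 * (rho * (Gam2 d phi * q1) - 2 * X * Gam1 d phi)
         + p2 * (rho * (Gam2 d phi * q2)) - F * (rho * Gam1 d phi))
    + 4 * (Gam d phi + X * (Gam1 d phi * q1))
    + 40 * A ^+ 2 * d * (1 + F ^+ 2 + p1 ^+ 2 + p2 ^+ 2 + y ^+ 2)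
    + 40 * A ^+ 2 / d * ((phi - y) ^+ 2 + (q1 - p1) ^+ 2 + (q2 - p2) ^+ 2).
Proof.
move=> d0 dle1 XA rho1 rhoA yF.
set K := 40 * A ^+ 2.
set d1 := rho * (Gam2 d phi * q1) - 2 * X * Gam1 d phi.
set d2 := rho * (Gam2 d phi * q2).
have A1 : 1 <= A by exact: le_trans rhoA.
have rho0 : 0 <= rho by lra.
have A0 : 0 <= A by lra.
have dW := ltW d0.
have /andP[g20 g21] := Gam2_ge0 d0 phi.
have gphi := Gam1_bound d0 phi.
have glip := Gam1_lip d0 y phi.
have glb := Gam_lb d0 phi.
(* The sign of [F] is known only where [y > 0], so the product is estimated at [y] and carried to
   [phi] by the Lipschitz bound [glip]. Where [y <= 0], the defect of [Gam1] enters. *)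
have gy : F * Gam1 d y <= d / 4 * `|F|.
  have [y0|y0] := ltP 0 y.
    have := yF y0; have := Gam1_ge0 d0 (ltW y0); have := normr_ge0 F; nra.
  have /andP[h1 h2] := Gam1_le0 d0 y0.
  have := ler_norm F; have := ler_norm (- F); rewrite normrN; have := normr_ge0 F; nra.
set g2 := Gam2 d phi in g20 g21 d1 d2 *.
set g := Gam1 d phi in gphi glip d1 *.
set gm := Gam d phi in glb *.
set gY := Gam1 d y in glip gy *.
have id1 : 1 <= d^-1 by rewrite -[leLHS]invr1 lef_pV2 ?posrE.
rewrite -[K / d]/(K * d^-1).
have dd : d * d^-1 = 1 by rewrite divff// gt_eqF.
set i := d^-1 in id1 dd *.
have i0 : 0 <= i by lra.
have s1 : Num.max y 0 ^+ 2 / 2 <= 4 * gm + d ^+ 2 / 2 + (phi - y) ^+ 2.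
  by have := max0_sqr_le y phi; lra.
(* Young's inequality with weight [d]: approximation errors receive the factor [1 / d], quantities
   fixed beforehand the factor [d], as in the last two lines of the claim. *)
have young (a b : R) : 2 * (a * b) <= i * a ^+ 2 + d * b ^+ 2.
  have : 0 <= d * (i * a - b) ^+ 2 by rewrite mulr_ge0 ?sqr_ge0// ltW.
  have -> : d * (i * a - b) ^+ 2 = (d * i) * i * a ^+ 2 - 2 * (d * i) * a * b + d * b ^+ 2 by ring.
  rewrite dd; lra.
have s3 : 0 <= rho * (g2 * (q1 ^+ 2 + q2 ^+ 2)).
  by do 2 (apply: mulr_ge0 => //); apply: addr_ge0; exact: sqr_ge0.
have g2sq : g ^+ 2 <= phi ^+ 2.
  by rewrite -(real_normK (num_real g)) -(real_normK (num_real phi)) ler_sqr ?nnegrE.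
have rg : (rho * g2) ^+ 2 <= A ^+ 2.
  have h : rho * g2 <= rho by rewrite ler_piMr.
  by rewrite ler_sqr ?nnegrE//; [lra|exact: mulr_ge0].
have sqd (a b : R) : a ^+ 2 <= 2 * (a - b) ^+ 2 + 2 * b ^+ 2.
  by have := sqr_ge0 (a - 2 * b); nra.
have AA : A <= A ^+ 2 by rewrite expr2 ler_peMl.
have Xg : (X * g) ^+ 2 <= A ^+ 2 * (2 * (phi - y) ^+ 2 + 2 * y ^+ 2).
  rewrite exprMn; apply: ler_pM; rewrite ?sqr_ge0//.
    exact: le_trans AA.
  exact: le_trans g2sq (sqd _ _).
have s4 : d1 ^+ 2 <= 2 * (A ^+ 2 * (2 * (q1 - p1) ^+ 2 + 2 * p1 ^+ 2)) + 8 * (A ^+ 2 * (2 * (phi - y) ^+ 2 + 2 * y ^+ 2)).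
  have h : (rho * g2) ^+ 2 * q1 ^+ 2 <= A ^+ 2 * (2 * (q1 - p1) ^+ 2 + 2 * p1 ^+ 2).
    by apply: ler_pM; rewrite ?sqr_ge0.
  have -> : d1 = (rho * g2) * q1 - 2 * (X * g) by rewrite /d1; ring.
  have := sqr_ge0 ((rho * g2) * q1 + 2 * (X * g)); rewrite -exprMn in h; nra.
have s5 : d2 ^+ 2 <= A ^+ 2 * (2 * (q2 - p2) ^+ 2 + 2 * p2 ^+ 2).
  rewrite /d2 mulrA exprMn; apply: ler_pM; rewrite ?sqr_ge0//.
have s6 : 2 * (F * (rho * g)) <= A * d * (F ^+ 2 + 1) + A * (d * F ^+ 2 + i * (phi - y) ^+ 2).
  have h1 : 2 * (F * gY) <= d * (F ^+ 2 + 1).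
    have : `|F| <= F ^+ 2 + 1.
      by rewrite -(real_normK (num_real F)); have := normr_ge0 F; have := sqr_ge0 (`|F| - 1); nra.
    move=> hF; apply: (@le_trans _ _ (2 * (d / 4 * `|F|))); first lra.
    by have := normr_ge0 F; nra.
  have h2 : 2 * (F * (g - gY)) <= d * F ^+ 2 + i * (phi - y) ^+ 2.
    have h3 := young (g - gY) F.
    have h4 : (g - gY) ^+ 2 <= (phi - y) ^+ 2.
      by rewrite -(real_normK (num_real (g - gY))) -(real_normK (num_real (phi - y))) ler_sqr ?nnegrE.
    have : i * (g - gY) ^+ 2 <= i * (phi - y) ^+ 2 by rewrite ler_wpM2l//; lra.
    lra.
  have -> : 2 * (F * (rho * g)) = rho * (2 * (F * gY) + 2 * (F * (g - gY))) by ring.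
  have h5 : 0 <= d * (F ^+ 2 + 1) + (d * F ^+ 2 + i * (phi - y) ^+ 2).
    have hF := sqr_ge0 F; have he := sqr_ge0 (phi - y).
    by apply: addr_ge0; [|apply: addr_ge0]; apply: mulr_ge0 => //; lra.
  apply: (@le_trans _ _ (rho * (d * (F ^+ 2 + 1) + (d * F ^+ 2 + i * (phi - y) ^+ 2)))).
    by rewrite ler_wpM2l//; lra.
  rewrite -[A * d * _]mulrA -mulrDr ler_wpM2r//.
have y1 := young (q1 - p1) d1.
have y2 := young (q2 - p2) d2.
have e1 : q1 * d1 + q2 * d2 = rho * (g2 * (q1 ^+ 2 + q2 ^+ 2)) - 2 * (X * (g * q1)).
  by rewrite /d1 /d2; ring.
have d12 : d * d1 ^+ 2 <= d * (2 * (A ^+ 2 * (2 * (q1 - p1) ^+ 2 + 2 * p1 ^+ 2)) + 8 * (A ^+ 2 * (2 * (phi - y) ^+ 2 + 2 * y ^+ 2))).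
  by rewrite ler_wpM2l//; lra.
have d22 : d * d2 ^+ 2 <= d * (A ^+ 2 * (2 * (q2 - p2) ^+ 2 + 2 * p2 ^+ 2)).
  by rewrite ler_wpM2l//; lra.
apply: (@le_trans _ _ (2 * (p1 * d1 + p2 * d2 - F * (rho * g)) + 4 * (gm + X * (g * q1))
  + (d ^+ 2 / 2 + (phi - y) ^+ 2 + i * (q1 - p1) ^+ 2 + i * (q2 - p2) ^+ 2
    + d * (2 * (A ^+ 2 * (2 * (q1 - p1) ^+ 2 + 2 * p1 ^+ 2)) + 8 * (A ^+ 2 * (2 * (phi - y) ^+ 2 + 2 * y ^+ 2)))
    + d * (A ^+ 2 * (2 * (q2 - p2) ^+ 2 + 2 * p2 ^+ 2))
    + (A * d * (F ^+ 2 + 1) + A * (d * F ^+ 2 + i * (phi - y) ^+ 2))))).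
  rewrite !mulrBl in y1 y2; lra.
(* Only the error terms remain. As [d <= 1 <= A], each of their coefficients is a multiple of
   [A ^+ 2 * d] or [A ^+ 2 / d] well below 40, a common crude bound. *)
rewrite -!addrA lerD2l lerD2l.
set B := A ^+ 2 in AA rg Xg s4 s5 d12 d22 *.
rewrite /K -/B.
have P1 := sqr_ge0 p1; have P2 := sqr_ge0 p2; have PY := sqr_ge0 y.
have PF := sqr_ge0 F; have Pe := sqr_ge0 (phi - y).
have Pq1 := sqr_ge0 (q1 - p1); have Pq2 := sqr_ge0 (q2 - p2).
set P := p1 ^+ 2 in P1 *; set P' := p2 ^+ 2 in P2 *; set Y := y ^+ 2 in PY *.
set F2 := F ^+ 2 in PF *; set e := (phi - y) ^+ 2 in Pe *.
set Q1 := (q1 - p1) ^+ 2 in Pq1 *; set Q2 := (q2 - p2) ^+ 2 in Pq2 *.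
have B1 : 1 <= B by lra.
have Bd : d <= B * d by rewrite ler_peMl// ltW.
have Ad : A * d <= B * d by rewrite ler_wpM2r// ltW.
have Bi : B * d <= B * i by rewrite ler_wpM2l//; lra.
have i_B : i <= B * i by rewrite ler_peMl//; lra.
have Ai : A * i <= B * i by rewrite ler_wpM2r//; lra.
have c1 : d ^+ 2 <= B * d by apply: le_trans Bd; rewrite expr2 ler_piMl// ltW.
have Bi1 : 1 <= B * i by lra.
have ineq (a b z : R) : 0 <= z -> a <= b -> a * z <= b * z by move=> ? ?; rewrite ler_wpM2r.
have m1 := ineq _ _ _ PF Ad; have m2 := ineq _ _ _ Pe Ai; have m3 := ineq _ _ _ Pe Bi.
have m4 := ineq _ _ _ Pq1 Bi; have m5 := ineq _ _ _ Pq2 Bi; have m6 := ineq _ _ _ Pq1 i_B.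
have m7 := ineq _ _ _ Pq2 i_B; have m8 := ineq _ _ _ Pe Bi1.
have Bd0 : 0 <= B * d by rewrite mulr_ge0//; lra.
have Bi0 : 0 <= B * i by lra.
have n1 := mulr_ge0 Bd0 P1; have n2 := mulr_ge0 Bd0 P2; have n3 := mulr_ge0 Bd0 PY.
have n4 := mulr_ge0 Bd0 PF; have n5 := mulr_ge0 Bi0 Pe; have n6 := mulr_ge0 Bi0 Pq1.
have n7 := mulr_ge0 Bi0 Pq2.
lra.
Qed.

(** * Functions with continuous partial derivatives of a given order *)

Section class_C.
Context {R : realType}.
Implicit Types (f phi psi : plane R -> R) (x v : plane R).

(** Smoothness is expressed by directional derivatives, so the chain rule is reduced to one variable
    by restriction to a line. *)
Lemma is_derive_line f x v (df : R) :
  is_derive (0 : R) 1 (fun h : R => f (h *: v + x)) df <-> is_derive x v f df.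
Proof.
set g := (fun h : R => f (h *: v + x)).
have E : (fun h : R => h^-1 *: ((g \o shift 0) (h *: 1) - g 0))
     = (fun h : R => h^-1 *: ((f \o shift x) (h *: v) - f x)).
  apply/funext => h /=; rewrite /g scale0r add0r addr0.
  by rewrite [X in f (X *: v + x)](_ : _ = h)// /GRing.scale/= mulr1.
by split => -[]; rewrite /derivable /derive ?E => h1 h2; apply: DeriveDef;
  rewrite /derivable /derive ?E.
Qed.

Lemma is_derive_comp_scalar f (J : R -> R) x v (df dJ : R) :
  is_derive (f x) 1 J dJ -> is_derive x v f df -> is_derive x v (J \o f) (dJ * df).
Proof.
move=> hJ /is_derive_line hf; apply/is_derive_line.
apply: (@is_derive1_comp _ J (fun h : R => f (h *: v + x)) 0 dJ df _ hf).
by rewrite scale0r add0r.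
Qed.

Lemma is_derive_fst x v : is_derive x v (fun z : plane R => z.1) v.1.
Proof.
apply/is_derive_line.
have -> : (fun h : R => (h *: v + x).1) = (fun h : R => h * v.1 + x.1) by [].
by apply: is_derive_eq; rewrite /GRing.scale/=; ring.
Qed.

Lemma class_C_cont k phi : class_C k phi -> continuous phi.
Proof. by case: k => [|k] []. Qed.

Lemma class_C_derivable k phi x i : class_C k.+1 phi -> derivable phi x (basis i).
Proof. by case=> _ /(_ i)[]. Qed.

Lemma class_C_derive k phi i : class_C k.+1 phi -> class_C k (derive phi ^~ (basis i)).
Proof. by case=> _ /(_ i)[]. Qed.

Lemma class_CW k phi : class_C k.+1 phi -> class_C k phi.
Proof.
elim: k phi => [phi []//|k IH phi [cphi h]].
split => // i; have [h1 h2] := h i; split => //.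
exact: IH.
Qed.

Lemma class_C_cst k (c : R) : class_C k (fun=> c).
Proof.
elim: k c => [c|k IH c]; split => //; first exact: cst_continuous.
  exact: cst_continuous.
move=> i; split; first by move=> x; exact: derivable_cst.
suff -> : derive (fun=> c) ^~ (basis i) = (fun=> 0) :> (plane R -> R) by exact: IH.
by apply/funext => x; exact: derive_cst.
Qed.

Lemma class_CD k phi psi : class_C k phi -> class_C k psi ->
  class_C k (fun x => phi x + psi x).
Proof.
elim: k phi psi => [|k IH] phi psi [c1 h1] [c2 h2]; split => //.
- by move=> x; apply: cvgD; [exact: c1|exact: c2].
- by move=> x; apply: cvgD; [exact: c1|exact: c2].
move=> i; have [d1 e1] := h1 i; have [d2 e2] := h2 i; split.
  by move=> x; exact: derivableD.
rewrite (_ : (fun x => _) = (fun x => derive phi x (basis i) + derive psi x (basis i))).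
  exact: IH.
by apply/funext => x; exact: deriveD.
Qed.

Lemma class_CM k phi psi : class_C k phi -> class_C k psi ->
  class_C k (fun x => phi x * psi x).
Proof.
elim: k phi psi => [|k IH] phi psi h1 h2.
  by split => // x; apply: cvgM; [exact: (class_C_cont h1)|exact: (class_C_cont h2)].
split; first by move=> x; apply: cvgM; [exact: (class_C_cont h1)|exact: (class_C_cont h2)].
move=> i; split.
  by move=> x; apply: derivableM; [exact: (@class_C_derivable k)|exact: (@class_C_derivable k)].
rewrite (_ : (fun x => _) = (fun x => phi x * derive psi x (basis i) + psi x * derive phi x (basis i))).
  by apply: class_CD; apply: IH; (exact: class_CW || exact: class_C_derive).
by apply/funext => x; rewrite deriveM//; exact: (@class_C_derivable k).
Qed.

Lemma class_CX k phi n : class_C k phi -> class_C k (fun x => phi x ^+ n).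
Proof.
move=> h; elim: n => [|n IH].
  by rewrite (_ : (fun x => _) = (fun=> 1)); [exact: class_C_cst|].
rewrite (_ : (fun x => _) = (fun x => phi x * phi x ^+ n)); first exact: class_CM.
by apply/funext => x; rewrite exprS.
Qed.

Lemma class_CZ k (c : R) phi : class_C k phi -> class_C k (fun x => c * phi x).
Proof. by move=> h; apply: class_CM => //; exact: class_C_cst. Qed.

Lemma class_C_fst k : class_C k (fun x : plane R => x.1).
Proof.
have c : continuous (fun x : plane R => x.1) by move=> x; exact: cvg_fst.
case: k => [|k]; split => // i; split.
  by move=> x; exact: (@ex_derive _ _ _ _ _ _ _ (is_derive_fst x (basis i))).
rewrite (_ : (fun x => _) = (fun=> (basis i).1)); first exact: class_C_cst.
by apply/funext => x; exact: (@derive_val _ _ _ _ _ _ _ (is_derive_fst x (basis i))).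
Qed.

(** The function [isq] solves [isq' = - t * isq ^+ 3], so a partial derivative of [isq d \o phi] is
    again a polynomial in [phi], [isq d \o phi] and a derivative of [phi]; the induction on [k]
    closes. *)
Lemma class_C_isq k (d : R) phi : 0 < d -> class_C k phi ->
  class_C k (fun x => isq d (phi x)).
Proof.
move=> d0; have cJ : continuous (isq d).
  move=> t; apply: differentiable_continuous; apply/derivable1_diffP.
  exact: (@ex_derive _ _ _ _ _ _ _ (is_derive_isq d0 t)).
elim: k phi => [|k IH] phi h.
  by split => // x; apply: continuous_comp; [exact: (class_C_cont h)|exact: cJ].
split; first by move=> x; apply: continuous_comp; [exact: (class_C_cont h)|exact: cJ].
have D i x := is_derive_comp_scalar (is_derive_isq d0 (phi x))
   (derivableP (@class_C_derivable k phi x i h)).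
move=> i; split; first by move=> x; exact: (@ex_derive _ _ _ _ _ _ _ (D i x)).
rewrite (_ : (fun x => _) = (fun x => -1 * (phi x * isq d (phi x) ^+ 3) * derive phi x (basis i))).
  apply: class_CM; last exact: class_C_derive.
  apply/class_CZ/class_CM; first exact: class_CW.
  by apply: class_CX; apply: IH; exact: class_CW.
apply/funext => x; rewrite (@derive_val _ _ _ _ _ _ _ (D i x)); ring.
Qed.

Lemma class_C_Gam k (d : R) phi : 0 < d -> class_C k phi ->
  class_C k (fun x => Gam d (phi x)).
Proof.
move=> d0 h.
rewrite (_ : (fun x => _) = (fun x => 4^-1 * (phi x ^+ 2 +
  (phi x * (phi x ^+ 2 + d ^+ 2) * isq d (phi x) + - d * phi x)))).
  apply/class_CZ/class_CD; first exact: class_CX.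
  apply: class_CD; last exact: class_CZ.
  apply: class_CM; last exact: class_C_isq.
  by apply: class_CM => //; apply: class_CD; [exact: class_CX|exact: class_C_cst].
by apply/funext => x; rewrite /Gam; field.
Qed.

Lemma class_C_Gam1 k (d : R) phi : 0 < d -> class_C k phi ->
  class_C k (fun x => Gam1 d (phi x)).
Proof.
move=> d0 h.
rewrite (_ : (fun x => _) = (fun x => 4^-1 * (2 * phi x +
  ((2 * phi x ^+ 2 + d ^+ 2) * isq d (phi x) + - d)))).
  apply/class_CZ/class_CD; first exact: class_CZ.
  apply: class_CD; last exact: class_C_cst.
  apply: class_CM; last exact: class_C_isq.
  by apply: class_CD; [apply/class_CZ/class_CX|exact: class_C_cst].
by apply/funext => x; rewrite /Gam1; field.
Qed.

Lemma is_derive_slice phi (t y : R) : class_C 1 phi ->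
  is_derive t (1 : R) (fun s : R => phi (s, y)) (derive phi (t, y) (basis ord0)).
Proof.
move=> cphi.
have /is_derive_line h1 := derivableP (@class_C_derivable 0 phi (t, y) ord0 cphi).
have h2 : is_derive t (1 : R) (fun s : R => s - t) 1.
  by apply: is_derive_eq; rewrite subr0.
have h3 : is_derive (t - t) (1 : R) (fun h : R => phi (h *: basis ord0 + (t, y)))
    (derive phi (t, y) (basis ord0)) by rewrite subrr.
have := @is_derive1_comp R (fun h : R => phi (h *: basis ord0 + (t, y))) (fun s : R => s - t) t _ _ h3 h2; rewrite mulr1.
have -> // : (fun h : R => phi (h *: basis ord0 + (t, y))) \o (fun s : R => s - t) = (fun s => phi (s, y)).
apply/funext => s; rewrite /basis /=; congr phi; congr pair.
  by change ((s - t) * 1 + t = s); ring.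
by change ((s - t) * 0 + y = y); rewrite mulr0 add0r.
Qed.

End class_C.

(** * Test functions *)

Section test_functions.
Context {R : realType}.
Local Notation mu := (leb2 R).
Implicit Types (D : set (plane R)) (phi psi : plane R -> R).

Lemma test_fun_ext D phi psi : test_fun D phi -> (forall k, class_C k psi) ->
  [set x | psi x != 0] `<=` closure [set x | phi x != 0] -> test_fun D psi.
Proof.
move=> [_ cphi sphi] cpsi sub.
have sub' : closure [set x | psi x != 0] `<=` closure [set x | phi x != 0].
  by rewrite (closure_id (closure [set x | phi x != 0])).1; [exact: closure_subset|exact: closed_closure].
split => //; last exact: subset_trans sphi.
by apply: subclosed_compact cphi sub'; exact: closed_closure.
Qed.

Lemma test_fun0 D phi psi : test_fun D phi -> (forall k, class_C k psi) ->
  (forall x, phi x = 0 -> psi x = 0) -> test_fun D psi.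
Proof.
move=> h cpsi h0; apply: test_fun_ext h cpsi _ => x /= px; apply: subset_closure => /=.
by apply: contra px => /eqP/h0 ->.
Qed.

Lemma test_fun_derive D phi i : test_fun D phi -> test_fun D (derive phi ^~ (basis i)).
Proof.
move=> h; apply: (test_fun_ext h) => [k|x /= dx].
  by apply: class_C_derive; case: h.
apply: contrapT => nx; move/eqP: dx; apply.
have : nbhs x (~` closure [set x | phi x != 0]).
  by apply: open_nbhs_nbhs; split => //; apply: closed_openC; exact: closed_closure.
move=> hn; have : {near x, phi =1 cst 0}.
  near=> z; have : (~` closure [set x | phi x != 0]) z by near: z.
  move=> nz; apply: contrapT => /eqP pz; apply: nz; exact: subset_closure.
move=> E; rewrite (near_eq_derive _ E) ?derive_cst//.
Unshelve. all: end_near. Qed.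

Lemma test_fun_out D phi x : test_fun D phi -> ~ D x -> phi x = 0.
Proof.
move=> [_ _ s] nD; apply: contrapT => /eqP px; apply: nD; apply: s.
exact: subset_closure.
Qed.

Lemma test_fun_bounded D phi : test_fun D phi -> exists C : R, forall x, `|phi x| <= C.
Proof.
move=> [ck cK _]; have cphi := class_C_cont (ck 0%N).
set K := closure _ in cK.
have := @continuous_compact _ _ phi K (continuous_subspaceT cphi) cK.
move=> /compact_bounded [M [_ hM]].
exists (`|M| + 1) => x.
have [Kx|nK] := pselect (K x).
  by apply: (hM (`|M| + 1)); [have := ler_norm M; lra|exists x].
have -> : phi x = 0.
  by apply: contrapT => /eqP px; apply: nK; exact: subset_closure.
by rewrite normr0 addr_ge0.
Qed.

Lemma test_fun_meas D phi (A : set (plane R)) : test_fun D phi -> measurable_fun A phi.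
Proof. by move=> [ck _ _]; apply: continuous_measurable2; exact: class_C_cont (ck 0%N). Qed.

Lemma test_fun_L2 D phi : measurable D -> (mu D < +oo)%E -> test_fun D phi -> L2 D phi.
Proof.
move=> mD fD h; have [C hC] := test_fun_bounded h.
by apply: (@L2_bounded _ _ mD _ C) => //; exact: test_fun_meas h.
Qed.

(* Fubini reduces the claim to the fundamental theorem of calculus on horizontal lines. *)
Lemma test_fun_derive_int0 D phi : open D -> bounded_set D -> test_fun D phi ->
  \int[mu]_(x in D) (derive phi x (basis ord0)) = 0.
Proof.
move=> oD bD h.
have mD := open_measurable2 oD.
pose f : plane R -> R := derive phi ^~ (basis ord0).
have hd : test_fun D f := test_fun_derive ord0 h.
change (\int[mu]_(x in D) f x = 0).
have [n Dn] := bounded_sub_box bD.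
have [C hC] := test_fun_bounded hd.
have mf A : measurable_fun A f by exact: test_fun_meas hd.
have f0 x : ~ D x -> f x = 0 by exact: test_fun_out hd.
have -> : \int[mu]_(x in D) f x = \int[mu]_x f x.
  rewrite Rintegral_mkcond; apply: eq_Rintegral => x _.
  by rewrite patchE; case: ifPn => // /negP; rewrite inE => /f0.
have if_ : mu.-integrable setT (EFin \o f).
  have iB : mu.-integrable setT (fun x => (C * \1_(box n) x)%:E).
    apply/integrableP; split.
      by apply/measurable_EFinP; apply: measurable_funM => //; exact: measurable_indic (measurable_box n).
    have C0 : 0 <= C by apply: le_trans (hC point).
    under eq_integral do rewrite gee0_abs ?lee_fin ?mulr_ge0// EFinM.
    rewrite ge0_integralZl_EFin//; last first.
      by apply/measurable_EFinP; exact: measurable_indic (measurable_box n).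
    rewrite integral_indic//; last exact: measurable_box.
    by rewrite setIT lte_mul_pinfty// leb2_box_fin.
  apply: le_integrable iB => //; first exact/measurable_EFinP.
  move=> x _ /=; rewrite lee_fin normrM indicE.
  have [xB|xB] := boolP (x \in box n).
    by rewrite normr1 mulr1; apply: le_trans (hC x) _; exact: ler_norm.
  rewrite f0 ?normr0 ?mulr0//.
  by move=> /Dn; move: xB; rewrite notin_setE.
rewrite /Rintegral -[X in fine X](@integral21_prod_meas1 _ _ _ _ R lebesgue_measure lebesgue_measure (EFin \o f))//.
rewrite (_ : (\int[_]_y _)%E = 0%E)//.
apply: integral0_eq => y _; rewrite /fubini_G /=.
have [ck _ _] := h.
pose F (t : R) : R := phi (t, y).
have dF (t : R) : is_derive t (1 : R) F (f (t, y)) by exact: is_derive_slice (ck 1%N).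
have cf : continuous (fun t : R => f (t, y)).
  move=> t; apply: differentiable_continuous; apply/derivable1_diffP.
  have [cd _ _] := hd.
  exact: (@ex_derive _ _ _ _ _ _ _ (is_derive_slice t y (cd 1%N))).
(* The box contains its right edge, so [n] is enlarged by one: [phi] then vanishes at both ends of
   the interval and the boundary terms are 0. *)
pose N : R := n.+1%:R.
have N0 : - N < N by rewrite gtrN.
have nout t : t \notin `[- N, N] -> f (t, y) = 0.
  move=> tN; apply: f0 => /Dn[/=]; rewrite in_itv/= => /andP[h1 h2] _.
  move: tN; rewrite in_itv/= => /negP; apply.
  have : n%:R < N by rewrite ltr_nat.
  by move=> ?; apply/andP; split; lra.
transitivity (\int[lebesgue_measure]_(t in [set` `[(- N)%R, N]]) (f (t, y))%:E)%E.
  rewrite [RHS]integral_mkcond; apply: eq_integral => t _.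
  by rewrite patchE; case: ifPn => // tn; rewrite nout//; move: tn; rewrite mem_setE.
rewrite (@continuous_FTC2 _ _ F)//.
- rewrite /F !(@test_fun_out D phi)//.
  + by rewrite subee.
  + by move=> /Dn[/=]; rewrite in_itv/= => /andP[h1 h2] _; have : n%:R < N by [rewrite ltr_nat]; lra.
  + by move=> /Dn[/=]; rewrite in_itv/= => /andP[h1 h2] _; have : n%:R < N by [rewrite ltr_nat]; lra.
- exact: continuous_subspaceT.
- have cF t : F x @[x --> t] --> F t.
    apply: differentiable_continuous; apply/derivable1_diffP.
    exact: (@ex_derive _ _ _ _ _ _ _ (dF t)).
  split.
  + by move=> t _; exact: (@ex_derive _ _ _ _ _ _ _ (dF t)).
  + exact: cvg_at_right_filter.
  + exact: cvg_at_left_filter.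
- by move=> t _; rewrite derive1E; exact: (@derive_val _ _ _ _ _ _ _ (dF t)).
Qed.

End test_functions.

Section Rint.
Context (d0 : measure_display) (T : measurableType d0) (R : realType).
Variables (mu : {measure set T -> \bar R}) (D : set T).
Hypothesis mD : measurable D.
Implicit Types f g : T -> R.

Lemma integrableRD f g : mu.-integrable D (EFin \o f) -> mu.-integrable D (EFin \o g) ->
  mu.-integrable D (EFin \o (fun x => f x + g x)).
Proof. exact: integrableD. Qed.

Lemma integrableRZ (c : R) f : mu.-integrable D (EFin \o f) ->
  mu.-integrable D (EFin \o (fun x => c * f x)).
Proof. exact: integrableZl. Qed.

Lemma integrableRB f g : mu.-integrable D (EFin \o f) -> mu.-integrable D (EFin \o g) ->
  mu.-integrable D (EFin \o (fun x => f x - g x)).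
Proof. exact: integrableB. Qed.

Lemma EFin_Rintegral f : mu.-integrable D (EFin \o f) ->
  (\int[mu]_(x in D) f x)%:E = (\int[mu]_(x in D) (f x)%:E)%E.
Proof. by move=> h; rewrite /Rintegral fineK//; exact: integrable_fin_num h. Qed.

End Rint.

(** * The energy estimate and the weak maximum principle *)

Section max_principle.
Context {R : realType}.
Local Notation mu := (leb2 R).
Local Notation o1 := (lift ord0 ord0 : 'I_2).

Lemma sum_ord2 (V : nmodType) (f : 'I_2 -> V) : \sum_(i < 2) f i = f ord0 + f o1.
Proof. by rewrite big_ord_recl big_ord1. Qed.

Lemma esum_ord2 (f : 'I_2 -> \bar R) : (\sum_(i < 2) f i = f ord0 + f o1)%E.
Proof. by rewrite big_ord_recl big_ord1. Qed.

Lemma L2normsqE (D : set (plane R)) (u : plane R -> R) : measurable D -> L2 D u ->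
  L2normsq D u = (\int[mu]_(x in D) (u x ^+ 2))%:E.
Proof. by move=> mD Lu; rewrite EFin_Rintegral//; exact: L2_sq Lu. Qed.

Lemma L2_max0 (D : set (plane R)) (u : plane R -> R) : measurable D -> L2 D u ->
  L2 D (fun x => Num.max (u x) 0).
Proof.
move=> mD Lu; apply: (L2_dom mD _ Lu).
  by apply: measurable_maxr; [exact: L2_meas Lu|exact: measurable_cst].
by move=> x _; case: (leP (u x) 0) => // _; rewrite normr0.
Qed.

Lemma energy_estimate (D : set (plane R)) (y F p1 p2 phi : plane R -> R)
    (A d : R) :
  open D -> bounded_set D -> L2 D y -> L2 D F -> L2 D p1 -> L2 D p2 ->
  test_fun D phi ->
  (forall psi, test_fun D psi -> \int[mu]_(x in D) (F x * psi x) =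
     \int[mu]_(x in D) (p1 x * derive psi x (basis ord0)) +
     \int[mu]_(x in D) (p2 x * derive psi x (basis o1))) ->
  {ae mu, forall x, D x -> 0 < y x -> F x <= 0} ->
  (forall x, D x -> x.1 ^+ 2 + 1 <= A) -> 0 < d -> d <= 1 ->
  \int[mu]_(x in D) (Num.max (y x) 0 ^+ 2 / 2) <=
    40 * A ^+ 2 * d * \int[mu]_(x in D) (1 + F x ^+ 2 + p1 x ^+ 2 + p2 x ^+ 2 + y x ^+ 2)
  + 40 * A ^+ 2 / d * \int[mu]_(x in D) ((phi x - y x) ^+ 2 +
      (derive phi x (basis ord0) - p1 x) ^+ 2 + (derive phi x (basis o1) - p2 x) ^+ 2).
Proof.
move=> oD bD Ly LF Lp1 Lp2 tphi weak Fneg xA d0 d1.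
have mD := open_measurable2 oD.
have fD := bounded_leb2_fin mD bD.
have [ck _ _] := tphi.
pose rho (x : plane R) : R := A + -1 * x.1 ^+ 2.
(* The two functions of the pointwise inequality. [Gam] and [Gam1] vanish at 0, so [psi] and [chi]
   vanish wherever [phi] does and are again test functions on [D]. *)
pose psi (x : plane R) : R := rho x * Gam1 d (phi x).
pose chi (x : plane R) : R := x.1 * Gam d (phi x).
have Crho k : class_C k rho.
  by apply: class_CD; [exact: class_C_cst|apply/class_CZ/class_CX; exact: class_C_fst].
have tpsi : test_fun D psi.
  apply: (test_fun0 tphi) => [k|x px]; last by rewrite /psi px Gam10// mulr0.
  by apply: class_CM => //; exact: class_C_Gam1.
have tchi : test_fun D chi.
  apply: (test_fun0 tphi) => [k|x px]; last by rewrite /chi px Gam0 mulr0.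
  by apply: class_CM; [exact: class_C_fst|exact: class_C_Gam].
have dphi x i := derivableP (@class_C_derivable _ 0 phi x i (ck 1%N)).
have dG x i := is_derive_comp_scalar (is_derive_Gam d0 (phi x)) (dphi x i).
have dG1 x i := is_derive_comp_scalar (is_derive_Gam1 d0 (phi x)) (dphi x i).
have drho x i : is_derive x (basis i) rho (- (2 * x.1 * (basis i).1)).
  have hJ : is_derive x.1 (1 : R) (fun t : R => A + -1 * t ^+ 2) (- (2 * x.1)).
    by apply: is_derive_eq; rewrite /GRing.scale/=; ring.
  apply: (is_derive_eq (is_derive_comp_scalar hJ (is_derive_fst x (basis i)))).
  by rewrite mulNr.
have dpsi x i : derive psi x (basis i) =
    rho x * (Gam2 d (phi x) * derive phi x (basis i)) - 2 * x.1 * (basis i).1 * Gam1 d (phi x).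
  have -> : psi = rho * (Gam1 d \o phi) by apply/funext.
  rewrite (@derive_val _ _ _ _ _ _ _ (is_deriveM (drho x i) (dG1 x i))).
  by rewrite /GRing.scale /=; ring.
have dchi x i : derive chi x (basis i) =
    (basis i).1 * Gam d (phi x) + x.1 * (Gam1 d (phi x) * derive phi x (basis i)).
  have -> : chi = (fun z : plane R => z.1) * (Gam d \o phi) by apply/funext.
  rewrite (@derive_val _ _ _ _ _ _ _ (is_deriveM (is_derive_fst x (basis i)) (dG x i))).
  by rewrite /GRing.scale /=; ring.
have L2t f : test_fun D f -> L2 D f by exact: test_fun_L2.
pose gA x := p1 x * derive psi x (basis ord0) + p2 x * derive psi x (basis o1) - F x * psi x.
pose gB x := derive chi x (basis ord0).
pose gm x := 1 + F x ^+ 2 + p1 x ^+ 2 + p2 x ^+ 2 + y x ^+ 2.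
pose ge x := (phi x - y x) ^+ 2 +
      (derive phi x (basis ord0) - p1 x) ^+ 2 + (derive phi x (basis o1) - p2 x) ^+ 2.
have i1 : mu.-integrable D (EFin \o (fun x => p1 x * derive psi x (basis ord0))).
  by apply: L2_mul => //; apply: L2t; exact: test_fun_derive.
have i2 : mu.-integrable D (EFin \o (fun x => p2 x * derive psi x (basis o1))).
  by apply: L2_mul => //; apply: L2t; exact: test_fun_derive.
have i3 : mu.-integrable D (EFin \o (fun x => F x * psi x)).
  by apply: L2_mul => //; exact: L2t.
have i12 := integrableRD mD i1 i2.
have iA : mu.-integrable D (EFin \o gA) by exact: integrableRB.
have A0 : \int[mu]_(x in D) gA x = 0.
  by rewrite /gA (RintegralB mD i12 i3) (RintegralD mD i1 i2) -(weak _ tpsi) subrr.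
have iB : mu.-integrable D (EFin \o gB).
  have L1 : L2 D (fun=> 1) by apply: (@L2_bounded _ _ mD _ `|1|).
  have := L2_mul mD L1 (L2t _ (test_fun_derive ord0 tchi)).
  by congr (_.-integrable _ (_ \o _)); apply/funext => x; rewrite mul1r.
have B0 : \int[mu]_(x in D) gB x = 0 by exact: test_fun_derive_int0.
have im : mu.-integrable D (EFin \o gm).
  do 4 (apply: (integrableRD mD); last exact: L2_sq).
  have L1 : L2 D (fun=> 1) by apply: (@L2_bounded _ _ mD _ `|1|).
  by have := L2_sq L1; congr (_.-integrable _ (_ \o _)); apply/funext => x; rewrite expr1n.
have ie : mu.-integrable D (EFin \o ge).
  apply: (integrableRD mD); [apply: (integrableRD mD)|]; apply: L2_sq; apply: L2B => //.
  - exact: L2t.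
  - by apply: L2t; exact: test_fun_derive.
  - by apply: L2t; exact: test_fun_derive.
have iy : mu.-integrable D (EFin \o (fun x => Num.max (y x) 0 ^+ 2 / 2)).
  have Ly' := L2_max0 mD Ly.
  have := integrableRZ mD 2^-1 (L2_sq Ly').
  by congr (_.-integrable _ (_ \o _)); apply/funext => x; rewrite mulrC.
have iv := integrableRD mD (integrableRD mD (integrableRD mD (integrableRZ mD 2 iA) (integrableRZ mD 4 iB))
  (integrableRZ mD (40 * A ^+ 2 * d) im)) (integrableRZ mD (40 * A ^+ 2 / d) ie).
apply: (@le_trans _ _ (\int[mu]_(x in D) (2 * gA x + 4 * gB x + 40 * A ^+ 2 * d * gm x + 40 * A ^+ 2 / d * ge x))).
  apply: le_Rintegral_ae => //; apply: filterS Fneg => x Fx Dx.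
  have xA' := xA x Dx.
  have r1 : x.1 ^+ 2 <= A by apply: le_trans xA'; rewrite lerDl.
  have r2 : 1 <= A - x.1 ^+ 2 by rewrite lerBrDl.
  have r3 : A - x.1 ^+ 2 <= A by rewrite gerBl sqr_ge0.
  have rhoE : rho x = A - x.1 ^+ 2 by rewrite /rho mulN1r.
  have := @energy_pointwise R d A (rho x) x.1 (F x) (y x) (phi x) (p1 x) (p2 x)
    (derive phi x (basis ord0)) (derive phi x (basis o1)) d0 d1.
  rewrite rhoE => /(_ r1 r2 r3 (Fx Dx)) h.
  apply: le_trans h _.
  rewrite /gA /gB /gm /ge !dpsi dchi /psi rhoE /= !mulr1 !mulr0 !mul0r !subr0 mul1r.
  exact: lexx.
rewrite RintegralD//; last 2 first.
- exact: (integrableRD mD (integrableRD mD (integrableRZ mD 2 iA) (integrableRZ mD 4 iB)) (integrableRZ mD (40 * A ^+ 2 * d) im)).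
- exact: integrableRZ.
rewrite RintegralD//; last 2 first.
- exact: (integrableRD mD (integrableRZ mD 2 iA) (integrableRZ mD 4 iB)).
- exact: integrableRZ.
rewrite RintegralD//; last 2 first.
- exact: integrableRZ.
- exact: integrableRZ.
by rewrite !RintegralZl// A0 B0 !mulr0 !add0r.
Qed.

Lemma weak_max_principle (D : set (plane R)) (y F : plane R -> R)
    (p : 'I_2 -> plane R -> R) (phi : nat -> plane R -> R) :
  open D -> bounded_set D -> L2 D y -> L2 D F -> (forall i, L2 D (p i)) ->
  (forall n, test_fun D (phi n)) ->
  (L2normsq D (phi n \- y)%R +
     \sum_(i < 2) L2normsq D ((derive (phi n) ^~ (basis i)) \- p i)%R)%E
      @[n --> \oo] --> 0%E ->
  (forall psi, test_fun D psi -> \int[mu]_(x in D) (F x * psi x) =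
     \sum_(i < 2) \int[mu]_(x in D) (p i x * derive psi x (basis i))) ->
  {ae mu, forall x, D x -> 0 < y x -> F x <= 0} ->
  {ae mu, forall x, D x -> y x <= 0}.
Proof.
move=> oD bD Ly LF Lp tphi cvg weak Fneg.
have mD := open_measurable2 oD.
have fD := bounded_leb2_fin mD bD.
have [N DN] := bounded_sub_box bD.
(* On [D] one has [|x.1| <= N], so this choice makes the multiplier [A - x.1 ^+ 2] at least 1. *)
pose A : R := N%:R ^+ 2 + 1.
have xA x : D x -> x.1 ^+ 2 + 1 <= A.
  move=> /DN[/=]; rewrite in_itv/= => /andP[h1 h2] _; rewrite lerD2r.
  rewrite -(real_normK (num_real x.1)) ler_sqr ?nnegrE// ler_norml.
  by apply/andP; split; lra.
pose Iy := \int[mu]_(x in D) (Num.max (y x) 0 ^+ 2 / 2).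
pose M := \int[mu]_(x in D) (1 + F x ^+ 2 + p ord0 x ^+ 2 + p o1 x ^+ 2 + y x ^+ 2).
pose e n := \int[mu]_(x in D) ((phi n x - y x) ^+ 2 +
      (derive (phi n) x (basis ord0) - p ord0 x) ^+ 2 + (derive (phi n) x (basis o1) - p o1 x) ^+ 2).
have weak' psi : test_fun D psi -> \int[mu]_(x in D) (F x * psi x) =
     \int[mu]_(x in D) (p ord0 x * derive psi x (basis ord0)) +
     \int[mu]_(x in D) (p o1 x * derive psi x (basis o1)).
  by move=> /weak ->; rewrite sum_ord2.
have est n d : 0 < d -> d <= 1 -> Iy <= 40 * A ^+ 2 * d * M + 40 * A ^+ 2 / d * e n.
  by move=> d0 d1; exact: energy_estimate.
have L2t f : test_fun D f -> L2 D f by exact: test_fun_L2.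
have eE n : (L2normsq D (phi n \- y)%R +
     \sum_(i < 2) L2normsq D ((derive (phi n) ^~ (basis i)) \- p i)%R)%E = (e n)%:E.
  have La : L2 D (phi n \- y) by apply: L2B => //; exact: L2t.
  have Lb i : L2 D ((derive (phi n) ^~ (basis i)) \- p i)%R.
    by apply: L2B => //; apply: L2t; exact: test_fun_derive.
  rewrite esum_ord2 !L2normsqE// -!EFinD addrA; congr EFin.
  have Ia := L2_sq La; have Ib := L2_sq (Lb ord0); have Ic := L2_sq (Lb o1).
  rewrite /e (RintegralD mD (integrableRD mD Ia Ib) Ic).
  by rewrite (RintegralD mD Ia Ib).
have esmall (eta : R) : 0 < eta -> exists n, e n <= eta.
  move=> eta0; move: cvg; under eq_fun do rewrite eE.
  move=> /fine_cvgP[_ /cvgrPdist_le /(_ _ eta0)[n _ /(_ n (leqnn n))]] /=.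
  by rewrite sub0r normrN => h; exists n; apply: le_trans h; exact: ler_norm.
have A1 : 1 <= A by rewrite lerDr sqr_ge0.
have K0 : 0 < 40 * A ^+ 2 by rewrite mulr_gt0// exprn_gt0//; lra.
have M0 : 0 <= M.
  apply: Rintegral_ge0 => x _.
  have := sqr_ge0 (F x); have := sqr_ge0 (p ord0 x); have := sqr_ge0 (p o1 x); have := sqr_ge0 (y x).
  lra.
have Iy0 : Iy <= 0.
  apply/ler_addgt0Pl => z z0; rewrite addr0.
  set K := 40 * A ^+ 2 in K0 est.
  (* [M] depends on neither [d] nor [n]. First [d] makes the data term at most [z / 2]; then [n]
     makes the approximation error, multiplied by [K / d], at most [z / 2]. The [+ 1] keeps the
     divisor positive. *)
  pose d := Num.min 1 (z / 2 / (K * (M + 1))).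
  have KM : 0 < K * (M + 1) by rewrite mulr_gt0//; lra.
  have d0 : 0 < d by rewrite lt_min ltr01 !divr_gt0.
  have d1 : d <= 1 by rewrite ge_min lexx.
  have [n en] := esmall (z / 2 / (K / d)) (divr_gt0 (divr_gt0 z0 (ltr0Sn _ 1)) (divr_gt0 K0 d0)).
  apply: (le_trans (est n d d0 d1)).
  have h1 : K / d * e n <= z / 2.
    by rewrite mulrC -ler_pdivlMr// divr_gt0.
  have h2 : K * d * M <= z / 2.
    apply: (@le_trans _ _ (d * (K * (M + 1)))).
      by have := mulr_gt0 K0 d0; lra.
    by rewrite -ler_pdivlMr// ge_min lexx orbT.
  lra.
have Ly' := L2_max0 mD Ly.
have iy := L2_sq Ly'.
have : (\int[mu]_(x in D) `|(Num.max (y x) 0 ^+ 2)%:E| = 0)%E.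
  under eq_integral do rewrite gee0_abs ?lee_fin ?sqr_ge0//.
  rewrite -(EFin_Rintegral mD iy); congr EFin; apply/eqP; rewrite eq_le; apply/andP; split.
    move: Iy0; rewrite /Iy.
    under eq_Rintegral do rewrite mulrC.
    by rewrite RintegralZl//; lra.
  by apply: Rintegral_ge0 => x _; exact: sqr_ge0.
have my : measurable_fun D (EFin \o (fun x => Num.max (y x) 0 ^+ 2)) by exact: measurable_int iy.
move=> /(ae_eq_integral_abs mu mD my); apply: filterS => x hx Dx.
have /= := hx Dx; case=> /eqP; rewrite sqrf_eq0 => /eqP h.
by rewrite -h le_max lexx.
Qed.
End max_principle.

(** * Fourier inversion on rectangles *)

Section kernel.
Context (d1 d2 : measure_display) (T1 : measurableType d1) (T2 : measurableType d2).
Context (R : realType).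
Variables (m1 : {sigma_finite_measure set T1 -> \bar R}).
Variables (m2 : {sigma_finite_measure set T2 -> \bar R}).

Lemma integrable_bdmul (g c : T2 -> R) (M : R) :
  m2.-integrable setT (EFin \o g) -> measurable_fun setT c ->
  (forall y, `|c y| <= M) -> m2.-integrable setT (EFin \o (fun y => g y * c y)).
Proof.
move=> ig mc cM.
have iM := integrableZl measurableT M ig.
have mg : measurable_fun setT g by have /measurable_int/measurable_EFinP := ig.
apply: le_integrable iM => //.
  by apply/measurable_EFinP; exact: measurable_funM.
move=> y _ /=; rewrite lee_fin !normrM mulrC ler_wpM2r//.
exact: le_trans (cM y) (ler_norm _).
Qed.

Lemma measurable_sec1 (c : T1 * T2 -> R) x : measurable_fun setT c ->
  measurable_fun setT (fun y => c (x, y)).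
Proof. by move=> mc; exact: measurableT_comp. Qed.

Lemma measurable_sec2 (c : T1 * T2 -> R) y : measurable_fun setT c ->
  measurable_fun setT (fun x => c (x, y)).
Proof. by move=> mc; exact: measurableT_comp. Qed.

(** The integrals of the positive and negative parts are measurable as extended functions, and
    [fine] is measurable; sections with an undefined integral are thus covered by the default
    values. *)
Lemma measurable_Rintegral_sec (h : T1 * T2 -> R) : measurable_fun setT h ->
  measurable_fun setT (fun x => \int[m2]_y h (x, y)).
Proof.
move=> mh; rewrite /Rintegral; apply: measurableT_comp; first exact: fine_measurable.
have mE : measurable_fun setT (EFin \o h) by exact/measurable_EFinP.
rewrite (_ : (fun x => _) = (fun x => (\int[m2]_y (EFin \o h)^\+ (x, y) -
   \int[m2]_y (EFin \o h)^\- (x, y))%E)); last first.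
  by apply/funext => x; rewrite [LHS]integralE; congr (_ - _)%E; apply: eq_integral => y _; rewrite ?funeposE ?funenegE.
apply: emeasurable_funB.
  by apply: measurable_fun_fubini_tonelli_F => //; exact: measurable_funepos.
by apply: measurable_fun_fubini_tonelli_F => //; exact: measurable_funeneg.
Qed.

Variables (f : T1 -> R) (g : T2 -> R) (c : T1 * T2 -> R) (M : R).
Hypothesis if_ : m1.-integrable setT (EFin \o f).
Hypothesis ig : m2.-integrable setT (EFin \o g).
Hypothesis mc : measurable_fun setT c.
Hypothesis cM : forall z, `|c z| <= M.
Let h (z : T1 * T2) : R := f z.1 * (g z.2 * c z).

Lemma kernel_integrable :
  (m1 \x m2)%E.-integrable setT (EFin \o (fun z : T1 * T2 => f z.1 * (g z.2 * c z))).
Proof.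
rewrite -/h.
have mf : measurable_fun setT f by have /measurable_int/measurable_EFinP := if_.
have mg : measurable_fun setT g by have /measurable_int/measurable_EFinP := ig.
have mh : measurable_fun setT h.
  apply: measurable_funM; first exact: measurableT_comp mf measurable_fst.
  by apply: measurable_funM => //; exact: measurableT_comp mg measurable_snd.
apply/integrable12ltyP; first exact/measurable_EFinP.
have /integrableP[_ fy] := if_; have /integrableP[_ gy] := ig.
set If := (\int[m1]_x `|(EFin \o f) x|)%E in fy.
set Ig := (\int[m2]_x `|(EFin \o g) x|)%E in gy.
have If0 : (0 <= If)%E by exact: integral_ge0.
have Ig0 : (0 <= Ig)%E by exact: integral_ge0.
have M0 : 0 <= M by apply: le_trans (cM (point, point)).
have mfa : measurable_fun setT (fun x => `|(EFin \o f) x|)%E.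
  by apply: measurableT_comp => //; exact/measurable_EFinP.
have mga : measurable_fun setT (fun x => `|(EFin \o g) x|)%E.
  by apply: measurableT_comp => //; exact/measurable_EFinP.
apply: (@le_lt_trans _ _ (\int[m1]_x (`|(f x)%:E| * (M%:E * Ig)))%E).
  apply: ge0_le_integral => //.
  - by move=> x _; exact: integral_ge0.
  - apply: (measurable_fun_fubini_tonelli_F (abse \o (EFin \o h))) => //=.
      by apply: measurableT_comp => //; exact/measurable_EFinP.
  - apply: emeasurable_funM; first exact: mfa.
    exact: measurable_cst.
  move=> x _; rewrite -ge0_integralZl_EFin// -ge0_integralZl//; last 2 first.
  - by apply: measurable_funeM.
  - by move=> y _; rewrite mule_ge0.
  apply: ge0_le_integral => //.
  - apply: measurableT_comp => //; apply/measurable_EFinP.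
    exact: measurable_sec1 mh.
  - by apply: measurable_funeM; apply: measurable_funeM.
  move=> y _; rewrite /= -!EFinM lee_fin /h /= !normrM ler_wpM2l//.
  by rewrite mulrC ler_wpM2r.
rewrite ge0_integralZr//; last by rewrite mule_ge0.
by rewrite -/If lte_mul_pinfty// ?ge0_fin_numE// lte_mul_pinfty.
Qed.

(** The Fourier exchanges of integration below have this shape, with a kernel built from the cosine
    and sine of [dotp]; absolute convergence follows from domination by [M * |f| * |g|]. *)
Lemma Rfubini_kernel :
  \int[m1]_x (f x * \int[m2]_y (g y * c (x, y))) =
  \int[m2]_y (g y * \int[m1]_x (f x * c (x, y))).
Proof.
have := Fubini kernel_integrable.
have E1 x : (\int[m2]_y (EFin \o h) (x, y) =
   (f x * \int[m2]_y (g y * c (x, y)))%:E)%E.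
  have i1 : m2.-integrable setT (EFin \o (fun y => g y * c (x, y))).
    by apply: (@integrable_bdmul _ _ M) => //; exact: measurable_sec1.
  rewrite /= EFinM /Rintegral fineK; last exact: integrable_fin_num i1.
  by rewrite -integralZl//; apply: eq_integral => y _; rewrite /h/= EFinM.
have E2 y : (\int[m1]_x (EFin \o h) (x, y) =
   (g y * \int[m1]_x (f x * c (x, y)))%:E)%E.
  have i1 : m1.-integrable setT (EFin \o (fun x => f x * c (x, y))).
    have iM := integrableZl measurableT M if_.
    apply: le_integrable iM => //.
      apply/measurable_EFinP; apply: measurable_funM; last exact: measurable_sec2.
      by have /measurable_int/measurable_EFinP := if_.
    move=> x _ /=; rewrite lee_fin !normrM mulrC ler_wpM2r//.
    exact: le_trans (cM _) (ler_norm _).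
  rewrite /= EFinM /Rintegral fineK; last exact: integrable_fin_num i1.
  by rewrite -integralZl//; apply: eq_integral => x _; rewrite /h/= mulrCA EFinM.
rewrite (eq_integral (EFin \o (fun x => f x * \int[m2]_y (g y * c (x, y))))); last by move=> x _; exact: E1.
rewrite [RHS](eq_integral (EFin \o (fun y => g y * \int[m1]_x (f x * c (x, y))))); last by move=> y _; exact: E2.
by move=> hE; rewrite /Rintegral hE.
Qed.

Lemma kernel_integral :
  \int[(m1 \x m2)%E]_z (f z.1 * (g z.2 * c z)) =
  \int[m1]_x (f x * \int[m2]_y (g y * c (x, y))).
Proof.
rewrite {1}/Rintegral -[X in fine X](integral12_prod_meas1 kernel_integrable).
rewrite /Rintegral; congr fine; apply: eq_integral => x _.
have i1 : m2.-integrable setT (EFin \o (fun y => g y * c (x, y))).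
  by apply: (@integrable_bdmul _ _ M) => //; exact: measurable_sec1.
rewrite /fubini_F /= EFinM fineK; last exact: integrable_fin_num i1.
by rewrite -integralZl//; apply: eq_integral => y _; rewrite /h/= EFinM.
Qed.

End kernel.

Section tensor.
Context {R : realType}.
Local Notation mu := (leb2 R).
Local Notation m := (@lebesgue_measure R).
Implicit Types f g : R -> R.

Lemma tensor_integrable f g :
  m.-integrable setT (EFin \o f) -> m.-integrable setT (EFin \o g) ->
  mu.-integrable setT (EFin \o (fun z : plane R => f z.1 * g z.2)).
Proof.
move=> i1 i2.
have := @kernel_integrable _ _ _ _ R m m f g (fun=> 1) 1 i1 i2 (@measurable_cst _ _ _ _ _ _).
have h : forall z : measurableTypeR R * measurableTypeR R, `|1 : R| <= 1 by move=> _; rewrite normr1.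
move=> /(_ h); congr (_.-integrable _ _).
by apply/funext => z /=; rewrite mulr1.
Qed.

Lemma tensor_integral f g :
  m.-integrable setT (EFin \o f) -> m.-integrable setT (EFin \o g) ->
  \int[mu]_z (f z.1 * g z.2) = (\int[m]_x f x) * (\int[m]_x g x).
Proof.
move=> i1 i2.
have h : forall z : measurableTypeR R * measurableTypeR R, `|1 : R| <= 1 by move=> _; rewrite normr1.
have := @kernel_integral _ _ _ _ R m m f g (fun=> 1) 1 i1 i2 (@measurable_cst _ _ _ _ _ _) h.
under eq_Rintegral do rewrite mulr1.
move=> ->; under eq_Rintegral do under eq_Rintegral do rewrite mulr1.
by rewrite RintegralZr.
Qed.

End tensor.

(** * Exponential and power integrals on the line *)

Section half_line.
Context {R : realType}.
Local Notation m := (@lebesgue_measure R).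

Lemma ge0_integral_fold (f : R -> R) : (forall x, 0 <= f x) -> continuous f ->
  (\int[m]_x (f x)%:E = \int[m]_(x in [set` `[0%R, +oo[]) (f x + f (- x))%:E)%E.
Proof.
move=> f0 cf.
have mf : measurable_fun [set: R] f by exact: continuous_measurable_fun.
have mposnums : measurable [set x : R | 0 <= x]%R by rewrite -set_itvcy.
rewrite -(setUv [set x : R | 0 <= x]%R) ge0_integral_setU//= ; last 4 first.
  exact: measurableC.
  by apply/measurable_EFinP; rewrite setUv.
  by move=> x _; rewrite lee_fin.
  exact/disj_setPCl.
rewrite -set_itvcy// setCitvr.
rewrite integral_itv_bndo_bndc; last exact/measurable_EFinP/measurable_funTS.
rewrite -{2}oppr0 ge0_integration_by_substitutionNy//; last exact: continuous_subspaceT.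
rewrite -ge0_integralD//.
- by move=> x _; rewrite lee_fin.
- exact/measurable_EFinP/measurable_funTS.
- by move=> x _; rewrite lee_fin; exact: f0.
- apply/measurable_EFinP/measurable_funTS; exact: measurableT_comp.
Qed.

Lemma cvg_expRN (t : R) : 0 < t -> expR (- (t * x)) @[x --> +oo] --> (0 : R).
Proof.
move=> t0; apply: (@cvg_comp _ _ _ (fun x : R => t * x) (fun y : R => expR (- y)) _ (+oo)).
  exact: gt0_cvgMry.
exact: cvgr_expR.
Qed.

Lemma cvg_expRN_bd (t M : R) (h : R -> R) : 0 < t -> (forall x, `|h x| <= M) ->
  expR (- (t * x)) * h x @[x --> +oo] --> (0 : R).
Proof.
move=> t0 hM.
have e0 : M * expR (- (t * x)) @[x --> +oo] --> (0 : R).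
  by rewrite -[X in _ --> X](mulr0 M); apply: cvgMr; exact: cvg_expRN.
apply/norm_cvg0P; apply: (squeeze_cvgr _ (cvg_cst 0) e0).
near=> x; rewrite normr_ge0/= normrM ger0_norm ?expR_ge0// mulrC ler_wpM2r ?expR_ge0//.
Unshelve. all: by end_near. Qed.

(** The summand 1 and the bound on [|A| + |B|] keep the integrand nonnegative, as the fundamental
    theorem of calculus on a half-line requires. Cosine and sine integrals are recovered afterwards
    by subtracting the plain exponential. *)
Lemma integral_exp_trig (t z A B : R) : 0 < t -> `|A| + `|B| <= 1 ->
  (\int[m]_(x in [set` `[0%R, +oo[]) (expR (- (t * x)) * (1 + A * cos (z * x) + B * sin (z * x)))%:E
  = (t^-1 + (A * t + B * z) / (t ^+ 2 + z ^+ 2))%:E)%E.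
Proof.
move=> t0 AB.
have q0 : t ^+ 2 + z ^+ 2 != 0 by rewrite gt_eqF// ltr_pwDl ?sqr_ge0// exprn_gt0.
have t0' : t != 0 by rewrite gt_eqF.
(* The primitive is [exp (- t x)] times the bounded function [h], so it tends to 0 at infinity. *)
pose h (x : R) : R := - t^-1 + (A * (z * sin (z * x) - t * cos (z * x))
   - B * (t * sin (z * x) + z * cos (z * x))) / (t ^+ 2 + z ^+ 2).
pose F (x : R) : R := expR (- (t * x)) * h x.
pose f (x : R) : R := expR (- (t * x)) * (1 + A * cos (z * x) + B * sin (z * x)).
have dF (x : R) : is_derive x (1 : R) F (f x).
  rewrite /F /h; apply: is_derive_eq.
  rewrite /f /GRing.scale/=; field.
  by rewrite ?t0' ?q0.
have cF : continuous F.
  move=> x; apply: differentiable_continuous; apply/derivable1_diffP.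
  exact: (@ex_derive _ _ _ _ _ _ _ (dF x)).
have cos1 (y : R) : `|cos y| <= 1 by rewrite ler_norml cos_geN1 cos_le1.
have sin1 (y : R) : `|sin y| <= 1 by rewrite ler_norml sin_geN1 sin_le1.
have cf : continuous f.
  move=> x; rewrite /f; apply: cvgM.
    apply: continuous_comp; last exact: continuous_expR.
    by apply: cvgN; apply: cvgM; [exact: cvg_cst|exact: cvg_id].
  apply: cvgD; [apply: cvgD; first exact: cvg_cst|]; apply: cvgM; try exact: cvg_cst.
    apply: continuous_comp; last exact: continuous_cos.
    by apply: cvgM; [exact: cvg_cst|exact: cvg_id].
  apply: continuous_comp; last exact: continuous_sin.
  by apply: cvgM; [exact: cvg_cst|exact: cvg_id].
rewrite (@ge0_continuous_FTC2y _ f F 0 0).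
- rewrite /F /h !mulr0 oppr0 expR0 mul1r sin0 cos0 sub0e -EFinN; congr EFin.
  field.
  by rewrite ?t0' ?q0.
- move=> x _; apply: mulr_ge0; first exact: expR_ge0.
  have h1 : `|A * cos (z * x)| <= `|A| by rewrite normrM ler_piMr.
  have h2 : `|B * sin (z * x)| <= `|B| by rewrite normrM ler_piMr.
  move: h1 h2; rewrite !ler_norml => /andP[? _] /andP[? _]; lra.
- exact: continuous_subspaceT.
- pose M := `|t^-1| + (`|A| * (`|z| + `|t|) + `|B| * (`|t| + `|z|)) * `|(t ^+ 2 + z ^+ 2)^-1|.
  apply: (@cvg_expRN_bd t M h t0) => x.
  rewrite /h; apply: le_trans (ler_normD _ _) _; rewrite normrN lerD2l normrM ler_wpM2r//.
  apply: le_trans (ler_normB _ _) _; rewrite !normrM.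
  apply: lerD; rewrite ler_wpM2l//.
    by apply: le_trans (ler_normB _ _) _; rewrite !normrM lerD// ler_piMr.
  by apply: le_trans (ler_normD _ _) _; rewrite !normrM lerD// ler_piMr.
- by move=> x _; exact: (@ex_derive _ _ _ _ _ _ _ (dF x)).
- exact/cvg_at_right_filter/cF.
- by move=> x _; rewrite derive1E; exact: (@derive_val _ _ _ _ _ _ _ (dF x)).
Qed.


(** The Abel convergence factor; its cosine transform is, up to normalisation, the Poisson kernel of
    the half-plane. *)
Definition eabs (t s : R) : R := expR (- (t * `|s|)).

Lemma continuous_eabs t : continuous (eabs t).
Proof.
move=> s; apply: continuous_comp; last exact: continuous_expR.
apply: cvgN; apply: cvgM; first exact: cvg_cst.
exact: norm_continuous.
Qed.

Lemma eabs_le1 t s : 0 < t -> 0 <= eabs t s <= 1.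
Proof.
move=> t0; rewrite expR_ge0 /eabs -[leRHS]expR0 ler_expR.
by rewrite oppr_le0 mulr_ge0// ltW.
Qed.

Lemma continuous_scal_comp (h : R -> R) (z : R) : continuous h ->
  continuous (fun s => h (z * s)).
Proof.
move=> ch s; apply: (@continuous_comp _ _ _ (fun s => z * s) h); last exact: ch.
by apply: cvgM; [exact: cvg_cst|exact: cvg_id].
Qed.

Lemma integral_eabs_trig (t z A B : R) : 0 < t -> `|A| + `|B| <= 1 ->
  (\int[m]_s (eabs t s * (1 + A * cos (z * s) + B * sin (z * s)))%:E
   = (2 * (t^-1 + A * t / (t ^+ 2 + z ^+ 2)))%:E)%E.
Proof.
move=> t0 AB.
have cos1 (y : R) : `|cos y| <= 1 by rewrite ler_norml cos_geN1 cos_le1.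
have sin1 (y : R) : `|sin y| <= 1 by rewrite ler_norml sin_geN1 sin_le1.
have pos (x : R) : 0 <= 1 + A * cos (z * x) + B * sin (z * x).
  have h1 : `|A * cos (z * x)| <= `|A| by rewrite normrM ler_piMr.
  have h2 : `|B * sin (z * x)| <= `|B| by rewrite normrM ler_piMr.
  by move: h1 h2; rewrite !ler_norml => /andP[? _] /andP[? _]; lra.
have cc := continuous_scal_comp (z := z) (@continuous_cos R).
have cs := continuous_scal_comp (z := z) (@continuous_sin R).
have cn (a b : R) : continuous (fun s => 1 + a * cos (z * s) + b * sin (z * s)).
  move=> s; apply: cvgD; [apply: cvgD; first exact: cvg_cst|].
    by apply: cvgM; [exact: cvg_cst|exact: cc].
  by apply: cvgM; [exact: cvg_cst|exact: cs].
rewrite ge0_integral_fold; last 2 first.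
- by move=> s; rewrite mulr_ge0// expR_ge0.
- by move=> s; apply: cvgM; [exact: continuous_eabs|exact: cn].
(* Folding the line onto the half-line cancels the odd sine term and doubles the rest, so the
   half-line formula is used with [B = 0]. *)
have A1 : `|A| + `|0 : R| <= 1 by rewrite normr0 addr0; have := normr_ge0 B; lra.
have := @integral_exp_trig t z A 0 t0 A1; rewrite mul0r addr0.
move=> E; rewrite EFinM -E -ge0_integralZl_EFin//.
- apply: eq_integral => x; rewrite inE/= in_itv/= andbT => x0.
  rewrite -EFinM /eabs normrN ger0_norm// mulrN cosN sinN; congr EFin; ring.
- move=> x _; rewrite lee_fin mulr_ge0 ?expR_ge0// mul0r addr0.
  have h1 : `|A * cos (z * x)| <= `|A| by rewrite normrM ler_piMr.
  by move: h1; rewrite ler_norml => /andP[? _]; have := normr_ge0 B; lra.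
- apply/measurable_EFinP; apply: measurable_funTS; apply: continuous_measurable_fun => s.
  apply: cvgM; last exact: cn.
  apply: (@continuous_comp _ _ _ (fun s : R => - (t * s)) expR); last exact: continuous_expR.
  by apply: cvgN; apply: cvgM; [exact: cvg_cst|exact: cvg_id].
Qed.

Lemma integrable_eabs t : 0 < t -> m.-integrable setT (EFin \o eabs t).
Proof.
move=> t0; apply/integrableP; split.
  by apply/measurable_EFinP; apply: continuous_measurable_fun; exact: continuous_eabs.
have h : `|0 : R| + `|0 : R| <= 1 by rewrite normr0 addr0.
have := @integral_eabs_trig t 0 0 0 t0 h => E.
apply: (@le_lt_trans _ _ (\int[m]_s (eabs t s * (1 + 0 * cos (0 * s) + 0 * sin (0 * s)))%:E)%E).
  rewrite le_eqVlt; apply/orP; left; apply/eqP; apply: eq_integral => s _.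
  by rewrite !mul0r !addr0 mulr1/= ger0_norm ?expR_ge0.
by rewrite E ltry.
Qed.

Lemma Rintegral_eabs t : 0 < t -> \int[m]_s eabs t s = 2 / t.
Proof.
move=> t0; have h : `|0 : R| + `|0 : R| <= 1 by rewrite normr0 addr0.
have := @integral_eabs_trig t 0 0 0 t0 h => E.
have -> : \int[m]_s eabs t s = \int[m]_s (eabs t s * (1 + 0 * cos (0 * s) + 0 * sin (0 * s))).
  by apply: eq_Rintegral => s _; rewrite !mul0r !addr0 mulr1.
by rewrite /Rintegral E/= !mul0r addr0.
Qed.

Lemma integrable_eabs_cos t z : 0 < t ->
  m.-integrable setT (EFin \o (fun s => eabs t s * cos (z * s))).
Proof.
move=> t0; apply: (@integrable_bdmul _ _ _ m _ _ 1); first exact: integrable_eabs.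
  by apply: continuous_measurable_fun; apply: continuous_scal_comp; exact: continuous_cos.
by move=> y; rewrite ler_norml cos_geN1 cos_le1.
Qed.

Lemma integrable_eabs_sin t z : 0 < t ->
  m.-integrable setT (EFin \o (fun s => eabs t s * sin (z * s))).
Proof.
move=> t0; apply: (@integrable_bdmul _ _ _ m _ _ 1); first exact: integrable_eabs.
  by apply: continuous_measurable_fun; apply: continuous_scal_comp; exact: continuous_sin.
by move=> y; rewrite ler_norml sin_geN1 sin_le1.
Qed.

Lemma Rintegral_eabs_cos t z : 0 < t ->
  \int[m]_s (eabs t s * cos (z * s)) = 2 * t / (t ^+ 2 + z ^+ 2).
Proof.
move=> t0; have h : `|1 : R| + `|0 : R| <= 1 by rewrite normr0 addr0 normr1.
have := @integral_eabs_trig t z 1 0 t0 h => E.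
have i1 := integrable_eabs t0; have i2 := integrable_eabs_cos z t0.
have : \int[m]_s (eabs t s + eabs t s * cos (z * s)) = 2 * (t^-1 + 1 * t / (t ^+ 2 + z ^+ 2)).
  rewrite (_ : \int[m]_s _ = \int[m]_s (eabs t s * (1 + 1 * cos (z * s) + 0 * sin (z * s)))).
    by rewrite /Rintegral E.
  by apply: eq_Rintegral => s _; ring.
rewrite RintegralD// Rintegral_eabs//; lra.
Qed.

Lemma Rintegral_eabs_sin t z : 0 < t -> \int[m]_s (eabs t s * sin (z * s)) = 0.
Proof.
move=> t0; have h : `|0 : R| + `|1 : R| <= 1 by rewrite normr0 add0r normr1.
have := @integral_eabs_trig t z 0 1 t0 h => E.
have i1 := integrable_eabs t0; have i2 := integrable_eabs_sin z t0.
have : \int[m]_s (eabs t s + eabs t s * sin (z * s)) = 2 * (t^-1 + 0 * t / (t ^+ 2 + z ^+ 2)).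
  rewrite (_ : \int[m]_s _ = \int[m]_s (eabs t s * (1 + 0 * cos (z * s) + 1 * sin (z * s)))).
    by rewrite /Rintegral E.
  by apply: eq_Rintegral => s _; ring.
rewrite RintegralD// Rintegral_eabs// !mul0r addr0; lra.
Qed.

Lemma cvgy_ln : ln x @[x --> +oo] --> (+oo : set_system R).
Proof.
apply/cvgryPge => A; near=> x.
have x0 : 0 < x by near: x; exact: nbhs_pinfty_gt.
have xA : expR A <= x by near: x; exact: nbhs_pinfty_ge.
by rewrite -[A]expRK ler_ln ?posrE ?expR_gt0.
Unshelve. all: by end_near. Qed.

Lemma continuous_expN_ln (h : R -> R) (c x : R) : {for x, continuous h} -> 0 < h x ->
  {for x, continuous (fun y : R => expR (- (c * ln (h y))) : R)}.
Proof.
move=> ch h0.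
have c1 : {for x, continuous (fun y => ln (h y))}.
  exact: (@continuous_comp _ _ _ h (@ln R) x ch (continuous_ln h0)).
apply: (@continuous_comp _ _ _ (fun y : R => - (c * ln (h y))) expR); last exact: continuous_expR.
by apply: cvgN; apply: cvgM; [exact: cvg_cst|exact: c1].
Qed.

Lemma continuous_1D (x : R) : {for x, continuous (fun y : R => 1 + y)}.
Proof. by apply: cvgD; [exact: cvg_cst|exact: cvg_id]. Qed.

Lemma continuous_1Dsqr (x : R) : {for x, continuous (fun y : R => 1 + y ^+ 2)}.
Proof. by apply: cvgD; [exact: cvg_cst|exact: exprn_continuous]. Qed.

Lemma integral_pow_half (r : R) : 0 < r ->
  (\int[m]_(x in [set` `[0%R, +oo[]) (expR (- ((r + 1) * ln (1 + x))))%:E = r^-1%:E)%E.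
Proof.
move=> r0.
pose F (x : R) : R := - r^-1 * expR (- (r * ln (1 + x))).
pose f (x : R) : R := expR (- ((r + 1) * ln (1 + x))).
have dF (x : R) : 0 <= x -> is_derive x (1 : R) F (f x).
  move=> x0; have x1 : 0 < 1 + x by lra.
  have h1 : is_derive x (1 : R) (fun x : R => 1 + x) 1.
    by apply: (is_derive_eq (is_deriveD (is_derive_cst (1 : R) x (1 : R)) (is_derive_id x (1 : R)))); rewrite add0r.
  have h2 := @is_derive1_comp R (@ln R) (fun x : R => 1 + x) x _ _ (is_derive1_ln x1) h1.
  rewrite /F; apply: is_derive_eq.
  rewrite /f /GRing.scale/= mulr1 -[RHS]mul1r.
  rewrite (_ : - ((r + 1) * ln (1 + x)) = - (r * ln (1 + x)) - ln (1 + x)); last by ring.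
  rewrite expRD [expR (- ln _)]expRN lnK ?posrE//.
  by field; rewrite !gt_eqF.
have cf (x : R) : 0 <= x -> {for x, continuous f}.
  move=> x0; have x1 : 0 < 1 + x by lra.
  have := (@continuous_expN_ln (fun y : R => 1 + y) (r + 1) x (@continuous_1D x) x1); apply.
have cF (x : R) : 0 <= x -> {for x, continuous F}.
  move=> x0; apply: differentiable_continuous; apply/derivable1_diffP.
  exact: (@ex_derive _ _ _ _ _ _ _ (dF x x0)).
rewrite (@ge0_continuous_FTC2y _ f F 0 0).
- by rewrite /F addr0 ln1 mulr0 oppr0 expR0 mulr1 sub0e -EFinN opprK.
- by move=> x _; exact: expR_ge0.
- apply: continuous_in_subspaceT => x; rewrite inE/= in_itv/= andbT; exact: cf.
- rewrite -[X in _ --> X](mulr0 (- r^-1)); apply: cvgMr.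
  apply: (@cvg_comp _ _ _ (fun x : R => ln (1 + x)) (fun y : R => expR (- (r * y))) _ (+oo)).
    apply: (@cvg_comp _ _ _ (fun x : R => 1 + x) (@ln R) _ (+oo)); last exact: cvgy_ln.
    apply/cvgryPge => A; near=> x.
    have : A - 1 <= x by near: x; apply: nbhs_pinfty_ge; exact: num_real.
    by lra.
  exact: cvg_expRN.
- by move=> x x0; exact: (@ex_derive _ _ _ _ _ _ _ (dF x (ltW x0))).
- by apply: cvg_at_right_filter; exact: cF.
- move=> x; rewrite in_itv/= andbT => x0; rewrite derive1E; exact: (@derive_val _ _ _ _ _ _ _ (dF x (ltW x0))).
Unshelve. all: by end_near. Qed.

(** Since [(1 + x) ^+ 2 <= 2 * (1 + x ^+ 2)], the integrand is at most [2 ^ p * (1 + x) ^ (- 2 p)]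
    on the half-line, with [2 p > 1]. The further factor 2 in [C] accounts for the two
    half-lines. *)
Lemma integrable_powR_sqr (p : R) : 1 / 2 < p ->
  m.-integrable setT (EFin \o (fun x : R => (1 + x ^+ 2) `^ (- p))).
Proof.
move=> p1; have p0 : 0 < p by lra.
have pos (x : R) : 0 < 1 + x ^+ 2 by rewrite ltr_pwDl ?sqr_ge0.
have pE (x : R) : (1 + x ^+ 2) `^ (- p) = expR (- (p * ln (1 + x ^+ 2))).
  by rewrite /powR gt_eqF// mulNr.
have ct : continuous (fun x : R => (1 + x ^+ 2) `^ (- p)).
  rewrite (_ : (fun x => _) = (fun x => expR (- (p * ln (1 + x ^+ 2))))); last exact/funext.
  by move=> x; have := (@continuous_expN_ln (fun y : R => 1 + y ^+ 2) p x (@continuous_1Dsqr x) (pos x)); apply.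
apply/integrableP; split.
  by apply/measurable_EFinP; exact: continuous_measurable_fun.
under eq_integral do rewrite gee0_abs ?lee_fin ?powR_ge0//.
rewrite ge0_integral_fold//; last by move=> x; exact: powR_ge0.
pose C : R := 2 * expR (p * ln 2).
apply: (@le_lt_trans _ _ (\int[m]_(x in [set` `[0%R, +oo[]) (C%:E * (expR (- ((2 * p - 1 + 1) * ln (1 + x))))%:E))%E).
  apply: ge0_le_integral => //.
  - by move=> x _; rewrite lee_fin addr_ge0 ?powR_ge0.
  - apply/measurable_EFinP; apply: measurable_funTS; apply: continuous_measurable_fun => x.
    apply: cvgD; first exact: ct.
    by apply: (@continuous_comp _ _ _ -%R (fun x : R => (1 + x ^+ 2) `^ (- p))); [exact: oppr_continuous|exact: ct].
  - apply/measurable_EFinP; apply: measurable_funM => //.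
    apply: subspace_continuous_measurable_fun => //.
    apply: continuous_in_subspaceT => x; rewrite inE/= in_itv/= andbT => x0.
    by apply: (@continuous_expN_ln (fun y : R => 1 + y) (2 * p - 1 + 1) x (@continuous_1D x)); lra.
  - move=> x; rewrite /= in_itv/= andbT => x0; rewrite -EFinM lee_fin sqrrN pE.
    have : expR (- (p * ln (1 + x ^+ 2))) <= expR (p * ln 2) * expR (- ((2 * p - 1 + 1) * ln (1 + x))).
      rewrite -expRD ler_expR.
      have : 2 * ln (1 + x) <= ln 2 + ln (1 + x ^+ 2).
        have x1 : 0 < 1 + x by lra.
        rewrite mulr_natl -lnXn// -lnM ?posrE// ler_ln ?posrE ?exprn_gt0 ?mulr_gt0//.
        by have := sqr_ge0 (1 - x); lra.
      by nra.
    by rewrite /C; lra.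
rewrite ge0_integralZl_EFin//; last 2 first.
- apply/measurable_EFinP.
  apply: subspace_continuous_measurable_fun => //.
  apply: continuous_in_subspaceT => x; rewrite inE/= in_itv/= andbT => x0.
  by apply: (@continuous_expN_ln (fun y : R => 1 + y) (2 * p - 1 + 1) x (@continuous_1D x)); lra.
- by rewrite /C mulr_ge0 ?expR_ge0.
rewrite integral_pow_half; last by lra.
by rewrite -EFinM ltry.
Qed.

End half_line.

Section Rdct.
Context (d : measure_display) (T : measurableType d) (R : realType).
Variable mu : {measure set T -> \bar R}.

Lemma Rintegral_dct (fk : nat -> T -> R) (f g : T -> R) :
  (forall k, measurable_fun setT (fk k)) -> measurable_fun setT f ->
  {ae mu, forall x, fk k x @[k --> \oo] --> f x} ->
  mu.-integrable setT (EFin \o g) -> (forall k x, `|fk k x| <= g x) ->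
  \int[mu]_x fk k x @[k --> \oo] --> \int[mu]_x f x.
Proof.
move=> mfk mf cv ig le.
have [] := @dominated_convergence _ _ _ mu setT measurableT
  (fun k => EFin \o fk k) (EFin \o f) (EFin \o g).
- by move=> k; exact/measurable_EFinP.
- exact/measurable_EFinP.
- apply: filterS cv => x hx _; apply: cvg_EFin; [exact: nearW|exact: hx].
- exact: ig.
- by apply: aeW => x k _; rewrite /= lee_fin.
move=> if_ _ h; apply: fine_cvg.
rewrite fineK; last exact: integrable_fin_num if_.
exact: h.
Qed.

Lemma ae_and (P Q : T -> Prop) : {ae mu, forall x, P x} -> {ae mu, forall x, Q x} ->
  {ae mu, forall x, P x /\ Q x}.
Proof.
move=> hP hQ; apply: negligibleS (negligibleU hP hQ) => x /= /not_andP[h|h].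
  by left.
by right.
Qed.

Lemma ae_imp (P Q : T -> Prop) : (forall x, P x -> Q x) -> {ae mu, forall x, P x} ->
  {ae mu, forall x, Q x}.
Proof. by move=> PQ; apply: negligibleS => x /= nQ /PQ. Qed.

End Rdct.

(** * Fourier transforms and Poisson integrals of intervals *)

Section rectangles.
Context {R : realType}.
Local Notation mu := (leb2 R).
Local Notation m := (@lebesgue_measure R).

Definition ind (a b : R) : R -> R := \1_(`]a, b]%classic).

Lemma measurable_ind a b : measurable_fun setT (ind a b).
Proof. by apply: measurable_indic; exact: measurable_itv. Qed.

Lemma ind_integrable a b : m.-integrable setT (EFin \o ind a b).
Proof.
apply/integrableP; split; first by apply/measurable_EFinP; exact: measurable_ind.
have -> : (\int[m]_x `|(EFin \o ind a b) x| = m `]a, b]%classic)%E.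
  rewrite -[in RHS](setIT `]a, b]%classic) -(integral_indic m measurableT (measurable_itv _)).
  by apply: eq_integral => x _; rewrite /= ger0_norm// /ind indicE.
by rewrite lebesgue_measure_itv/=; case: ifP => _; rewrite ltry.
Qed.

Lemma ind_FTC a b (f F : R -> R) : a < b -> continuous f ->
  (forall z : R, is_derive z (1 : R) F (f z)) ->
  \int[m]_z (ind a b z * f z) = F b - F a.
Proof.
move=> ab cf dF.
have cF (t : R) : F x @[x --> t] --> F t.
  apply: differentiable_continuous; apply/derivable1_diffP.
  exact: (@ex_derive _ _ _ _ _ _ _ (dF t)).
have -> : \int[m]_z (ind a b z * f z) = \int[m]_(z in `]a, b]) f z.
  rewrite [RHS]Rintegral_mkcond; apply: eq_Rintegral => z _.
  by rewrite patchE /ind indicE mem_setE; case: ifP => _; rewrite ?mul1r ?mul0r.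
rewrite /Rintegral integral_itv_obnd_cbnd; last first.
  by apply/measurable_EFinP; apply: measurable_funTS; exact: continuous_measurable_fun.
rewrite (@continuous_FTC2 _ f F)//.
- exact: continuous_subspaceT.
- split.
  + by move=> t _; exact: (@ex_derive _ _ _ _ _ _ _ (dF t)).
  + exact: cvg_at_right_filter.
  + exact: cvg_at_left_filter.
- by move=> t _; rewrite derive1E; exact: (@derive_val _ _ _ _ _ _ _ (dF t)).
Qed.

Lemma ind_bound a b (f : R -> R) : a < b -> measurable_fun setT f ->
  (forall z, `|f z| <= 1) -> `|\int[m]_z (ind a b z * f z)| <= b - a.
Proof.
move=> ab mf f1.
have ii := ind_integrable a b.
have i1 := integrable_bdmul ii mf f1.
apply: le_trans (le_normr_Rintegral measurableT i1) _.
have <- : \int[m]_z (ind a b z * 1) = b - a.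
  by apply: (@ind_FTC a b (fun=> 1) id) => //; exact: cst_continuous.
apply: le_Rintegral => //.
- exact: (integrable_norm i1).
- by under eq_fun do rewrite mulr1.
- move=> z _; rewrite normrM; have i0 : 0 <= ind a b z by rewrite /ind indicE.
  by rewrite ger0_norm// ler_wpM2l.
Qed.

(** Up to sign and normalisation, [c1] and [s1] are the real and imaginary parts of the Fourier
    transform of the indicator of an interval. *)
Definition c1 a b s : R := \int[m]_z (ind a b z * cos (z * s)).
Definition s1 a b s : R := \int[m]_z (ind a b z * sin (z * s)).

Lemma continuous_cosM (s : R) : continuous (fun z : R => cos (z * s)).
Proof.
move=> z; apply: (@continuous_comp _ _ _ (fun z : R => z * s) cos); last exact: continuous_cos.
by apply: cvgM; [exact: cvg_id|exact: cvg_cst].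
Qed.

Lemma continuous_sinM (s : R) : continuous (fun z : R => sin (z * s)).
Proof.
move=> z; apply: (@continuous_comp _ _ _ (fun z : R => z * s) sin); last exact: continuous_sin.
by apply: cvgM; [exact: cvg_id|exact: cvg_cst].
Qed.

Lemma cos_abs1 (y : R) : `|cos y| <= 1. Proof. by rewrite ler_norml cos_geN1 cos_le1. Qed.
Lemma sin_abs1 (y : R) : `|sin y| <= 1. Proof. by rewrite ler_norml sin_geN1 sin_le1. Qed.

Lemma ind_cos_integrable a b s :
  m.-integrable setT (EFin \o (fun z => ind a b z * cos (z * s))).
Proof.
apply: (@integrable_bdmul _ _ _ m _ _ 1); first exact: ind_integrable.
  by apply: continuous_measurable_fun; exact: continuous_cosM.
by move=> z; exact: cos_abs1.
Qed.

Lemma ind_sin_integrable a b s :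
  m.-integrable setT (EFin \o (fun z => ind a b z * sin (z * s))).
Proof.
apply: (@integrable_bdmul _ _ _ m _ _ 1); first exact: ind_integrable.
  by apply: continuous_measurable_fun; exact: continuous_sinM.
by move=> z; exact: sin_abs1.
Qed.

Lemma sqr_le_abs (x y : R) : `|x| <= y -> x ^+ 2 <= y ^+ 2.
Proof.
move=> xy; rewrite -(real_normK (num_real x)) ler_sqr ?nnegrE//.
exact: le_trans xy.
Qed.

(** Two bounds are squared and added: the trivial one by the length [b - a], and [|s * c1 a b s| =
    |sin (b s) - sin (a s)| <= 2]. This decay makes the transform of a rectangle square
    integrable. *)
Lemma c1_decay a b s : a < b -> c1 a b s ^+ 2 * (1 + s ^+ 2) <= (b - a) ^+ 2 + 4.
Proof.
move=> ab.
have h1 : `|c1 a b s| <= b - a.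
  apply: ind_bound => //; last by move=> z; exact: cos_abs1.
  by apply: continuous_measurable_fun; exact: continuous_cosM.
have h2 : s * c1 a b s = sin (b * s) - sin (a * s).
  have cc : continuous (fun z : R => s * cos (z * s)).
    by move=> z; apply: cvgM; [exact: cvg_cst|exact: continuous_cosM].
  have dd (z : R) : is_derive z (1 : R) (fun z : R => sin (z * s)) (s * cos (z * s)).
    by apply: is_derive_eq; rewrite /GRing.scale/=; ring.
  have <- := ind_FTC ab cc dd.
  rewrite /c1 -RintegralZl//; last exact: ind_cos_integrable.
  by apply: eq_Rintegral => z _; rewrite mulrCA.
have h3 : `|s * c1 a b s| <= 2.
  rewrite h2; apply: le_trans (ler_normB _ _) _.
  by have := sin_abs1 (b * s); have := sin_abs1 (a * s); lra.
have := sqr_le_abs h1; have := sqr_le_abs h3; rewrite exprMn; lra.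
Qed.

Lemma s1_decay a b s : a < b -> s1 a b s ^+ 2 * (1 + s ^+ 2) <= (b - a) ^+ 2 + 4.
Proof.
move=> ab.
have h1 : `|s1 a b s| <= b - a.
  apply: ind_bound => //; last by move=> z; exact: sin_abs1.
  by apply: continuous_measurable_fun; exact: continuous_sinM.
have h2 : s * s1 a b s = - cos (b * s) - - cos (a * s).
  have cc : continuous (fun z : R => s * sin (z * s)).
    by move=> z; apply: cvgM; [exact: cvg_cst|exact: continuous_sinM].
  have dd (z : R) : is_derive z (1 : R) (fun z : R => - cos (z * s)) (s * sin (z * s)).
    by apply: is_derive_eq; rewrite /GRing.scale/=; ring.
  have <- := ind_FTC ab cc dd.
  rewrite /s1 -RintegralZl//; last exact: ind_sin_integrable.
  by apply: eq_Rintegral => z _; rewrite mulrCA.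
have h3 : `|s * s1 a b s| <= 2.
  rewrite h2; apply: le_trans (ler_normB _ _) _; rewrite !normrN.
  by have := cos_abs1 (b * s); have := cos_abs1 (a * s); lra.
have := sqr_le_abs h1; have := sqr_le_abs h3; rewrite exprMn; lra.
Qed.

(* [2 * pi] times the Poisson kernel of the half-plane *)
Definition kap (t z : R) : R := 2 * t / (t ^+ 2 + z ^+ 2).
Definition Phi (a b t x : R) : R := 2 * (atan ((b - x) / t) - atan ((a - x) / t)).

Lemma Phi_int a b t x : a < b -> 0 < t ->
  \int[m]_z (ind a b z * kap t (x - z)) = Phi a b t x.
Proof.
move=> ab t0; have t0' : t != 0 by rewrite gt_eqF.
have pos (z : R) : 0 < t ^+ 2 + z ^+ 2 by rewrite ltr_pwDl ?sqr_ge0// exprn_gt0.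
have cc : continuous (fun z : R => kap t (x - z)).
  move=> z; rewrite /kap; apply: cvgM; first exact: cvg_cst.
  apply: cvgV; first by rewrite gt_eqF.
  apply: cvgD; first exact: cvg_cst.
  apply: (@continuous_comp _ _ _ (fun z : R => x - z) (fun y : R => y ^+ 2)); last exact: exprn_continuous.
  by apply: cvgB; [exact: cvg_cst|exact: cvg_id].
have dd (z : R) : is_derive z (1 : R) (fun z : R => 2 * atan ((z - x) / t)) (kap t (x - z)).
  have h1 : is_derive z (1 : R) (fun z : R => (z - x) / t) (t^-1).
    by apply: is_derive_eq; rewrite /GRing.scale/=; field.
  have h2 := @is_derive1_comp R atan (fun z : R => (z - x) / t) z _ _ (is_derive1_atan _) h1.
  apply: (is_derive_eq (is_deriveZ 2 h2)).
  have p1 := pos (x - z).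
  have p2 : 0 < 1 + ((z - x) / t) ^+ 2 by rewrite ltr_pwDl ?sqr_ge0.
  have -> : kap t (x - z) = 2 * (t^-1 / (1 + ((z - x) / t) ^+ 2)).
    have -> : 1 + ((z - x) / t) ^+ 2 = (t ^+ 2 + (x - z) ^+ 2) / t ^+ 2 by field.
    by rewrite /kap; field; rewrite t0' gt_eqF.
  by rewrite /GRing.scale/=; ring.
by rewrite (ind_FTC ab cc dd) /Phi mulrBr.
Qed.

Lemma Phi_bound a b t x : a < b -> 0 < t -> 0 <= Phi a b t x <= 2 * pi.
Proof.
move=> ab t0; apply/andP; split.
  by rewrite /Phi mulr_ge0// subr_ge0 le_atan// ler_pM2r ?invr_gt0// lerD2r ltW.
rewrite /Phi.
by have := atan_ltpi2 ((b - x) / t); have := atan_gtNpi2 ((a - x) / t); lra.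
Qed.

Lemma atan_cvg (y : R) : 0 < y -> atan (y / k.+1%:R^-1) @[k --> \oo] --> pi / 2.
Proof.
move=> y0.
have h : y / k.+1%:R^-1 @[k --> \oo] --> (+oo : set_system R).
  apply/cvgryPge => A; near=> k.
  have : A / y <= k%:R by near: k; exact: nbhs_infty_ger.
  rewrite ler_pdivrMr// mulrC invrK => h; apply: le_trans h _.
  by rewrite ler_pM2l// ler_nat.
apply: (@cvg_comp _ _ _ (fun k : nat => y / k.+1%:R^-1) (@atan R) _ (+oo)); first exact: h.
exact: cvgy_atan.
Unshelve. all: by end_near. Qed.

(** At the endpoints the limit would be [pi], the midpoint of the jump; they are excluded, which
    later costs a null set. *)
Lemma Phi_cvg (a b x : R) : a < b -> x != a -> x != b ->
  Phi a b k.+1%:R^-1 x @[k --> \oo] --> 2 * pi * ind a b x.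
Proof.
move=> ab xa xb.
pose L (y : R) : R := if 0 < y then pi / 2 else - (pi / 2).
have at_ (y : R) : y != 0 -> atan (y / k.+1%:R^-1) @[k --> \oo] --> L y.
  move=> y0; rewrite /L; case: ltP => h; first exact: atan_cvg.
  have h' : 0 < - y by rewrite oppr_gt0 lt_neqAle y0.
  have hN : - atan (- y / k.+1%:R^-1) @[k --> \oo] --> - (pi / 2).
    by apply: cvgN; exact: atan_cvg.
  by move: hN; under eq_fun do rewrite mulNr atanN opprK.
have -> : 2 * pi * ind a b x = 2 * (L (b - x) - L (a - x)).
  rewrite /L /ind indicE mem_setE in_itv/= !subr_gt0.
  case: (ltP a x) => h1 /=; case: (ltP x b) => h2 /=.
  - by rewrite ltNge (ltW h1) (ltW h2)/=; lra.
  - by rewrite ltNge (ltW h1)/= leNgt lt_neqAle eq_sym xb h2/= ; lra.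
  - by rewrite (lt_neqAle x a) xa h1/=; lra.
  - by exfalso; lra.
apply: cvgMr; apply: cvgB; apply: at_; rewrite subr_eq0.
  by rewrite eq_sym.
by rewrite eq_sym.
Qed.

End rectangles.

(** * Fourier transforms of rectangles and the Poisson identity *)

Section fourier.
Context {R : realType}.
Local Notation mu := (leb2 R).
Local Notation m := (@lebesgue_measure R).
Variables (a1 b1 a2 b2 : R).
Hypotheses (ab1 : a1 < b1) (ab2 : a2 < b2).

Definition chi (z : plane R) : R := ind a1 b1 z.1 * ind a2 b2 z.2.
(** The Fourier transform of the indicator [chi] is [(2 * pi)^-1] times [CQ - i SQ]. *)
Definition CQ (xi : plane R) : R := \int[mu]_z (chi z * cos (dotp z xi)).
Definition SQ (xi : plane R) : R := \int[mu]_z (chi z * sin (dotp z xi)).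

Lemma measurable_dotp :
  measurable_fun setT (fun w : plane R * plane R => dotp w.1 w.2).
Proof.
by apply: measurable_funD; apply: measurable_funM;
  apply: measurableT_comp => //; apply: measurableT_comp.
Qed.

Lemma measurable_cos_dotp :
  measurable_fun setT (fun w : plane R * plane R => cos (dotp w.1 w.2)).
Proof.
apply: measurableT_comp; last exact: measurable_dotp.
by apply: continuous_measurable_fun; exact: continuous_cos.
Qed.

Lemma measurable_sin_dotp :
  measurable_fun setT (fun w : plane R * plane R => sin (dotp w.1 w.2)).
Proof.
apply: measurableT_comp; last exact: measurable_dotp.
by apply: continuous_measurable_fun; exact: continuous_sin.
Qed.

Lemma dotpC (x y : plane R) : dotp x y = dotp y x.
Proof. by rewrite /dotp mulrC (mulrC x.2). Qed.

Lemma chi_integrable : mu.-integrable setT (EFin \o chi).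
Proof. by apply: tensor_integrable; exact: ind_integrable. Qed.

Lemma measurable_chi : measurable_fun setT chi.
Proof. by have /measurable_int/measurable_EFinP := chi_integrable. Qed.

Lemma chi_bound z : 0 <= chi z <= 1.
Proof.
rewrite /chi /ind !indicE.
by case: (_ \in _); case: (_ \in _); rewrite /= ?mulr0 ?mulr1 ?lexx ?ler01.
Qed.

Lemma CQ_tensor xi : CQ xi = c1 a1 b1 xi.1 * c1 a2 b2 xi.2 - s1 a1 b1 xi.1 * s1 a2 b2 xi.2.
Proof.
rewrite /c1 /s1 -!tensor_integral; try exact: ind_cos_integrable; try exact: ind_sin_integrable.
rewrite -RintegralB//; last 2 first.
- exact: (tensor_integrable (ind_cos_integrable _ _ _) (ind_cos_integrable _ _ _)).
- exact: (tensor_integrable (ind_sin_integrable _ _ _) (ind_sin_integrable _ _ _)).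
by apply: eq_Rintegral => z _; rewrite /chi /dotp cosD; ring.
Qed.

Lemma SQ_tensor xi : SQ xi = c1 a1 b1 xi.1 * s1 a2 b2 xi.2 + s1 a1 b1 xi.1 * c1 a2 b2 xi.2.
Proof.
rewrite /c1 /s1 -!tensor_integral; try exact: ind_cos_integrable; try exact: ind_sin_integrable.
rewrite -RintegralD//; last 2 first.
- exact: (tensor_integrable (ind_cos_integrable _ _ _) (ind_sin_integrable _ _ _)).
- exact: (tensor_integrable (ind_sin_integrable _ _ _) (ind_cos_integrable _ _ _)).
by apply: eq_Rintegral => z _; rewrite /chi /dotp sinD; ring.
Qed.

Lemma measurable_CQ : measurable_fun setT CQ.
Proof.
apply: (@measurable_Rintegral_sec _ _ _ _ _ leb2s (fun w : plane R * plane R => chi w.2 * cos (dotp w.2 w.1))).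
apply: measurable_funM; first exact: measurableT_comp measurable_chi measurable_snd.
under eq_fun do rewrite dotpC; exact: measurable_cos_dotp.
Qed.

Lemma measurable_SQ : measurable_fun setT SQ.
Proof.
apply: (@measurable_Rintegral_sec _ _ _ _ _ leb2s (fun w : plane R * plane R => chi w.2 * sin (dotp w.2 w.1))).
apply: measurable_funM; first exact: measurableT_comp measurable_chi measurable_snd.
under eq_fun do rewrite dotpC; exact: measurable_sin_dotp.
Qed.

Lemma pow1_integrable :
  mu.-integrable setT (EFin \o (fun z : plane R => (1 + z.1 ^+ 2)^-1 * (1 + z.2 ^+ 2)^-1)).
Proof.
have h : m.-integrable setT (EFin \o (fun x : R => (1 + x ^+ 2)^-1)).
  have := @integrable_powR_sqr R 1 (ltac:(lra)); congr (_.-integrable _ (_ \o _)).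
  by apply/funext => x; rewrite powRN powRr1// addr_ge0 ?sqr_ge0.
exact: (tensor_integrable h h).
Qed.

(** A product of two functions decaying like [1 / (1 + |s|)] has its square dominated by the
    integrable product of the [(1 + s ^+ 2)^-1]. The transforms [CQ] and [SQ] are sums or
    differences of two such products. *)
Lemma tensor_L2 (u1 u2 v1 v2 : R -> R) (w : plane R -> R) (K1 K2 : R) :
  (forall s, u1 s ^+ 2 * (1 + s ^+ 2) <= K1) -> (forall s, v1 s ^+ 2 * (1 + s ^+ 2) <= K1) ->
  (forall s, u2 s ^+ 2 * (1 + s ^+ 2) <= K2) -> (forall s, v2 s ^+ 2 * (1 + s ^+ 2) <= K2) ->
  measurable_fun setT w -> (forall z, `|w z| <= `|u1 z.1 * u2 z.2| + `|v1 z.1 * v2 z.2|) ->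
  L2 setT w.
Proof.
move=> h1 g1 h2 g2 mw hw; apply/L2_integrable; split => //.
have i1 := integrableZl measurableT (4 * (K1 * K2)) pow1_integrable.
apply: le_integrable i1 => //.
  by apply/measurable_EFinP; exact: measurable_funX.
move=> z _ /=; rewrite lee_fin ger0_norm ?sqr_ge0//.
have p1 : 0 < 1 + z.1 ^+ 2 by rewrite ltr_pwDl ?sqr_ge0.
have p2 : 0 < 1 + z.2 ^+ 2 by rewrite ltr_pwDl ?sqr_ge0.
apply: le_trans (ler_norm _); rewrite -invfM ler_pdivlMr ?mulr_gt0//.
have e1 : (u1 z.1 * u2 z.2) ^+ 2 * ((1 + z.1 ^+ 2) * (1 + z.2 ^+ 2)) <= K1 * K2.
  have -> : (u1 z.1 * u2 z.2) ^+ 2 * ((1 + z.1 ^+ 2) * (1 + z.2 ^+ 2)) =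
    (u1 z.1 ^+ 2 * (1 + z.1 ^+ 2)) * (u2 z.2 ^+ 2 * (1 + z.2 ^+ 2)) by ring.
  by apply: ler_pM => //; apply: mulr_ge0 (sqr_ge0 _) (ltW _).
have e2 : (v1 z.1 * v2 z.2) ^+ 2 * ((1 + z.1 ^+ 2) * (1 + z.2 ^+ 2)) <= K1 * K2.
  have -> : (v1 z.1 * v2 z.2) ^+ 2 * ((1 + z.1 ^+ 2) * (1 + z.2 ^+ 2)) =
    (v1 z.1 ^+ 2 * (1 + z.1 ^+ 2)) * (v2 z.2 ^+ 2 * (1 + z.2 ^+ 2)) by ring.
  by apply: ler_pM => //; apply: mulr_ge0 (sqr_ge0 _) (ltW _).
have e3 : w z ^+ 2 <= 2 * ((u1 z.1 * u2 z.2) ^+ 2 + (v1 z.1 * v2 z.2) ^+ 2).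
  apply: le_trans (sqr_le_abs (hw z)) _.
  rewrite -(real_normK (num_real (u1 z.1 * u2 z.2))) -(real_normK (num_real (v1 z.1 * v2 z.2))).
  by have := sqr_ge0 (`|u1 z.1 * u2 z.2| - `|v1 z.1 * v2 z.2|); lra.
set P := (1 + z.1 ^+ 2) * (1 + z.2 ^+ 2) in e1 e2 *.
have P0 : 0 <= P by apply: mulr_ge0; exact: ltW.
apply: (le_trans (ler_wpM2r P0 e3)); rewrite -mulrA mulrDl; lra.
Qed.

Lemma CQ_L2 : L2 setT CQ.
Proof.
apply: (@tensor_L2 (c1 a1 b1) (c1 a2 b2) (s1 a1 b1) (s1 a2 b2) _ ((b1 - a1) ^+ 2 + 4) ((b2 - a2) ^+ 2 + 4)).
- by move=> s; exact: c1_decay.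
- by move=> s; exact: s1_decay.
- by move=> s; exact: c1_decay.
- by move=> s; exact: s1_decay.
- exact: measurable_CQ.
- by move=> z; rewrite CQ_tensor; exact: ler_normB.
Qed.

Lemma SQ_L2 : L2 setT SQ.
Proof.
apply: (@tensor_L2 (c1 a1 b1) (s1 a2 b2) (s1 a1 b1) (c1 a2 b2) _ ((b1 - a1) ^+ 2 + 4) ((b2 - a2) ^+ 2 + 4)).
- by move=> s; exact: c1_decay.
- by move=> s; exact: s1_decay.
- by move=> s; exact: s1_decay.
- by move=> s; exact: c1_decay.
- exact: measurable_SQ.
- by move=> z; rewrite SQ_tensor; exact: ler_normD.
Qed.

Lemma CQ_bound : exists M, forall xi, `|CQ xi| <= M /\ `|SQ xi| <= M.
Proof.
exists ((b1 - a1) * (b2 - a2) + (b1 - a1) * (b2 - a2)) => xi.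
have mc s : measurable_fun setT (fun z : R => cos (z * s)).
  by apply: continuous_measurable_fun; exact: continuous_cosM.
have ms s : measurable_fun setT (fun z : R => sin (z * s)).
  by apply: continuous_measurable_fun; exact: continuous_sinM.
have bc (a b s : R) : a < b -> `|c1 a b s| <= b - a.
  by move=> ab; apply: ind_bound => // z; exact: cos_abs1.
have bs (a b s : R) : a < b -> `|s1 a b s| <= b - a.
  by move=> ab; apply: ind_bound => // z; exact: sin_abs1.
split.
  rewrite CQ_tensor; apply: le_trans (ler_normB _ _) _; rewrite !normrM.
  by apply: lerD; apply: ler_pM => //; [exact: bc|exact: bc|exact: bs|exact: bs].
rewrite SQ_tensor; apply: le_trans (ler_normD _ _) _; rewrite !normrM.
by apply: lerD; apply: ler_pM => //; [exact: bc|exact: bs|exact: bs|exact: bc].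
Qed.

(** A product over the coordinates, rather than an exponential of the Euclidean norm, so that its
    transform splits into one-dimensional Poisson kernels. *)
Definition om (t : R) (xi : plane R) : R := eabs t xi.1 * eabs t xi.2.

Lemma om_integrable t : 0 < t -> mu.-integrable setT (EFin \o om t).
Proof. by move=> t0; apply: tensor_integrable; exact: integrable_eabs. Qed.

Lemma measurable_om t : 0 < t -> measurable_fun setT (om t).
Proof. by move=> /om_integrable/measurable_int/measurable_EFinP. Qed.

Lemma om_bound t xi : 0 < t -> 0 <= om t xi <= 1.
Proof.
move=> t0; have /andP[h1 h2] := eabs_le1 xi.1 t0; have /andP[h3 h4] := eabs_le1 xi.2 t0.
by rewrite /om mulr_ge0// mulr_ile1.
Qed.

Lemma om_cos t (z1 z2 : R) : 0 < t ->
  \int[mu]_xi (om t xi * cos (dotp (z1, z2) xi)) = kap t z1 * kap t z2.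
Proof.
move=> t0.
have ic z := integrable_eabs_cos z t0; have is_ z := integrable_eabs_sin z t0.
have -> : \int[mu]_xi (om t xi * cos (dotp (z1, z2) xi)) =
  \int[mu]_xi ((eabs t xi.1 * cos (z1 * xi.1)) * (eabs t xi.2 * cos (z2 * xi.2)) -
     (eabs t xi.1 * sin (z1 * xi.1)) * (eabs t xi.2 * sin (z2 * xi.2))).
  by apply: eq_Rintegral => xi _; rewrite /om /dotp cosD/=; ring.
rewrite RintegralB//; last 2 first.
- exact: (tensor_integrable (ic z1) (ic z2)).
- exact: (tensor_integrable (is_ z1) (is_ z2)).
rewrite (tensor_integral (ic z1) (ic z2)) (tensor_integral (is_ z1) (is_ z2)).
by rewrite !Rintegral_eabs_cos// !Rintegral_eabs_sin// mulr0 subr0.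
Qed.

Lemma chi_bdmul_integrable (c : plane R -> R) (M : R) : measurable_fun setT c ->
  (forall z, `|c z| <= M) -> mu.-integrable setT (EFin \o (fun z => chi z * c z)).
Proof.
by move=> mc cM; exact: (@integrable_bdmul _ _ _ leb2s _ _ M chi_integrable mc cM).
Qed.

Lemma measurable_cos_dotpr xi : measurable_fun setT (fun z : plane R => cos (dotp z xi)).
Proof. exact: measurable_sec2 measurable_cos_dotp. Qed.

Lemma measurable_sin_dotpr xi : measurable_fun setT (fun z : plane R => sin (dotp z xi)).
Proof. exact: measurable_sec2 measurable_sin_dotp. Qed.

Lemma ind_kap_integrable a b t x : 0 < t ->
  m.-integrable setT (EFin \o (fun z => ind a b z * kap t (x - z))).
Proof.
move=> t0; have pos (z : R) : 0 < t ^+ 2 + z ^+ 2 by rewrite ltr_pwDl ?sqr_ge0// exprn_gt0.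
apply: (@integrable_bdmul _ _ _ m _ _ (2 * t / t ^+ 2)); first exact: ind_integrable.
  apply: continuous_measurable_fun => z; rewrite /kap; apply: cvgM; first exact: cvg_cst.
  apply: cvgV; first by rewrite gt_eqF.
  apply: cvgD; first exact: cvg_cst.
  apply: (@continuous_comp _ _ _ (fun z : R => x - z) (fun y : R => y ^+ 2)); last exact: exprn_continuous.
  by apply: cvgB; [exact: cvg_cst|exact: cvg_id].
move=> z; rewrite /kap ger0_norm; last first.
  by apply: mulr_ge0; [apply: mulr_ge0 => //; exact: ltW|rewrite invr_ge0 ltW].
rewrite ler_wpM2l//; first by apply: mulr_ge0 => //; exact: ltW.
by rewrite lef_pV2 ?posrE ?exprn_gt0// lerDl sqr_ge0.
Qed.

Lemma measurable_cos_diff (x : plane R) :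
  measurable_fun setT (fun w : plane R * plane R => cos (dotp (x.1 - w.2.1, x.2 - w.2.2) w.1)).
Proof.
apply: measurableT_comp; first by apply: continuous_measurable_fun; exact: continuous_cos.
rewrite /dotp /=.
by apply: measurable_funD; apply: measurable_funM; (try apply: measurable_funB => //);
  apply: measurableT_comp => //; apply: measurableT_comp.
Qed.

(** The left side is the Abel mean of the inverse Fourier integral of [chi] at [x]. The addition
    formula for the cosine and Fubini turn it into the convolution of [chi] with a product of
    Poisson kernels, which splits over the coordinates. *)
Lemma poisson_rect t (x : plane R) : 0 < t ->
  \int[mu]_xi (om t xi * (CQ xi * cos (dotp x xi) + SQ xi * sin (dotp x xi))) =
  Phi a1 b1 t x.1 * Phi a2 b2 t x.2.
Proof.
move=> t0.
have E xi : CQ xi * cos (dotp x xi) + SQ xi * sin (dotp x xi) =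
    \int[mu]_z (chi z * cos (dotp (x.1 - z.1, x.2 - z.2) xi)).
  have ic := chi_bdmul_integrable (measurable_cos_dotpr xi) (fun z => cos_abs1 _).
  have is_ := chi_bdmul_integrable (measurable_sin_dotpr xi) (fun z => sin_abs1 _).
  rewrite /CQ /SQ -!RintegralZr// -RintegralD//; last 2 first.
  - exact: (@integrable_bdmul _ _ _ leb2s _ (fun=> cos (dotp x xi)) 1 ic (@measurable_cst _ _ _ _ _ _) (fun=> cos_abs1 _)).
  - exact: (@integrable_bdmul _ _ _ leb2s _ (fun=> sin (dotp x xi)) 1 is_ (@measurable_cst _ _ _ _ _ _) (fun=> sin_abs1 _)).
  apply: eq_Rintegral => z _.
  have -> : dotp (x.1 - z.1, x.2 - z.2) xi = dotp x xi - dotp z xi by rewrite /dotp/=; ring.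
  by rewrite cosB; ring.
under eq_Rintegral do rewrite E.
have F := @Rfubini_kernel _ _ _ _ R leb2s leb2s (om t) chi
  (fun w : plane R * plane R => cos (dotp (x.1 - w.2.1, x.2 - w.2.2) w.1)) 1
  (om_integrable t0) chi_integrable (measurable_cos_diff x) (fun w => cos_abs1 _).
etransitivity; first exact: F.
rewrite /=.
have -> : \int[leb2s]_y (chi y * \int[leb2s]_x0 (om t x0 * cos (dotp (x.1 - y.1, x.2 - y.2) x0))) =
  \int[mu]_z ((ind a1 b1 z.1 * kap t (x.1 - z.1)) * (ind a2 b2 z.2 * kap t (x.2 - z.2))).
  apply: eq_Rintegral => z _.
  by rewrite (_ : \int[leb2s]_x0 _ = kap t (x.1 - z.1) * kap t (x.2 - z.2)) ?om_cos// /chi; ring.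
rewrite (tensor_integral (ind_kap_integrable _ _ _ t0) (ind_kap_integrable _ _ _ t0)).
by rewrite !Phi_int.
Qed.

Variable f : plane R -> R.
Hypothesis if_ : mu.-integrable setT (EFin \o f).

Definition fcos (xi : plane R) : R := \int[mu]_x (f x * cos (dotp x xi)).
Definition fsin (xi : plane R) : R := \int[mu]_x (f x * sin (dotp x xi)).

Let mf : measurable_fun setT f.
Proof. by have /measurable_int/measurable_EFinP := if_. Qed.

Lemma measurable_fcos : measurable_fun setT fcos.
Proof.
apply: (@measurable_Rintegral_sec _ _ _ _ _ leb2s (fun w : plane R * plane R => f w.2 * cos (dotp w.2 w.1))).
apply: measurable_funM; first exact: measurableT_comp mf measurable_snd.
under eq_fun do rewrite dotpC; exact: measurable_cos_dotp.
Qed.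

Lemma measurable_fsin : measurable_fun setT fsin.
Proof.
apply: (@measurable_Rintegral_sec _ _ _ _ _ leb2s (fun w : plane R * plane R => f w.2 * sin (dotp w.2 w.1))).
apply: measurable_funM; first exact: measurableT_comp mf measurable_snd.
under eq_fun do rewrite dotpC; exact: measurable_sin_dotp.
Qed.

(** Parseval's relation between [f] and the rectangle, made absolutely convergent by the factor
    [om t]: the inverse transform is moved from [f] onto the rectangle, where it is explicit. *)
Lemma poisson_identity t : 0 < t ->
  \int[mu]_xi (om t xi * (CQ xi * fcos xi + SQ xi * fsin xi)) =
  \int[mu]_x (f x * (Phi a1 b1 t x.1 * Phi a2 b2 t x.2)).
Proof.
move=> t0; have [M hM] := CQ_bound.
have E xi : CQ xi * fcos xi + SQ xi * fsin xi =
    \int[mu]_x (f x * (CQ xi * cos (dotp x xi) + SQ xi * sin (dotp x xi))).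
  have ic := @integrable_bdmul _ _ _ leb2s _ _ 1 if_ (measurable_cos_dotpr xi) (fun z => cos_abs1 _).
  have is_ := @integrable_bdmul _ _ _ leb2s _ _ 1 if_ (measurable_sin_dotpr xi) (fun z => sin_abs1 _).
  rewrite /fcos /fsin -!RintegralZl// -RintegralD//; last 2 first.
  - exact: (integrableRZ measurableT (CQ xi) ic).
  - exact: (integrableRZ measurableT (SQ xi) is_).
  by apply: eq_Rintegral => z _; ring.
under eq_Rintegral do rewrite E.
under [RHS]eq_Rintegral do rewrite -poisson_rect//.
have mc : measurable_fun setT (fun w : plane R * plane R => CQ w.2 * cos (dotp w.1 w.2) + SQ w.2 * sin (dotp w.1 w.2)).
  apply: measurable_funD; apply: measurable_funM.
  - exact: measurableT_comp measurable_CQ measurable_snd.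
  - exact: measurable_cos_dotp.
  - exact: measurableT_comp measurable_SQ measurable_snd.
  - exact: measurable_sin_dotp.
have cM (w : plane R * plane R) : `|CQ w.2 * cos (dotp w.1 w.2) + SQ w.2 * sin (dotp w.1 w.2)| <= M + M.
  have [h1 h2] := hM w.2; have h3 := cos_abs1 (dotp w.1 w.2); have h4 := sin_abs1 (dotp w.1 w.2).
  apply: le_trans (ler_normD _ _) _; rewrite !normrM; apply: lerD.
    by apply: le_trans h1; rewrite ler_piMr.
  by apply: le_trans h2; rewrite ler_piMr.
have F := @Rfubini_kernel _ _ _ _ R leb2s leb2s f (om t) _ _ if_ (om_integrable t0) mc cM.
exact/esym/F.
Qed.

Lemma ae_fst_neq (c : R) : {ae mu, forall x, x.1 != c}.
Proof.
exists ([set c] `*` setT); split.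
- exact: measurableX.
- by rewrite leb2_rect// lebesgue_measure_set1 mul0e.
- by move=> x /= /negP; rewrite negbK => /eqP ->.
Qed.

Lemma ae_snd_neq (c : R) : {ae mu, forall x, x.2 != c}.
Proof.
exists (setT `*` [set c]); split.
- exact: measurableX.
- by rewrite leb2_rect// lebesgue_measure_set1 mule0.
- by move=> x /= /negP; rewrite negbK => /eqP ->.
Qed.

Lemma om_cvg xi : om k.+1%:R^-1 xi @[k --> \oo] --> (1 : R).
Proof.
have h (s : R) : eabs k.+1%:R^-1 s @[k --> \oo] --> (1 : R).
  rewrite /eabs -[X in _ --> X]expR0.
  apply: (@cvg_comp _ _ _ (fun k : nat => - (k.+1%:R^-1 * `|s|)) expR _ (nbhs 0)); last exact: continuous_expR.
  have hs : - (k.+1%:R^-1 * `|s|) @[k --> \oo] --> - (0 * `|s|).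
    by apply: cvgN; apply: cvgMl; exact: cvg_harmonic.
  by move: hs; rewrite mul0r oppr0.
by rewrite -[X in _ --> X](mulr1 1); apply: cvgM; exact: h.
Qed.

(** Both sides of [poisson_identity] pass to the limit [t = 1 / (k + 1)] by dominated convergence,
    with majorants [|CQ * fcos + SQ * fsin|] and [(2 * pi) ^+ 2 * |f|]. *)
Lemma inversion_rect :
  mu.-integrable setT (EFin \o (fun xi => CQ xi * fcos xi + SQ xi * fsin xi)) ->
  \int[mu]_xi (CQ xi * fcos xi + SQ xi * fsin xi) =
  (2 * pi) ^+ 2 * \int[mu]_x (f x * chi x).
Proof.
move=> iG.
set G := fun xi => CQ xi * fcos xi + SQ xi * fsin xi in iG *.
have mG : measurable_fun setT G by have /measurable_int/measurable_EFinP := iG.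
have t0 k : 0 < k.+1%:R^-1 :> R by rewrite invr_gt0.
have c1_ : \int[mu]_xi (om k.+1%:R^-1 xi * G xi) @[k --> \oo] --> \int[mu]_xi G xi.
  apply: (@Rintegral_dct _ _ _ mu _ _ (fun xi => `|G xi|)).
  - by move=> k; apply: measurable_funM => //; exact: measurable_om.
  - exact: mG.
  - apply: aeW => xi; rewrite -[X in _ --> X]mul1r; apply: cvgMl; exact: om_cvg.
  - exact: (integrable_norm iG).
  - move=> k xi; rewrite normrM; have /andP[h1 h2] := om_bound xi (t0 k).
    by rewrite ger0_norm// ler_piMl.
have pi0 : 0 <= 2 * pi :> R by rewrite mulr_ge0// pi_ge0.
have mPhi a b t : a < b -> 0 < t -> measurable_fun setT (Phi a b t : R -> R).
  move=> ab tt; apply: measurable_funM => //.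
  have cat (c : R) : continuous (fun x : R => atan ((c - x) / t)).
    move=> x; apply: (@continuous_comp _ _ _ (fun x : R => (c - x) / t) (@atan R)); last exact: continuous_atan.
    by apply: cvgM; [apply: cvgB; [exact: cvg_cst|exact: cvg_id]|exact: cvg_cst].
  by apply: measurable_funB; exact: continuous_measurable_fun.
have c2_ : \int[mu]_x (f x * (Phi a1 b1 k.+1%:R^-1 x.1 * Phi a2 b2 k.+1%:R^-1 x.2)) @[k --> \oo]
   --> \int[mu]_x ((2 * pi) ^+ 2 * (f x * chi x)).
  apply: (@Rintegral_dct _ _ _ mu _ _ (fun x => (2 * pi) ^+ 2 * `|f x|)).
  - move=> k; apply: measurable_funM => //; apply: measurable_funM.
      exact: (measurableT_comp (mPhi _ _ _ ab1 (t0 k)) measurable_fst).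
    exact: (measurableT_comp (mPhi _ _ _ ab2 (t0 k)) measurable_snd).
  - by apply: measurable_funM => //; apply: measurable_funM => //; exact: measurable_chi.
  (* The Poisson integrals converge to the indicator off the four lines carrying the edges, which
     are null. *)
  - have H : {ae mu, forall x, (x.1 != a1 /\ x.1 != b1) /\ (x.2 != a2 /\ x.2 != b2)}.
      by apply: ae_and; apply: ae_and; (exact: ae_fst_neq || exact: ae_snd_neq).
    apply: ae_imp H => x [[h1 h2] [h3 h4]].
    have -> : (2 * pi) ^+ 2 * (f x * chi x) =
        f x * ((2 * pi * ind a1 b1 x.1) * (2 * pi * ind a2 b2 x.2)).
      by rewrite /chi; ring.
    by apply: cvgMr; apply: cvgM; exact: Phi_cvg.
  - exact: (integrableRZ measurableT _ (integrable_norm if_)).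
  - move=> k x; rewrite normrM mulrC ler_wpM2r//.
    have /andP[p1 p2] := Phi_bound x.1 ab1 (t0 k); have /andP[p3 p4] := Phi_bound x.2 ab2 (t0 k).
    by rewrite normrM !ger0_norm// expr2 ler_pM.
have E k : \int[mu]_xi (om k.+1%:R^-1 xi * G xi) =
  \int[mu]_x (f x * (Phi a1 b1 k.+1%:R^-1 x.1 * Phi a2 b2 k.+1%:R^-1 x.2)) by exact: poisson_identity.
have ifc : mu.-integrable setT (EFin \o (fun x => f x * chi x)).
  apply: (@integrable_bdmul _ _ _ leb2s _ _ 1 if_ measurable_chi) => x.
  by have /andP[h1 h2] := chi_bound x; rewrite ger0_norm.
rewrite -RintegralZl//; apply: cvg_unique c2_; first exact: Rhausdorff.
move: c1_; under eq_fun do rewrite E; exact.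
Qed.

End fourier.

(** * Half-open rectangles generate the Borel sets *)

Section rect_generation.
Context {R : realType}.
Local Notation mu := (leb2 R).

Definition rect (a1 b1 a2 b2 : R) : set (plane R) :=
  `]a1, b1]%classic `*` `]a2, b2]%classic.

Definition rects : set (set (plane R)) :=
  [set A | exists a1 b1 a2 b2, A = rect a1 b1 a2 b2].

Lemma measurable_rect a1 b1 a2 b2 : measurable (rect a1 b1 a2 b2).
Proof. exact: measurableX. Qed.

Lemma bigcup_ocT : \bigcup_n `](- n%:R : R), n%:R]%classic = setT.
Proof.
apply/seteqP; split=> // x _; exists (Num.bound `|x|) => //=.
have hn : `|x| < (Num.bound `|x|)%:R by exact: archi_boundP.
by rewrite in_itv/=; move: hn; rewrite ltr_norml => /andP[h1 h2]; rewrite h1 ltW.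
Qed.

(** One side is treated at a time: with the other side fixed, the sets whose product lies in the
    generated sigma-algebra form a sigma-algebra containing the half-open intervals. The first pass
    fixes an interval, the second an arbitrary Borel set. *)
Lemma measurable_rects : @measurable _ (plane R) = <<s rects >>.
Proof.
apply/seteqP; split; last first.
  apply: smallest_sub; first exact: sigma_algebra_measurable.
  by move=> _ [a1 [b1 [a2 [b2 ->]]]]; exact: measurable_rect.
pose S := @measurable _ (g_sigma_algebraType rects).
have SR a1 b1 a2 b2 : S (rect a1 b1 a2 b2).
  by apply: sub_sigma_algebra; exists a1, b1, a2, b2.
have S1 (c d : R) : (@measurable _ (measurableTypeR R)) `<=` [set A | S (A `*` `]c, d]%classic)].
  have ST : S (setT `*` `]c, d]%classic).
    rewrite -bigcup_ocT setX_bigcupl; apply: bigcupT_measurable => n; exact: SR.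
  apply: smallest_sub; first split.
  - by rewrite /= set0X; exact: measurable0.
  - move=> A SA /=; rewrite (_ : (setT `\` A) `*` _ = (setT `*` `]c, d]%classic) `\` (A `*` `]c, d]%classic)).
      exact: measurableD.
    apply/seteqP; split => -[x y] /=; first by move=> [[_ nA] h]; split => // -[].
    by move=> [[_ h] nA]; split => //; split => // Ax; apply: nA.
  - move=> A SA /=; rewrite setX_bigcupl; apply: bigcupT_measurable => n; exact: SA.
  - move=> _ [[a b] _ <-]; exact: SR.
have S2 (A : set (measurableTypeR R)) : measurable A ->
    (@measurable _ (measurableTypeR R)) `<=` [set B | S (A `*` B)].
  move=> mA.
  have ST : S (A `*` setT).
    rewrite -bigcup_ocT setX_bigcupr; apply: bigcupT_measurable => n; exact: S1.
  apply: smallest_sub; first split.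
  - by rewrite /= setX0; exact: measurable0.
  - move=> B SB /=; rewrite (_ : A `*` (setT `\` B) = (A `*` setT) `\` (A `*` B)).
      exact: measurableD.
    apply/seteqP; split => -[x y] /=; first by move=> [h [_ nB]]; split => // -[].
    by move=> [[h _] nA]; split => //; split => // Bx; apply: nA.
  - move=> B SB /=; rewrite setX_bigcupr; apply: bigcupT_measurable => n; exact: SB.
  - by move=> _ [[a b] _ <-]; exact: S1.
rewrite measurable_prod_measurableType; apply: smallest_sub.
  exact: (@sigma_algebra_measurable _ (g_sigma_algebraType rects)).
by move=> _ [A mA [B mB <-]]; exact: S2.
Qed.

Lemma itv_ocI (a b c d : R) :
  `]a, b]%classic `&` `]c, d]%classic = `]Num.max a c, Num.min b d]%classic.
Proof.
apply/seteqP; split => x /=; rewrite !in_itv/= gt_max le_min.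
  by move=> [/andP[-> ->] /andP[-> ->]].
by move=> /andP[/andP[-> ->] /andP[-> ->]].
Qed.

Lemma rects_setI : setI_closed rects.
Proof.
move=> _ _ [a1 [b1 [a2 [b2 ->]]]] [c1 [d1 [c2 [d2 ->]]]].
by rewrite /rect -setXI !itv_ocI; do 4 eexists.
Qed.

Lemma box_rect n : box n = rect (- n%:R) n%:R (- n%:R) n%:R.
Proof. by []. Qed.

(** Dynkin's theorem: the sets over which [u] integrates to zero inside the box form a Dynkin system
    containing the rectangles, which are stable under intersection. Complements are covered because
    the box is itself a rectangle. *)
Lemma ae0_of_rects (u : plane R -> R) (N : nat) :
  mu.-integrable (box N) (EFin \o u) ->
  (forall a1 b1 a2 b2, rect a1 b1 a2 b2 `<=` box N ->
     \int[mu]_(x in rect a1 b1 a2 b2) u x = 0) ->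
  {ae mu, forall x, box N x -> u x = 0}.
Proof.
move=> iu h0.
have mB := @measurable_box R N.
have iuS (A : set (plane R)) : measurable A -> mu.-integrable (A `&` box N) (EFin \o u).
  by move=> mA; apply: integrableS iu => //; exact: measurableI.
have hr a1 b1 a2 b2 : (\int[mu]_(x in rect a1 b1 a2 b2 `&` box N) (u x)%:E = 0)%E.
  have [c1 [d1 [c2 [d2 E]]]] : rects (rect a1 b1 a2 b2 `&` box N).
    by apply: rects_setI; [exists a1, b1, a2, b2|rewrite box_rect; do 4 eexists].
  have I : mu.-integrable (rect c1 d1 c2 d2) (EFin \o u).
    by rewrite -E; apply: iuS; exact: measurable_rect.
  rewrite E -(EFin_Rintegral (measurable_rect _ _ _ _) I) h0// -E.
  exact: subIsetr.
have hB : (\int[mu]_(x in box N) (u x)%:E = 0)%E.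
  by have := hr (- N%:R) N%:R (- N%:R) N%:R; rewrite -box_rect setIid.
have key (A : set (plane R)) : measurable A -> (\int[mu]_(x in A `&` box N) (u x)%:E = 0)%E.
  have L : dynkin [set A : set (plane R) | measurable A /\ (\int[mu]_(x in A `&` box N) (u x)%:E = 0)%E].
    split.
    - by split => //; rewrite setTI.
    - move=> B [mB' B0]; split; first exact: measurableC.
      have E : box N = (~` B `&` box N) `|` (B `&` box N) by rewrite -setIUl setvU setTI.
      move: hB; rewrite {1}E integral_setU ?B0 ?adde0//.
      + by apply: measurableI => //; exact: measurableC.
      + exact: measurableI.
      + by rewrite -E; exact: measurable_int iu.
      + by apply/disj_setPS => x [[nA _] [Ax _]]; exact: nA.
    - move=> F tF hF; split; first by apply: bigcupT_measurable => n; case: (hF n).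
      rewrite setI_bigcupl integral_bigcup//.
      + by rewrite eseries0// => n _ _; case: (hF n).
      + exact: trivIset_setIr.
      + by move=> n; apply: measurableI => //; case: (hF n).
      + rewrite -setI_bigcupl; apply: iuS; apply: bigcupT_measurable => n; by case: (hF n).
  move=> mA.
  have : <<d rects >> A.
    by rewrite (setI_closed_g_dynkin_g_sigma_algebra rects_setI) -measurable_rects.
  move=> h; have [] // := h _ (conj L _) => _ [a1 [b1 [a2 [b2 ->]]]].
  by split; [exact: measurable_rect|exact: hr].
have : ae_eq mu (box N) (EFin \o u) (cst 0%E).
  apply: integral_ae_eq => //.
  by move=> E EB mE; rewrite integral0 -(setIidl EB); exact: key.
by apply: ae_imp => x hx Bx; have /= [] := hx Bx.
Qed.

End rect_generation.

(** * Embedding of H^s into bounded functions *)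

Section sobolev_weight.
Context {R : realType}.
Local Notation mu := (leb2 R).
Variable s : R.
Hypothesis s_gt1 : 1 < s.

(* [tw] is a product dominating [wt^-1], by
   [(1 + xi.1 ^+ 2) * (1 + xi.2 ^+ 2) <= (1 + dotp xi xi) ^+ 2]. *)
Definition wt (xi : plane R) : R := (1 + dotp xi xi) `^ s.
Definition tw (xi : plane R) : R :=
  (1 + xi.1 ^+ 2) `^ (- (s / 2)) * (1 + xi.2 ^+ 2) `^ (- (s / 2)).

Lemma wt_gt0 xi : 0 < wt xi.
Proof. by apply: powR_gt0; rewrite ltr_pwDl// addr_ge0// -expr2 sqr_ge0. Qed.

Lemma measurable_wt : measurable_fun setT wt.
Proof.
apply: (measurableT_comp (measurable_powR s)).
apply: measurable_funD; first exact: measurable_cst.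
by apply: measurable_funD; apply: measurable_funM; (exact: measurable_fst || exact: measurable_snd).
Qed.

(** Here [s > 1] enters: each factor is a power of [1 + x ^+ 2] with exponent beyond [1 / 2] in
    absolute value. *)
Lemma tw_integrable : mu.-integrable setT (EFin \o tw).
Proof.
have h : 1 / 2 < s / 2 by rewrite ltr_pM2r// invr_gt0.
exact: (tensor_integrable (integrable_powR_sqr h) (integrable_powR_sqr h)).
Qed.

Lemma wtV_le xi : (wt xi)^-1 <= tw xi.
Proof.
have p1 : 0 < 1 + xi.1 ^+ 2 by rewrite ltr_pwDl ?sqr_ge0.
have p2 : 0 < 1 + xi.2 ^+ 2 by rewrite ltr_pwDl ?sqr_ge0.
have q1 := sqr_ge0 xi.1; have q2 := sqr_ge0 xi.2.
have p3 : 0 <= 1 + dotp xi xi by rewrite /dotp -!expr2 addr_ge0// addr_ge0.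
rewrite /tw !powRN -invfM lef_pV2 ?posrE; [|exact: wt_gt0|by rewrite mulr_gt0// powR_gt0].
rewrite -powRM; [|exact: ltW..].
have -> : wt xi = ((1 + dotp xi xi) ^+ 2) `^ (s / 2).
  by rewrite -powR_mulrn// -powRrM /wt; congr (_ `^ _); field.
apply: ge0_ler_powR; rewrite ?nnegrE ?sqr_ge0//.
  by rewrite divr_ge0// ltW// (lt_trans ltr01).
  by rewrite mulr_ge0// ltW.
by rewrite /dotp; nra.
Qed.

(** The inequality of the means, in the form [wt xi * (|a| - (wt xi)^-1) ^+ 2 >= 0], which spares
    the square root of the weight. It turns a weighted L^2 bound into an L^1 bound. *)
Lemma abs_le_wt xi (a : R) : `|a| <= 2^-1 * (wt xi * a ^+ 2 + tw xi).
Proof.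
have w0 := wt_gt0 xi; have h := wtV_le xi.
set i := (wt xi)^-1 in h; have wi : wt xi * i = 1 by rewrite mulfV// gt_eqF.
have : 0 <= wt xi * (`|a| - i) ^+ 2 by rewrite mulr_ge0 ?sqr_ge0 ?ltW.
have -> : wt xi * (`|a| - i) ^+ 2 = wt xi * `|a| ^+ 2 - 2 * `|a| * (wt xi * i) + (wt xi * i) * i by ring.
rewrite wi real_normK ?num_real//; lra.
Qed.

Variables (a b : plane R -> R) (K : R).
Hypotheses (ma : measurable_fun setT a) (mb : measurable_fun setT b).
Hypothesis wK : (Hs_weight s a b <= K%:E)%E.

Lemma weight_integrable :
  mu.-integrable setT (EFin \o (fun xi => wt xi * (a xi ^+ 2 + b xi ^+ 2))).
Proof.
apply/integrableP; split.
  apply/measurable_EFinP; apply: measurable_funM; first exact: measurable_wt.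
  by apply: measurable_funD; exact: measurable_funX.
apply: le_lt_trans (ltry K); apply: le_trans wK; rewrite /Hs_weight.
under eq_integral do rewrite gee0_abs ?lee_fin ?mulr_ge0 ?addr_ge0 ?sqr_ge0 ?ltW ?wt_gt0//.
by [].
Qed.

Lemma weight_bound_integrable :
  mu.-integrable setT (EFin \o (fun xi => 2^-1 * (wt xi * (a xi ^+ 2 + b xi ^+ 2)) + tw xi)).
Proof.
apply: (integrableRD measurableT); last exact: tw_integrable.
by apply: (integrableRZ measurableT); exact: weight_integrable.
Qed.

Lemma absD_le_weight xi :
  `|a xi| + `|b xi| <= 2^-1 * (wt xi * (a xi ^+ 2 + b xi ^+ 2)) + tw xi.
Proof. by have := abs_le_wt xi (a xi); have := abs_le_wt xi (b xi); lra. Qed.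

Lemma weight_L1l : mu.-integrable setT (EFin \o a).
Proof.
apply: le_integrable weight_bound_integrable => //; first exact/measurable_EFinP.
move=> xi _; rewrite lee_fin; apply: le_trans (ler_norm _).
by have := absD_le_weight xi; have := normr_ge0 (b xi); lra.
Qed.

Lemma weight_L1r : mu.-integrable setT (EFin \o b).
Proof.
apply: le_integrable weight_bound_integrable => //; first exact/measurable_EFinP.
move=> xi _; rewrite lee_fin; apply: le_trans (ler_norm _).
by have := absD_le_weight xi; have := normr_ge0 (a xi); lra.
Qed.

Lemma weight_L1_bound :
  \int[mu]_xi `|a xi| + \int[mu]_xi `|b xi| <= 2^-1 * K + \int[mu]_xi tw xi.
Proof.
have ia := integrable_norm weight_L1l; have ib := integrable_norm weight_L1r.
have iw := weight_integrable.
have iZ := integrableRZ measurableT 2^-1 iw.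
rewrite -(RintegralD measurableT ia ib).
apply: (@le_trans _ _ (\int[mu]_xi (2^-1 * (wt xi * (a xi ^+ 2 + b xi ^+ 2)) + tw xi))).
  apply: le_Rintegral => //.
  - exact: (integrableRD measurableT ia ib).
  - exact: weight_bound_integrable.
  - by move=> xi _; exact: absD_le_weight.
rewrite (RintegralD measurableT iZ tw_integrable) (RintegralZl _ measurableT iw).
rewrite lerD2r ler_wpM2l// -lee_fin (EFin_Rintegral measurableT iw).
exact: wK.
Qed.

End sobolev_weight.

(** * The Fourier-Plancherel transform paired with rectangles *)

Section fourier_uniqueness.
Context {R : realType}.
Local Notation mu := (leb2 R).
Implicit Types u v w C S a b : plane R -> R.

(** Cauchy-Schwarz in Young's form; the free [eta] will balance a fixed norm against a small one. *)
Lemma L2_pair_le C S u w (eta : R) : 0 < eta -> L2 setT C -> L2 setT S -> L2 setT u -> L2 setT w ->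
  `|\int[mu]_x (C x * u x - S x * w x)| <=
  2^-1 * (eta * (\int[mu]_x (C x ^+ 2) + \int[mu]_x (S x ^+ 2)) +
          eta^-1 * (\int[mu]_x (u x ^+ 2) + \int[mu]_x (w x ^+ 2))).
Proof.
move=> e0 LC LS Lu Lw.
have mT : measurable [set: plane R] by [].
have i1 := L2_mul mT LC Lu; have i2 := L2_mul mT LS Lw.
have i3 := integrableRD mT (L2_sq LC) (L2_sq LS).
have i4 := integrableRD mT (L2_sq Lu) (L2_sq Lw).
have i5 := integrableRZ mT eta i3; have i6 := integrableRZ mT eta^-1 i4.
have i7 := integrableRD mT i5 i6.
have i12 := integrableRB mT i1 i2.
apply: (le_trans (le_normr_Rintegral mT i12)).
apply: (@le_trans _ _ (\int[mu]_x (2^-1 * (eta * (C x ^+ 2 + S x ^+ 2) + eta^-1 * (u x ^+ 2 + w x ^+ 2))))).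
  apply: le_Rintegral => //.
  - exact: (integrable_norm i12).
  - exact: (integrableRZ mT 2^-1 i7).
  - move=> x _.
    have ei : eta * eta^-1 = 1 by rewrite mulfV// gt_eqF.
    have i0 : 0 < eta^-1 by rewrite invr_gt0.
    set i := eta^-1 in ei i0 *.
    have H (A B : R) : `|A * B| <= 2^-1 * (eta * A ^+ 2 + i * B ^+ 2).
      have h (B' : R) : A * B' <= 2^-1 * (eta * A ^+ 2 + i * B' ^+ 2).
        have : 0 <= i * (eta * A - B') ^+ 2 by rewrite mulr_ge0 ?sqr_ge0 ?ltW.
        have -> : i * (eta * A - B') ^+ 2 = (eta * i) * (eta * A ^+ 2) - 2 * (eta * i) * (A * B') + i * B' ^+ 2 by ring.
        by rewrite ei; lra.
      have := h (- B); rewrite sqrrN mulrN => h1; have h2 := h B.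
      by rewrite ler_norml; apply/andP; split; lra.
    apply: le_trans (ler_normB _ _) _.
    by have := H (C x) (u x); have := H (S x) (w x); lra.
by rewrite (RintegralZl _ mT i7) (RintegralD mT i5 i6) (RintegralZl _ mT i3) (RintegralZl _ mT i4)
  (RintegralD mT (L2_sq LC) (L2_sq LS)) (RintegralD mT (L2_sq Lu) (L2_sq Lw)).
Qed.

Definition disc (n : nat) : set (plane R) := [set x | dist2 x (0, 0) <= n%:R].

Lemma continuous_dist20 : continuous (fun x : plane R => dist2 x (0, 0)).
Proof.
move=> x; rewrite /dist2; apply: continuous_comp; last exact: sqrt_continuous.
apply: cvgD; apply: (@cvg_comp _ _ _ _ (fun t : R => t ^+ 2) _ (nbhs _)).
- by apply: cvgB; [exact: cvg_fst|exact: cvg_cst].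
- exact: exprn_continuous.
- by apply: cvgB; [exact: cvg_snd|exact: cvg_cst].
- exact: exprn_continuous.
Qed.

Lemma measurable_disc n : measurable (disc n).
Proof.
have := @continuous_measurable2 R _ setT continuous_dist20 measurableT _ (measurable_itv `]-oo, n%:R]).
by rewrite setTI; congr (measurable _); apply/seteqP; split => x /=; rewrite in_itv/=.
Qed.

Lemma dist20_abs (x : plane R) : `|x.1| <= dist2 x (0, 0) /\ `|x.2| <= dist2 x (0, 0).
Proof.
rewrite /dist2 /= !subr0; have := sqr_ge0 x.1; have := sqr_ge0 x.2 => h1 h2.
by split; rewrite -sqrtr_sqr ler_wsqrtr//; lra.
Qed.

(** The index grows by one because the box omits its left and lower edges. *)
Lemma disc_sub_box n : disc n `<=` box n.+1.
Proof.
move=> x; rewrite /disc/= => h; have [] := dist20_abs x.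
move=> /le_trans/(_ h) + /le_trans/(_ h).
rewrite !ler_norml => /andP[h1 h2] /andP[h3 h4].
by split; rewrite /= in_itv/= -natr1; apply/andP; split; lra.
Qed.

Lemma box_sub_disc n : box n `<=` disc n.*2.
Proof.
move=> x [/=]; rewrite !in_itv/= => /andP[h1 h2] /andP[h3 h4]; rewrite /disc/= /dist2/= !subr0.
have n0 : 0 <= n%:R :> R by [].
rewrite -(ger0_norm (ler0n R n.*2)) -sqrtr_sqr ler_wsqrtr//.
by rewrite -muln2 natrM; nra.
Qed.

Lemma disc_fin n : (mu (disc n) < +oo)%E.
Proof.
apply: le_lt_trans (leb2_box_fin n.+1); apply: le_measure; rewrite ?inE//.
- exact: measurable_disc.
- exact: measurable_box.
- exact: disc_sub_box.
Qed.

Lemma L2S (A B : set (plane R)) u : measurable A -> measurable B -> A `<=` B -> L2 B u -> L2 A u.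
Proof.
move=> mA mB AB /L2_integrable[m i]; apply/L2_integrable; split.
  exact: measurable_funS m.
exact: integrableS i.
Qed.

Lemma L2_L1 (A : set (plane R)) u : measurable A -> (mu A < +oo)%E -> L2 A u ->
  mu.-integrable A (EFin \o u).
Proof.
move=> mA fA Lu.
have L1 : L2 A (fun=> 1) by apply: (@L2_bounded _ _ mA _ 1) => // x _; rewrite normr1.
have := L2_mul mA L1 Lu; congr (_.-integrable _ (_ \o _)).
by apply/funext => x; rewrite mul1r.
Qed.

Lemma integrable_patch (A : set (plane R)) u : measurable A -> mu.-integrable A (EFin \o u) ->
  mu.-integrable setT (EFin \o (u \_ A)).
Proof.
move=> mA iu; have := (integrable_mkcond _ mA).1 iu.
by rewrite restrict_EFin.
Qed.

Lemma chi_patch (a1 b1 a2 b2 : R) u x :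
  u x * chi a1 b1 a2 b2 x = (u \_ (rect a1 b1 a2 b2)) x.
Proof.
rewrite /chi /ind !indicE patchE /rect in_setX.
by case: (x.1 \in _); case: (x.2 \in _); rewrite /= ?mulr1 ?mulr0.
Qed.

Lemma fcos_trunc v n xi :
  fourier_trunc_re v n xi = (2 * pi)^-1 * fcos (v \_ (disc n)) xi.
Proof.
rewrite /fourier_trunc_re Rintegral_mkcond; congr (_ * _); apply: eq_Rintegral => x _.
by rewrite !patchE; case: ifP => _; rewrite ?mul0r.
Qed.

Lemma fsin_trunc v n xi :
  fourier_trunc_im v n xi = - ((2 * pi)^-1 * fsin (v \_ (disc n)) xi).
Proof.
rewrite /fourier_trunc_im Rintegral_mkcond; congr (- (_ * _)); apply: eq_Rintegral => x _.
by rewrite !patchE; case: ifP => _; rewrite ?mul0r.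
Qed.

Section inverse_transform.
Variables v a b : plane R -> R.
Hypothesis Fv : is_fourier v a b.

Let Lv : L2 setT v. Proof. by case: Fv. Qed.
Let La : L2 setT a. Proof. by case: Fv. Qed.
Let Lb : L2 setT b. Proof. by case: Fv. Qed.

Lemma patch_disc_integrable n : mu.-integrable setT (EFin \o (v \_ (disc n))).
Proof.
apply: integrable_patch; first exact: measurable_disc.
apply: L2_L1; [exact: measurable_disc|exact: disc_fin|].
by apply: (L2S (measurable_disc n) measurableT) => //; exact: Lv.
Qed.

Lemma measurable_trunc_re n : measurable_fun setT (fourier_trunc_re v n).
Proof.
rewrite (_ : fourier_trunc_re v n = fun xi => (2 * pi)^-1 * fcos (v \_ (disc n)) xi).
  by apply: measurable_funM => //; apply: measurable_fcos; exact: patch_disc_integrable.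
by apply/funext => xi; exact: fcos_trunc.
Qed.

Lemma measurable_trunc_im n : measurable_fun setT (fourier_trunc_im v n).
Proof.
rewrite (_ : fourier_trunc_im v n = fun xi => - ((2 * pi)^-1 * fsin (v \_ (disc n)) xi)).
  apply: measurableT_comp => //.
  by apply: measurable_funM => //; apply: measurable_fsin; exact: patch_disc_integrable.
by apply/funext => xi; exact: fsin_trunc.
Qed.

Variables a1 b1 a2 b2 : R.
Hypotheses (ab1 : a1 < b1) (ab2 : a2 < b2).
Local Notation CQ := (CQ a1 b1 a2 b2).
Local Notation SQ := (SQ a1 b1 a2 b2).

(** A truncation of [v] to a disc is integrable, so [inversion_rect] applies to it. One factor
    [2 * pi] cancels against the normalisation of the transform. *)
Lemma trunc_inversion n : rect a1 b1 a2 b2 `<=` disc n ->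
  L2 setT (fourier_trunc_re v n) -> L2 setT (fourier_trunc_im v n) ->
  \int[mu]_xi (CQ xi * fourier_trunc_re v n xi - SQ xi * fourier_trunc_im v n xi) =
  2 * pi * \int[mu]_(x in rect a1 b1 a2 b2) v x.
Proof.
move=> sub Lc Ld; have mT : measurable [set: plane R] by [].
have pi0 : 2 * pi != 0 :> R by rewrite mulf_neq0// gt_eqF// pi_gt0.
have iG := integrableRB mT (L2_mul mT (CQ_L2 ab1 ab2) Lc) (L2_mul mT (SQ_L2 ab1 ab2) Ld).
have E xi : CQ xi * fcos (v \_ (disc n)) xi + SQ xi * fsin (v \_ (disc n)) xi =
  2 * pi * (CQ xi * fourier_trunc_re v n xi - SQ xi * fourier_trunc_im v n xi).
  rewrite fcos_trunc fsin_trunc -[LHS]mul1r -[X in X * _](mulfV pi0); ring.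
have iG' : mu.-integrable setT (EFin \o (fun xi =>
    CQ xi * fcos (v \_ (disc n)) xi + SQ xi * fsin (v \_ (disc n)) xi)).
  have := integrableRZ mT (2 * pi) iG; congr (_.-integrable _ (_ \o _)).
  by apply/funext => xi; rewrite E.
have := inversion_rect ab1 ab2 (patch_disc_integrable n) iG'.
under eq_Rintegral do rewrite E.
rewrite (RintegralZl _ mT iG) expr2 -(mulrA (2 * pi) (2 * pi)) => h; rewrite (mulfI pi0 h) {h}.
rewrite [in RHS]Rintegral_mkcond; congr (_ * _); apply: eq_Rintegral => x _.
rewrite chi_patch !patchE; case: ifPn => // /set_mem Rx.
by rewrite ifT//; apply/mem_set; exact: sub.
Qed.

(** The identity for truncations survives the limit in mean because [CQ] and [SQ] are square
    integrable. *)
Lemma fourier_inversion N : rect a1 b1 a2 b2 `<=` box N ->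
  \int[mu]_xi (CQ xi * a xi - SQ xi * b xi) =
  2 * pi * \int[mu]_(x in rect a1 b1 a2 b2) v x.
Proof.
move=> sub; have mT : measurable [set: plane R] by [].
have [LC LS] := (CQ_L2 ab1 ab2, SQ_L2 ab1 ab2).
set K := \int[mu]_x (CQ x ^+ 2) + \int[mu]_x (SQ x ^+ 2).
have K0 : 0 <= K by rewrite addr_ge0//; apply: Rintegral_ge0 => x _; exact: sqr_ge0.
apply/eqP; rewrite -subr_eq0 -normr_le0.
apply/ler_addgt0Pr => e e0; rewrite add0r.
(* When the squared error is below [eta ^+ 2], Young's bound is at most [(eta * K + eta) / 2], that
   is [e / 2]. *)
pose eta := e / (K + 1).
have eta0 : 0 < eta by rewrite divr_gt0// ltr_wpDl.
have [_ _ _ cv] := Fv.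
(* The index serves two purposes: the disc contains the box, hence the rectangle, and the truncated
   transform is close to its limit. *)
have [n [Nn hn]] : exists n, (N.*2 <= n)%N /\
  (L2normsq setT (fourier_trunc_re v n \- a)%R +
       L2normsq setT (fourier_trunc_im v n \- b)%R < (eta ^+ 2)%:E)%E.
  have h : nbhs (0%E : \bar R) [set x | (x < (eta ^+ 2)%:E)%E].
    by apply: open_nbhs_nbhs; split; [exact: open_ereal_lt_ereal|rewrite /= lte_fin exprn_gt0].
  have [M _ hM] := cv _ h.
  by exists (maxn N.*2 M); split; [exact: leq_maxl|apply: hM; exact: leq_maxr].
have nn (u : plane R -> R) : (0 <= L2normsq setT u)%E.
  by apply: integral_ge0 => x _; rewrite lee_fin sqr_ge0.
(* Square integrability of the truncated transforms is deduced from their finite distance to [a] and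
   [b]. *)
have Lu : L2 setT (fourier_trunc_re v n \- a)%R.
  split; first by apply: measurable_funB (measurable_trunc_re n) (L2_meas La).
  apply: le_lt_trans (lt_trans hn (ltry _)); exact: leeDl.
have Lw : L2 setT (fourier_trunc_im v n \- b)%R.
  split; first by apply: measurable_funB (measurable_trunc_im n) (L2_meas Lb).
  apply: le_lt_trans (lt_trans hn (ltry _)); exact: leeDr.
have Lc : L2 setT (fourier_trunc_re v n).
  by have := L2D mT Lu La; congr L2; apply/funext => x /=; rewrite subrK.
have Ld : L2 setT (fourier_trunc_im v n).
  by have := L2D mT Lw Lb; congr L2; apply/funext => x /=; rewrite subrK.
have sub' : rect a1 b1 a2 b2 `<=` disc n.
  move=> x /sub/box_sub_disc; rewrite /disc/= => /le_trans; apply.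
  by rewrite ler_nat.
rewrite -(trunc_inversion sub' Lc Ld) distrC.
have i1 := integrableRB mT (L2_mul mT LC Lc) (L2_mul mT LS Ld).
have i2 := integrableRB mT (L2_mul mT LC La) (L2_mul mT LS Lb).
rewrite -(RintegralB mT i1 i2).
under eq_Rintegral => x _.
  have -> : CQ x * fourier_trunc_re v n x - SQ x * fourier_trunc_im v n x - (CQ x * a x - SQ x * b x) =
    CQ x * (fourier_trunc_re v n \- a)%R x - SQ x * (fourier_trunc_im v n \- b)%R x by rewrite /=; ring.
  over.
apply: (le_trans (L2_pair_le eta0 LC LS Lu Lw)).
rewrite -/K; set J := \int[mu]_x _ + \int[mu]_x _.
have hJ : J <= eta ^+ 2.
  by move: hn; rewrite !L2normsqE// -EFinD lte_fin => /ltW.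
have : eta^-1 * J <= eta.
  by rewrite mulrC ler_pdivrMr// -expr2.
have : eta * (K + 1) = e by rewrite /eta mulfVK// gt_eqF// ltr_wpDl.
have : 0 <= eta * K by rewrite mulr_ge0// ltW.
move=> h1 he h2; have {}he : eta * K + eta = e by rewrite -he [RHS]mulrDr mulr1.
by rewrite -he; lra.
Qed.

End inverse_transform.

End fourier_uniqueness.

(** * The inverse Fourier integral and the bound by the Sobolev norm *)

Section sobolev_embedding.
Context {R : realType}.
Local Notation mu := (leb2 R).

Section inverse_integral.
Variables a b : plane R -> R.
Hypotheses (ia : mu.-integrable setT (EFin \o a)) (ib : mu.-integrable setT (EFin \o b)).

(** The real part of the inverse Fourier integral of [a + i b], bounded pointwise by the L^1 norms
    of [a] and [b]. *)
Definition ifourier (z : plane R) : R := (2 * pi)^-1 * (fcos a z - fsin b z).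

Let mT : measurable [set: plane R] := measurableT.

Lemma measurable_ifourier : measurable_fun setT ifourier.
Proof.
apply: measurable_funM => //.
by apply: measurable_funB; [exact: measurable_fcos|exact: measurable_fsin].
Qed.

Lemma fcos_bound z : `|fcos a z| <= \int[mu]_xi `|a xi|.
Proof.
have h := @integrable_bdmul _ _ _ leb2s _ _ 1 ia (measurable_cos_dotpr z) (fun z => cos_abs1 _).
apply: (le_trans (le_normr_Rintegral mT h)).
apply: (le_Rintegral mT (integrable_norm h) (integrable_norm ia)) => xi _.
by rewrite /= normrM; apply: ler_piMr; [exact: normr_ge0|exact: cos_abs1].
Qed.

Lemma fsin_bound z : `|fsin b z| <= \int[mu]_xi `|b xi|.
Proof.
have h := @integrable_bdmul _ _ _ leb2s _ _ 1 ib (measurable_sin_dotpr z) (fun z => sin_abs1 _).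
apply: (le_trans (le_normr_Rintegral mT h)).
apply: (le_Rintegral mT (integrable_norm h) (integrable_norm ib)) => xi _.
by rewrite /= normrM; apply: ler_piMr; [exact: normr_ge0|exact: sin_abs1].
Qed.

Lemma ifourier_bound z :
  `|ifourier z| <= (2 * pi)^-1 * (\int[mu]_xi `|a xi| + \int[mu]_xi `|b xi|).
Proof.
have pi0 : 0 <= (2 * pi)^-1 :> R by rewrite invr_ge0 mulr_ge0// pi_ge0.
rewrite /ifourier normrM (ger0_norm pi0); apply: (ler_wpM2l pi0).
by apply: (le_trans (ler_normB _ _)); apply: lerD; [exact: fcos_bound|exact: fsin_bound].
Qed.

(** Since [a] and [b] are integrable, Fubini moves the trigonometric kernel directly onto the
    rectangle. The value is the one that [fourier_inversion] gives for [v]. *)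
Lemma ifourier_rect a1 b1 a2 b2 : a1 < b1 -> a2 < b2 ->
  2 * pi * \int[mu]_(x in rect a1 b1 a2 b2) ifourier x =
  \int[mu]_xi (CQ a1 b1 a2 b2 xi * a xi - SQ a1 b1 a2 b2 xi * b xi).
Proof.
move=> ab1 ab2.
have pi0 : 2 * pi != 0 :> R by rewrite mulf_neq0// gt_eqF// pi_gt0.
have ic := chi_integrable a1 b1 a2 b2.
have [M hM] := CQ_bound ab1 ab2.
have m1 : measurable_fun setT (fun w : plane R * plane R => cos (dotp w.2 w.1)).
  by under eq_fun do rewrite dotpC; exact: measurable_cos_dotp.
have m2 : measurable_fun setT (fun w : plane R * plane R => sin (dotp w.2 w.1)).
  by under eq_fun do rewrite dotpC; exact: measurable_sin_dotp.
have F1 := @Rfubini_kernel _ _ _ _ R leb2s leb2s _ a _ 1 ic ia m1 (fun w => cos_abs1 _).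
have F2 := @Rfubini_kernel _ _ _ _ R leb2s leb2s _ b _ 1 ic ib m2 (fun w => sin_abs1 _).
have iA := @integrable_bdmul _ _ _ leb2s _ _ M ia (measurable_CQ a1 b1 a2 b2) (fun x => (hM x).1).
have iB := @integrable_bdmul _ _ _ leb2s _ _ M ib (measurable_SQ a1 b1 a2 b2) (fun x => (hM x).2).
have iwc := @integrable_bdmul _ _ _ leb2s _ _ _ ic (measurable_fcos ia) fcos_bound.
have iws := @integrable_bdmul _ _ _ leb2s _ _ _ ic (measurable_fsin ib) fsin_bound.
have E1 : \int[mu]_xi (a xi * CQ a1 b1 a2 b2 xi) = \int[mu]_z (chi a1 b1 a2 b2 z * fcos a z).
  etransitivity; last exact: (esym F1).
  apply: eq_Rintegral => xi _; congr (_ * _); apply: eq_Rintegral => z _.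
  by rewrite dotpC.
have E2 : \int[mu]_xi (b xi * SQ a1 b1 a2 b2 xi) = \int[mu]_z (chi a1 b1 a2 b2 z * fsin b z).
  etransitivity; last exact: (esym F2).
  apply: eq_Rintegral => xi _; congr (_ * _); apply: eq_Rintegral => z _.
  by rewrite dotpC.
rewrite Rintegral_mkcond.
have -> : \int[mu]_x (ifourier \_ (rect a1 b1 a2 b2)) x =
    \int[mu]_z ((2 * pi)^-1 * (chi a1 b1 a2 b2 z * fcos a z - chi a1 b1 a2 b2 z * fsin b z)).
  by apply: eq_Rintegral => z _; rewrite -chi_patch /ifourier; ring.
have -> : \int[mu]_xi (CQ a1 b1 a2 b2 xi * a xi - SQ a1 b1 a2 b2 xi * b xi) =
    \int[mu]_xi (a xi * CQ a1 b1 a2 b2 xi - b xi * SQ a1 b1 a2 b2 xi).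
  by apply: eq_Rintegral => xi _; rewrite [X in X - _]mulrC [X in _ - X]mulrC.
rewrite (RintegralB mT iA iB) E1 E2 -(RintegralB mT iwc iws).
rewrite (RintegralZl _ mT (integrableRB mT iwc iws)) mulrA (mulfV pi0).
exact: mul1r.
Qed.

End inverse_integral.

(** Both functions have the same integral over each rectangle in each box, hence agree almost
    everywhere there; countably many boxes cover the plane. *)
Lemma ifourier_ae v a b : is_fourier v a b ->
  mu.-integrable setT (EFin \o a) -> mu.-integrable setT (EFin \o b) ->
  {ae mu, forall x, v x = ifourier a b x}.
Proof.
move=> Fv ia ib; have [Lv _ _ _] := Fv.
have pi0 : 2 * pi != 0 :> R by rewrite mulf_neq0// gt_eqF// pi_gt0.
have H N : {ae mu, forall x, box N x -> v x - ifourier a b x = 0}.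
  have mB := @measurable_box R N.
  have iv : mu.-integrable (box N) (EFin \o v).
    by apply: L2_L1 => //; [exact: leb2_box_fin|apply: (L2S mB measurableT) => //].
  have iw : mu.-integrable (box N) (EFin \o ifourier a b).
    apply: L2_L1 => //; first exact: leb2_box_fin.
    apply: (L2_bounded mB (leb2_box_fin N)) => [|x _]; last exact: ifourier_bound.
    apply: measurable_funTS; exact: measurable_ifourier.
  apply: ae0_of_rects; first exact: integrableRB.
  move=> a1 b1 a2 b2 sub.
  have mR := measurable_rect a1 b1 a2 b2.
  have iv' := integrableS mB mR sub iv; have iw' := integrableS mB mR sub iw.
  rewrite (RintegralB mR iv' iw').
  have [ab1|ba1] := ltP a1 b1; last first.
    by rewrite /rect (_ : `]a1, b1]%classic = set0) ?set0X ?Rintegral_set0 ?subrr// set_itv_ge// bnd_simp -leNgt.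
  have [ab2|ba2] := ltP a2 b2; last first.
    by rewrite /rect (_ : `]a2, b2]%classic = set0) ?setX0 ?Rintegral_set0 ?subrr// set_itv_ge// bnd_simp -leNgt.
  apply/eqP; rewrite subr_eq0; apply/eqP/(mulfI pi0).
  by rewrite ifourier_rect// (fourier_inversion Fv ab1 ab2 sub).
have [Z hZ] := choice H.
have : mu.-negligible (\bigcup_N [set x | ~ (box N x -> v x - ifourier a b x = 0)]).
  exact: negligible_bigcup.
apply: negligibleS => x /= hx.
have [N _ hN] : (\bigcup_n box n) x by rewrite (@bigcup_box R).
by exists N => //= h; apply: hx; apply/eqP; rewrite -subr_eq0; apply/eqP; exact: h.
Qed.

Lemma sobolev_Linfty (s : R) : 1 < s -> exists C0 : R, forall v a b (K : R),
  is_fourier v a b -> (Hs_weight s a b <= K%:E)%E ->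
  {ae mu, forall x, `|v x| <= (2 * pi)^-1 * (2^-1 * K + C0)}.
Proof.
move=> s1; exists (\int[mu]_xi tw s xi) => v a b K Fv hK.
have [_ [ma _] [mb _] _] := Fv.
have ia := weight_L1l s1 ma mb hK; have ib := weight_L1r s1 ma mb hK.
apply: ae_imp (ifourier_ae Fv ia ib) => x ->.
apply: (le_trans (ifourier_bound ia ib x)); apply: ler_wpM2l.
  by rewrite invr_ge0 mulr_ge0// pi_ge0.
exact: weight_L1_bound.
Qed.

End sobolev_embedding.

(** * Derivative of the smoothed Heaviside function *)

Section smoothed_heaviside.
Context {R : realType}.

(** A quadratic error bound handles the kink of a truncated power together with all other points. *)
Lemma is_derive_quad (f : R -> R) (x d K : R) :
  (forall h, `|h| <= 1 -> `|f (x + h) - f x - h * d| <= K * h ^+ 2) -> is_derive x (1 : R) f d.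
Proof.
move=> H.
have K0 : 0 <= K.
  by have := H 1; rewrite normr1 lexx expr1n mulr1 => /(_ isT); apply: le_trans.
have c : h^-1 *: (f (h *: (1 : R) + x) - f x) @[h --> 0^'] --> d.
  apply/cvgrPdist_le => e e0; near=> h.
  have h0 : h != 0 by near: h; exact: nbhs_dnbhs_neq.
  have h1 : `|h| <= Num.min 1 (e / (K + 1)).
    near: h; apply: dnbhs0_le.
    by rewrite lt_min ltr01 divr_gt0// ltr_wpDl.
  move: h1; rewrite le_min => /andP[h1 h2].
  have -> : d - h^-1 *: (f (h *: (1 : R) + x) - f x) = - (h^-1 * (f (x + h) - f x - h * d)).
    by rewrite /GRing.scale/= mulr1 (addrC h x); field.
  rewrite normrN normrM normfV ler_pdivrMl ?normr_gt0//.
  apply: (le_trans (H _ h1)); rewrite -(real_normK (num_real h)) expr2 mulrCA ler_wpM2l//.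
  move: h2; rewrite ler_pdivlMr ?ltr_wpDl// => h2; have := normr_ge0 h; nra.
apply: DeriveDef; first by apply/cvg_ex; exists d.
exact: cvg_lim.
Unshelve. all: by end_near.
Qed.

Lemma is_derive_pos2 (c y : R) :
  is_derive y (1 : R) (fun t : R => Num.max (t - c) 0 ^+ 2) (2 * Num.max (y - c) 0).
Proof.
apply: (@is_derive_quad _ _ _ 1) => h _.
rewrite (addrAC y h); move: (y - c) => x.
rewrite ler_norml; case: (leP x 0) => hx; case: (leP (x + h) 0) => hh; apply/andP; split; nra.
Qed.

Lemma is_derive_pos3 (c y : R) :
  is_derive y (1 : R) (fun t : R => Num.max (t - c) 0 ^+ 3) (3 * Num.max (y - c) 0 ^+ 2).
Proof.
apply: (@is_derive_quad _ _ _ (3 * Num.max (y - c) 0 + 1)) => h.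
rewrite (addrAC y h); move: (y - c) => x.
rewrite !ler_norml => /andP[h1 h2]; case: (leP x 0) => hx; case: (leP (x + h) 0) => hh.
- by apply/andP; split; nra.
- have : 0 <= (x + h) ^+ 3 by rewrite exprn_ge0// ltW.
  have : (x + h) ^+ 3 <= h ^+ 2.
    have : (x + h) ^+ 2 <= h ^+ 2 by rewrite ler_sqr ?nnegrE; lra.
    have -> : (x + h) ^+ 3 = (x + h) ^+ 2 * (x + h) by ring.
    by have := sqr_ge0 (x + h); nra.
  have -> : (0 : R) ^+ 2 = 0 by rewrite expr2 mulr0.
  have -> : (0 : R) ^+ 3 = 0 by rewrite exprS mul0r.
  by move=> *; apply/andP; split; nra.
- have x3 : 0 <= x ^+ 3 by rewrite exprn_ge0// ltW.
  have -> : (0 : R) ^+ 3 = 0 by rewrite exprS mul0r.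
  have hx1 : x <= - h by lra.
  have e1 : 0 - x ^+ 3 - h * (3 * x ^+ 2) = x ^+ 2 * (- 3 * h - x) by ring.
  rewrite e1; have : 0 <= x ^+ 2 * (- 3 * h - x) by rewrite mulr_ge0 ?sqr_ge0//; lra.
  have : x ^+ 2 * (- 3 * h - x) <= (3 * x + 1) * h ^+ 2.
    have -> : x ^+ 2 * (- 3 * h - x) = x * (x * (- 3 * h - x)) by ring.
    have : x * (- 3 * h - x) <= 3 * h ^+ 2 by nra.
    move=> hq; have := ler_wpM2l (ltW hx) hq; have := sqr_ge0 h; lra.
  by move=> *; apply/andP; split; have := sqr_ge0 h; nra.
- have -> : (x + h) ^+ 3 - x ^+ 3 - h * (3 * x ^+ 2) = (3 * x + h) * h ^+ 2 by ring.
  have := sqr_ge0 h; move=> s0; apply/andP; split; last by rewrite ler_wpM2r//; lra.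
  by rewrite -mulNr ler_wpM2r//; lra.
Qed.

Variable eps : R.
Hypothesis eps0 : 0 < eps.

Lemma Heps_ge0 v : 0 <= Heps eps v.
Proof.
rewrite /Heps; case: (leP v 0) => // h1; case: (ltP v eps) => // h2.
apply: divr_ge0; last by rewrite exprn_ge0// ltW.
by apply: mulr_ge0; [exact: sqr_ge0|lra].
Qed.

(** As a spline in the truncated powers with knots 0 and [eps], the function can be differentiated
    without gluing its three pieces. *)
Lemma Heps_posE v : Heps eps v = (eps ^+ 3)^-1 *
  (3 * eps * Num.max (v - 0) 0 ^+ 2 + -2 * Num.max (v - 0) 0 ^+ 3 +
   (3 * eps * Num.max (v - eps) 0 ^+ 2 + 2 * Num.max (v - eps) 0 ^+ 3)).
Proof.
have e3 : eps != 0 by rewrite gt_eqF.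
have e0 := eps0; rewrite /Heps subr0; case: (leP v 0) => h1.
  have -> : Num.max (v - eps) 0 = 0 by rewrite max_r//; lra.
  by rewrite !expr0n/=; ring.
case: (ltP v eps) => h2.
  have -> : Num.max (v - eps) 0 = 0 by rewrite max_r//; lra.
  by rewrite !expr0n/=; field.
have -> : Num.max (v - eps) 0 = v - eps by rewrite max_l//; lra.
by field.
Qed.

Definition dHeps v : R := (eps ^+ 3)^-1 *
  (3 * eps * (2 * Num.max (v - 0) 0) + -2 * (3 * Num.max (v - 0) 0 ^+ 2) +
   (3 * eps * (2 * Num.max (v - eps) 0) + 2 * (3 * Num.max (v - eps) 0 ^+ 2))).

Lemma is_derive_Heps v : is_derive v (1 : R) (Heps eps) (dHeps v).
Proof.
rewrite (_ : Heps eps = (fun v => (eps ^+ 3)^-1 *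
  (3 * eps * Num.max (v - 0) 0 ^+ 2 + -2 * Num.max (v - 0) 0 ^+ 3 +
   (3 * eps * Num.max (v - eps) 0 ^+ 2 + 2 * Num.max (v - eps) 0 ^+ 3)))); last first.
  by apply/funext => u; exact: Heps_posE.
have p2 := is_derive_pos2; have p3 := is_derive_pos3.
apply: is_deriveZ; apply: is_deriveD; apply: is_deriveD; exact: is_deriveZ.
Qed.

Lemma derive1_Heps : derive1 (Heps eps) = dHeps.
Proof. by apply/funext => v; have := is_derive_Heps v => h; rewrite derive1E derive_val. Qed.

Lemma dHeps_ge0 v : 0 <= dHeps v.
Proof.
apply: mulr_ge0; first by rewrite invr_ge0 exprn_ge0// ltW.
have e0 := eps0; rewrite subr0; case: (leP v 0) => h1.
  have -> : Num.max (v - eps) 0 = 0 by rewrite max_r//; lra.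
  by rewrite !expr0n/=; lra.
case: (leP (v - eps) 0) => h2; first by rewrite !expr0n/=; nra.
by rewrite le_eqVlt; apply/orP; left; apply/eqP; ring.
Qed.

Lemma measurable_dHeps : measurable_fun setT dHeps.
Proof.
have m (c : R) : measurable_fun setT (fun v : R => Num.max (v - c) 0).
  by apply: measurable_maxr => //; exact: measurable_funB.
apply: measurable_funM => //; apply: measurable_funD; apply: measurable_funD;
  apply: measurable_funM => //; apply: measurable_funM => //; exact: measurable_funX.
Qed.

End smoothed_heaviside.

(** * Sign of the states *)

Section state_sign.
Context {R : realType}.
Local Notation mu := (leb2 R).

(** The strict inequality yields an actual extension to the plane of weight below [K], even if the
    infimum in the quotient norm is not attained; the bound for the extension restricts to [A]. *)
Lemma Hs_Linfty (s : R) : 1 < s -> exists C0 : R, forall A u (K : R),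
  (Hsnormsq s A u < K%:E)%E ->
  {ae mu, forall x, A x -> `|u x| <= (2 * pi)^-1 * (2^-1 * K + C0)}.
Proof.
move=> s1; have [C0 HC] := sobolev_Linfty s1; exists C0 => A u K.
move=> /ereal_inf_lt[_ [v [a [b [Fv vu ->]]]] wK].
have := ae_and (HC _ _ _ K Fv (ltW wK)) vu.
by apply: ae_imp => x [h1 h2] Ax; rewrite -h2.
Qed.

Lemma state_nonpos (D : set (plane R)) (beta : R -> R) f (eps : R) g y :
  open D -> bounded_set D -> {homo beta : u v / u <= v} -> 0 < eps ->
  is_state D beta f eps g y ->
  {ae mu, forall x, D x -> f x + eps * g x <= beta 0} ->
  {ae mu, forall x, D x -> y x <= 0}.
Proof.
move=> oD bD hb e0 [[p [Ly hp] [phi tphi cv]] [h [p' [_ hp'] hh] eqn]] rhs.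
have mD := open_measurable2 oD; have fD := bounded_leb2_fin mD bD.
have Lh i : L2 D (h i i) by have [_ /(_ i) []] := hh i.
have LF : L2 D (fun x => - (\sum_(i < 2) h i i x)).
  have := L2Z mD (-1) (L2D mD (Lh ord0) (Lh (lift ord0 ord0))); congr L2.
  by apply/funext => x; rewrite sum_ord2 mulN1r.
apply: (weak_max_principle oD bD Ly LF (fun i => (hp i).1) tphi cv) => [psi tpsi|].
  have Lpsi := test_fun_L2 mD fD tpsi.
  (* [p] comes from membership in [H1_0], [p'] from the H^2 regularity. As weak gradients of the
     same [y] they agree when tested with [derive psi], which lets the Hessian [h] be paired with
     [psi]. *)
  have E i : \int[mu]_(x in D) (p i x * derive psi x (basis i)) = - \int[mu]_(x in D) (h i i x * psi x).
    have tdi := test_fun_derive i tpsi.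
    have := (hp i).2 _ tdi; rewrite ((hp' i).2 _ tdi) => /oppr_inj <-.
    by have [_ /(_ i) [_ /(_ _ tpsi)]] := hh i.
  have i0 := L2_mul mD (Lh ord0) Lpsi; have i1 := L2_mul mD (Lh (lift ord0 ord0)) Lpsi.
  rewrite sum_ord2 !E -opprD -(RintegralD mD i0 i1) -[RHS]mulN1r -(RintegralZl _ mD (integrableRD mD i0 i1)).
  by apply: eq_Rintegral => x _; rewrite sum_ord2; ring.
apply: ae_imp (ae_and eqn rhs) => x [h1 h2] Dx y0.
have := h1 Dx; have := h2 Dx; have := hb _ _ (ltW y0).
have : 0 <= eps^-1 * Heps eps (g x) * y x.
  by apply: mulr_ge0 (ltW y0); apply: mulr_ge0; [rewrite invr_ge0 ltW|exact: Heps_ge0].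
lra.
Qed.

(** The theorem asks for a threshold on [eps n], whereas convergence gives one on the index: a value
    below the first [N] terms forces [n >= N]. *)
Lemma positive_seq_lb (eps : nat -> R) (N : nat) : (forall n, 0 < eps n) ->
  exists2 m : R, 0 < m & forall n, (n < N)%N -> m <= eps n.
Proof.
move=> e0; elim: N => [|N [m m0 hm]]; first by exists 1.
exists (Num.min m (eps N)); first by rewrite lt_min m0 e0.
move=> n; rewrite ltnS leq_eqVlt => /orP[/eqP ->|nN]; rewrite ge_min ?lexx ?orbT//.
by rewrite hm.
Qed.

Lemma negligible_ae_not (A : set (plane R)) : measurable A -> mu A = 0%E -> {ae mu, forall x, ~ A x}.
Proof. by move=> mA A0; exists A; split => // x /= /contrapT. Qed.

Lemma ess_sup_on_le (A : set (plane R)) u (c : R) : (ess_sup_on A u <= c%:E)%E ->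
  {ae mu, forall x, A x -> u x <= c}.
Proof.
by move=> /ess_supP; apply: ae_imp => x /= + Ax; rewrite mem_set// lee_fin.
Qed.

Lemma lte_fin_gap (x : \bar R) (c : R) : (x < c%:E)%E -> exists2 d : R, 0 < d & (x <= (c - d)%:E)%E.
Proof.
case: x => [r||] //; last by exists 1 => //; rewrite leNye.
by rewrite lte_fin => h; exists (c - r); [rewrite subr_gt0|rewrite lee_fin; lra].
Qed.

End state_sign.

Theorem corollary4p2 (R : realType) (D E : set (plane R))
    (f yd gsh : plane R -> R) (alpha s : R) (beta : R -> R)
    (S : R -> (plane R -> R) -> (plane R -> R))
    (eps : nat -> R) (gbar : nat -> plane R -> R)
    (domD : domain D) (bndD : bounded_set D) (C11D : class_C11 D)
    (fL2 : L2 D f) (alpha_ge0 : 0 <= alpha)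
    (domE : domain E) (subE : E `<=` D) (bdE : leb2 R (boundary E) = 0%E)
    (distE : (0 < set_dist (closure E) (boundary D))%E)
    (ydL2 : L2 E yd) (s_gt1 : 1 < s)
    (gshF : F_ad s D E gsh)
    (hbeta : beta_assumptions beta)
    (hS : solution_operator D beta f S)
    (fE : (ess_sup_on E f <= (beta 0)%:E)%E)
    (fDE : (ess_sup_on (D `\` closure E) f < (beta 0)%:E)%E)
    (eps_gt0 : forall n, 0 < eps n) (eps_cvg : eps n @[n --> \oo] --> 0)
    (gbar_min : forall n,
       local_minimizer alpha s D E yd gsh S (eps n) (gbar n))
    (gbar_cvg : exists2 g, W s D E g &
       Wnormsq s D E (gbar n \- g)%R @[n --> \oo] --> 0%E) :
  exists2 eps0 : R, 0 < eps0 & forall n, eps n < eps0 ->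
    let ybar := S (eps n) (gbar n) in
    let q := fun x => (eps n)^-1 * derive1 (Heps (eps n)) (gbar n x) * ybar x
                      - eps n in
    (leb2 R).-negligible [set x | (D `\` closure E) x /\ q x = 0] /\
    (\int[leb2 R]_(x in D `\` closure E) ((`|q x| ^+ 2)^-1)%:E < +oo)%E.
Proof.
have [_ oD _] := domD; have [_ oE _] := domE; have [bmono _ _ _] := hbeta.
have [g [_ [_ gHs]] gcv] := gbar_cvg.
have [C0 HC] := Hs_Linfty s_gt1.
have mD := open_measurable2 oD.
have mA : measurable (D `\` closure E).
  by apply: measurableD => //; apply: closed_measurable2; exact: closed_closure.
have fA : (leb2 R (D `\` closure E) < +oo)%E.
  apply: le_lt_trans (bounded_leb2_fin mD bndD); apply: le_measure; rewrite ?inE//.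
have [K hK] : exists K : R, (Hsnormsq s (D `\` closure E) g < K%:E)%E.
  case: (Hsnormsq _ _ _) gHs => [r||] // _; first by exists (r + 1); rewrite lte_fin ltrDl.
  by exists 0; rewrite ltNyr.
have gB := HC _ _ _ hK.
have [N hN] : exists N, forall n, (N <= n)%N ->
    (Hsnormsq s (D `\` closure E) (gbar n \- g)%R < 1%:E)%E.
  have h : nbhs (0%E : \bar R) [set x | (x < 1%:E)%E].
    by apply: open_nbhs_nbhs; split; [exact: open_ereal_lt_ereal|rewrite /= lte_fin].
  have [M _ hM] := gcv _ h; exists M => n Mn.
  apply: le_lt_trans (hM n Mn); apply: leeDr.
  by apply: integral_ge0 => x _; rewrite lee_fin sqr_ge0.
(* The bounds for [gbar n - g], with squared norm below 1, and for the limit [g], with squared norm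
   below [K], are added. *)
set C := (2 * pi)^-1 * (2^-1 * 1 + C0) + (2 * pi)^-1 * (2^-1 * K + C0).
have gbarC n : (N <= n)%N -> {ae leb2 R, forall x, (D `\` closure E) x -> gbar n x <= C}.
  move=> Nn; apply: ae_imp (ae_and (HC _ _ _ (hN n Nn)) gB) => x [h1 h2] Ax.
  have := h1 Ax; have := h2 Ax; rewrite /= !ler_norml => /andP[_ h3] /andP[_ h4].
  by rewrite /C; lra.
have [d d0 /ess_sup_on_le fd] := lte_fin_gap fDE.
have [m m0 hm] := positive_seq_lb N eps_gt0.
have C1 : 0 < `|C| + 1 by rewrite ltr_wpDl.
(* The bound [m] forces [n >= N]; the other one makes [eps n * C] at most the gap [d] between [f]
   and [beta 0]. The [+ 1] covers [C = 0]. *)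
exists (Num.min m (d / (`|C| + 1))); first by rewrite lt_min m0 divr_gt0.
move=> n; rewrite lt_min => /andP[nm nd] ybar q.
have e0 := eps_gt0 n.
have Nn : (N <= n)%N by rewrite leqNgt; apply/negP => /hm; rewrite leNgt nm.
have [[[gL2 _] gE] _] := gbar_min n.
have st : is_state D beta f (eps n) (gbar n) ybar by exact: hS.
(* The two bounds on [f] concern [E] and the complement of its closure; what they leave out of [D]
   lies in the boundary of [E], a null set. *)
have bdN : {ae leb2 R, forall x, ~ boundary E x}.
  apply: negligible_ae_not => //; apply: measurableD.
    by apply: closed_measurable2; exact: closed_closure.
  by apply: open_measurable2; exact: open_interior.
have rhs : {ae leb2 R, forall x, D x -> f x + eps n * gbar n x <= beta 0}.
  have h1 := ae_and (ess_sup_on_le fE) gE; have h2 := ae_and fd (gbarC n Nn).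
  apply: ae_imp (ae_and bdN (ae_and h1 h2)) => x [nb [[h3 h4] [h5 h6]]] Dx.
  have [Ex|nEx] := pselect (E x).
    by have := h3 Ex; have := h4 Ex; nra.
  have Ax : (D `\` closure E) x.
    by split => // cx; apply: nb; split => // /interior_subset.
  have := h5 Ax; have := h6 Ax; move: nd; rewrite ltr_pdivlMr// => nd.
  by have := ler_norm C; nra.
have yneg := state_nonpos oD bndD bmono e0 st rhs.
have qneg : {ae leb2 R, forall x, (D `\` closure E) x -> q x <= - eps n}.
  apply: ae_imp yneg => x hx [Dx _]; rewrite /q derive1_Heps//.
  have := hx Dx; rewrite -/ybar => y0.
  have : (eps n)^-1 * dHeps (eps n) (gbar n x) * ybar x <= 0.
    apply: mulr_ge0_le0 => //; apply: mulr_ge0; first by rewrite invr_ge0 ltW.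
    exact: dHeps_ge0.
  lra.
split.
  apply: negligibleS qneg => x [Ax q0] /= /(_ Ax); rewrite q0; lra.
have mq : measurable_fun (D `\` closure E) q.
  have AD : D `\` closure E `<=` D by exact: subDsetl.
  have [[p [[my _] _] _] _] := st.
  apply: measurable_funB; last exact: measurable_cst.
  apply: measurable_funM; last exact: measurable_funS my.
  apply: measurable_funM; first exact: measurable_cst.
  rewrite derive1_Heps//; apply: (measurableT_comp (measurable_dHeps (eps n))).
  by apply: measurable_funS (L2_meas gL2).
apply: (@le_lt_trans _ _ (\int[leb2 R]_(x in D `\` closure E) ((eps n ^+ 2)^-1)%:E)%E); last first.
  by rewrite integral_cst// lte_mul_pinfty// ?lee_fin ?invr_ge0 ?sqr_ge0.
apply: ae_ge0_le_integral => //.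
- apply/measurable_EFinP.
  under eq_fun do rewrite -powR_inv1 ?sqr_ge0//.
  apply: (measurableT_comp (measurable_powR _)); apply: measurable_funX.
  exact: measurableT_comp.
- by move=> x _; rewrite lee_fin invr_ge0 sqr_ge0.
apply: ae_imp qneg => x hx Ax; rewrite lee_fin; have := hx Ax => qx.
have qn : eps n <= `|q x| by rewrite ler_normr; apply/orP; right; lra.
rewrite lef_pV2 ?posrE ?exprn_gt0//; last exact: lt_le_trans qn.
by rewrite ler_sqr ?nnegrE// ltW.
Qed.
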